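(* Let $(M,g)$ be a complete, connected and non-compact Riemannian manifold whose sectional curvature is bounded from below by $-\beta^2$, and whose geodesic flow $\phi^t: SM \to SM$ is Anosov with respect to the Sasaki metric with constants $k, C > 0$. Let $\sigma = \sigma(\beta,k,C) > 0$ be the constant, depending only on $\beta, k, C$, described in the context. Assume that the following three conditions are satisfied: (1) For every $v \in SM$ there exists an open neighborhood $U(v) \subset SM$ of $v$ such that $\lim_{t\to\infty} d(c(0),c(t)) = \infty$ uniformly for all geodesics $c:\mathbb{R} \to M$ with $\dot c(0) \in U(v)$. (2) There exists a compact set $K \subset M$ such that for all $p \in M \setminus K$ and all unit speed geodesics $c$ with $c(0)=p$, the segment $c:[-1,\sigma] \to M$ has no conjugate points. (3) There exists at least one geodesic $c:\mathbb{R}\to M$ without conjugate points. Then $(M,g)$ has no conjugate points, i.e. no geodesic $c:\mathbb{R}\to M$ has conjugate points.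
   Context: Notation. $SM=\{v\in TM : \|v\|=1\}$ is the unit tangent bundle, $\pi: TM\to M$ the projection, $d$ the Riemannian distance on $M$, $c_v$ the geodesic with $\dot c_v(0)=v$, $\phi^t(v)=\dot c_v(t)$ the geodesic flow, and $X_G$ the vector field on $SM$ generating it. Geodesics are parametrized by unit speed. Using the splitting of $T_vTM$ into horizontal and vertical parts, $T_vSM=\{(x,y): x,y\in T_{\pi(v)}M,\ y\perp v\}$, and $V(v)=\{(0,y): y \perp v\}\subset T_vSM$ is the vertical space. The Sasaki metric is $g_S((x_1,y_1),(x_2,y_2))=\langle x_1,x_2\rangle+\langle y_1,y_2\rangle$, and $\|\cdot\|$ denotes the norm it induces on $TSM$. Anosov. The geodesic flow is Anosov (with respect to the Sasaki metric) with constants $k,C>0$ if there is a splitting $T_vSM=E^s(v)\oplus E^u(v)\oplus E^\phi(v)$ for all $v\in SM$ with $E^\phi(v)=\mathrm{span}\{X_G(v)\}$ such that for all $t\ge 0$: $\|D\phi^t(v)\xi\|\le Ce^{-kt}\|\xi\|$ for all $\xi\in E^s(v)$, and $\|D\phi^{-t}(v)\xi\|\le Ce^{-kt}\|\xi\|$ for all $\xi\in E^u(v)$. Conjugate points. A geodesic has conjugate points on an interval $I$ if there are $a<b$ in $I$ and a non-trivial Jacobi field along the geodesic vanishing at $a$ and at $b$. A geodesic without conjugate points is one having no conjugate points on $\mathbb{R}$. The constant $\sigma$. It is a known result that there is a constant $\sigma=\sigma(\beta,k,C)$ with the following property: for every complete Riemannian manifold with sectional curvature bounded from below by $-\beta^2$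 whose geodesic flow $\phi^t$ is Anosov with respect to the Sasaki metric with constants $k,C$ (that is, the tangent space of its unit tangent bundle at every unit tangent vector $v$ splits as $E^s(v)\oplus E^u(v)\oplus E^\phi(v)$, where $E^\phi(v)$ is spanned by the generator of the geodesic flow at $v$, and for all $t\ge 0$ one has $\|D\phi^t(v)\xi\|\le Ce^{-kt}\|\xi\|$ for all $\xi\in E^s(v)$ and $\|D\phi^{-t}(v)\xi\|\le Ce^{-kt}\|\xi\|$ for all $\xi\in E^u(v)$), and for every unit tangent vector $v$ of it, if $E^s(v)\cap V(v)\neq\{0\}$, then the geodesic $c_v$ has conjugate points on the interval $[-1,\sigma]$. The constant $\sigma(\beta,k,C)$ in the claim is a fixed constant with this property. *)

(* Defs.v *)
From HB Require Import structures.
From mathcomp Require Import all_boot all_order all_algebra.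
From mathcomp Require Import all_classical all_reals all_analysis.
Set Implicit Arguments.
Unset Strict Implicit.
Unset Printing Implicit Defensive.
Import Order.TTheory GRing.Theory Num.Theory.
Import numFieldNormedType.Exports.
Local Open Scope classical_set_scope.
Local Open Scope ring_scope.

Section Smooth.
Context {R : realType} {V W : normedModType R}.

(* For an open subset U of a finite-dimensional V, the usual class C^k. *)
Fixpoint Ck (k : nat) (U : set V) (f : V -> W) : Prop :=
  (forall x, U x -> {for x, continuous f}) /\
  if k is k'.+1 then
    forall v : V, (forall x, U x -> derivable f x v) /\
                  Ck k' U (fun x => 'D_v f x)
  else True.

Definition smooth (U : set V) (f : V -> W) : Prop := forall k, Ck k U f.

End Smooth.

(* A smooth manifold is presented by a smooth atlas indexed by its own points:
   [chart p] is a chart around p, with domain [dom p] and inverse [ichart p];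
   outside [dom p], resp. its image, the values of these maps are irrelevant.
   The dimension 0 is allowed. *)
Record manifold (R : realType) (n : nat) := Manifold {
  points :> topologicalType;
  dom : points -> set points;
  chart : points -> points -> 'rV[R]_n;
  ichart : points -> 'rV[R]_n -> points;
  points_hausdorff : hausdorff_space points;
  points_second_countable : @second_countable points;
  dom_center : forall p, dom p p;
  dom_open : forall p, open (dom p);
  chart_open : forall p, open (chart p @` dom p);
  chartK : forall p q, dom p q -> ichart p (chart p q) = q;
  chart_continuous : forall p q, dom p q -> {for q, continuous (chart p)};
  ichart_continuous : forall p x,
    (chart p @` dom p) x -> {for x, continuous (ichart p)};
  chart_smooth : forall p q,
    smooth (chart p @` (dom p `&` dom q)) (chart q \o ichart p)
}.
Arguments dom {R n} m p _ : rename.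
Arguments chart {R n m} p q : rename.
Arguments ichart {R n m} p x : rename.

Section Tangent.
Context {R : realType} {n : nat} {M : manifold R n}.

(* A vector of T_pM is given by its coordinates in the chart [chart p]. *)
Definition TM : Type := (M * 'rV[R]_n)%type.

(* Coordinates in [chart q] of the vector v of T_pM. *)
Definition tcoord (q p : M) (v : 'rV[R]_n) : 'rV[R]_n :=
  'D_v (chart q \o ichart p) (chart p p).

(* The vector at the point x of [chart q] with coordinates w in [chart q]. *)
Definition tvec (q : M) (x w : 'rV[R]_n) : 'rV[R]_n :=
  'D_w (chart (ichart q x) \o ichart q) x.

Definition TM_open (W : set TM) : Prop := forall q : M,
  open [set y : 'rV[R]_n * 'rV[R]_n |
    (chart q @` dom M q) y.1 /\ W (ichart q y.1, tvec q y.1 y.2)].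

Definition curve_derivable (c : R -> M) (t : R) : Prop :=
  {for t, continuous c} /\ derivable (chart (c t) \o c) t 1.

Definition velocity (c : R -> M) (t : R) : 'rV[R]_n :=
  derive1 (chart (c t) \o c) t.

Definition velocity_lift (c : R -> M) (t : R) : TM := (c t, velocity c t).

(* Vector fields X along c, with X t in T_(c t)M. *)
Definition field_continuous (c : R -> M) (X : R -> 'rV[R]_n) (t : R) : Prop :=
  {for t, continuous (fun s => tcoord (c t) (c s) (X s))}.

Definition field_derivable (c : R -> M) (X : R -> 'rV[R]_n) (t : R) : Prop :=
  derivable (fun s => tcoord (c t) (c s) (X s)) t 1.

Definition C1_curve (c : R -> M) : Prop :=
  forall t, curve_derivable c t /\ field_continuous c (velocity c) t.

End Tangent.
Arguments TM {R n} M.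

(* [gram p] is the Gram matrix of the inner product of T_pM. *)
Record riemannian_metric (R : realType) (n : nat) (M : manifold R n) :=
  RiemannianMetric {
  gram : M -> 'M[R]_n;
  gram_sym : forall p, (gram p)^T = gram p;
  gram_pos : forall p (v : 'rV[R]_n), v != 0 ->
    0 < (v *m gram p *m v^T) 0 0;
  gram_smooth : forall (q : M) (i j : 'I_n),
    smooth (chart q @` dom M q) (fun x : 'rV[R]_n =>
      (tvec q x (delta_mx 0 i) *m gram (ichart q x) *m
        (tvec q x (delta_mx 0 j))^T) 0 0 : R)
}.

(* Elements of T_vTM are pairs (x, y) of vectors of T_(v.1)M, their horizontal
   and vertical parts. *)
Notation TTM R n := ('rV[R]_n * 'rV[R]_n)%type.

Section Riemannian.
Context {R : realType} {n : nat} {M : manifold R n} (g : riemannian_metric M).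
Implicit Types (p q : M) (t : R) (u v w x : 'rV[R]_n) (c : R -> M).

Definition inner p u v : R := (u *m gram g p *m v^T) 0 0.

Definition norm_at p v : R := Num.sqrt (inner p v v).

Definition metric_coef q x : 'M[R]_n :=
  \matrix_(i, j) inner (ichart q x) (tvec q x (delta_mx 0 i))
                                    (tvec q x (delta_mx 0 j)).

Definition partial (i : 'I_n) (f : 'rV[R]_n -> R) x : R :=
  'D_(delta_mx 0 i) f x.

(* [christoffel q x k i j] is Gamma^k_ij at the point x of [chart q]. *)
Definition christoffel q x (k i j : 'I_n) : R :=
  2^-1 * \sum_(l < n) invmx (metric_coef q x) k l *
    (partial i (fun y => metric_coef q y j l) x +
     partial j (fun y => metric_coef q y i l) x -
     partial l (fun y => metric_coef q y i j) x).

(* Covariant derivative DX/dt along c, for the Levi-Civita connection. *)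
Definition covD c (X : R -> 'rV[R]_n) t : 'rV[R]_n :=
  derive1 (fun s => tcoord (c t) (c s) (X s)) t +
  \row_k \sum_(i < n) \sum_(j < n)
    christoffel (c t) (chart (c t) (c t)) k i j * velocity c t 0 i * X t 0 j.

(* R(u, v)w, where R(X, Y) = [D_X, D_Y] - D_[X, Y]. *)
Definition curvature p u v w : 'rV[R]_n :=
  let x := chart p p in let G := christoffel p in
  \row_l \sum_(i < n) \sum_(j < n) \sum_(k < n) u 0 i * v 0 j * w 0 k *
    (partial i (fun y => G y l j k) x - partial j (fun y => G y l i k) x +
     \sum_(m < n) (G x l i m * G x m j k - G x l j m * G x m i k)).

Definition sectional p u v : R :=
  inner p (curvature p u v v) u /
  (inner p u u * inner p v v - inner p u v ^+ 2).

Definition sectional_bounded_below (b : R) : Prop :=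
  forall p u v, free [:: u; v] -> b <= sectional p u v.

(* Affinely parametrized geodesics, defined on the whole line. *)
Definition geodesic c : Prop := forall t,
  [/\ curve_derivable c t, field_derivable c (velocity c) t &
      covD c (velocity c) t = 0].

Definition unit_geodesic c : Prop :=
  geodesic c /\ forall t, norm_at (c t) (velocity c t) = 1.

(* Geodesic completeness; M need not be connected here. *)
Definition complete_metric : Prop :=
  forall v : TM M, exists2 c, geodesic c & velocity_lift c 0 = v.

Definition jacobi_field c (J : R -> 'rV[R]_n) : Prop := forall t,
  [/\ field_derivable c J t, field_derivable c (covD c J) t &
      covD c (covD c J) t + curvature (c t) (J t) (velocity c t) (velocity c t)
        = 0].

Definition conjugate_points_on c (I : set R) : Prop :=
  exists a b (J : R -> 'rV[R]_n),
    [/\ I a, I b, a < b, jacobi_field c J & [/\ J <> cst 0, J a = 0 & J b = 0]].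

(* A piecewise C^1 path is a chain of C^1 curves, each restricted to [0, 1]. *)
Fixpoint path_from_to p (s : seq (R -> M)) q : Prop :=
  if s is c :: s' then [/\ C1_curve c, c 0 = p & path_from_to (c 1) s' q]
  else p = q.

Definition path_length (s : seq (R -> M)) : R :=
  \sum_(c <- s)
    \int[lebesgue_measure]_(t in `[0, 1]) norm_at (c t) (velocity c t).

Definition dist p q : R :=
  inf [set L | exists2 s, path_from_to p s q & L = path_length s].

Definition SM : set (TM M) := [set v | norm_at v.1 v.2 = 1].

Definition SM_open (U : set (TM M)) : Prop :=
  exists2 W, TM_open W & U = W `&` SM.

(* c_v; the default value only matters if there is no such geodesic. *)
Definition geodesic_of (v : TM M) : R -> M :=
  xget (fun=> v.1) [set c | geodesic c /\ velocity_lift c 0 = v].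

Definition flow t (v : TM M) : TM M := velocity_lift (geodesic_of v) t.

Definition lift_derivable (V : R -> TM M) t : Prop :=
  curve_derivable (fst \o V) t /\ field_derivable (fst \o V) (snd \o V) t.

(* The velocity of a curve in TM, split by the connection. *)
Definition lift_velocity (V : R -> TM M) t : TTM R n :=
  (velocity (fst \o V) t, covD (fst \o V) (snd \o V) t).

Definition in_TSM (v : TM M) (xi : TTM R n) : Prop :=
  inner v.1 xi.2 v.2 = 0.

Definition vertical (v : TM M) (xi : TTM R n) : Prop :=
  xi.1 = 0 /\ inner v.1 xi.2 v.2 = 0.

Definition sasaki_norm (v : TM M) (xi : TTM R n) : R :=
  Num.sqrt (inner v.1 xi.1 xi.1 + inner v.1 xi.2 xi.2).

(* The tangent map of phi^t : SM -> SM at v, computed on curves in SM. *)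
Definition Dflow t (v : TM M) (xi : TTM R n) : TTM R n :=
  xget 0 [set eta | exists V : R -> TM M,
    [/\ V 0 = v /\ (forall s, SM (V s)),
        lift_derivable V 0, lift_velocity V 0 = xi,
        lift_derivable (flow t \o V) 0 & lift_velocity (flow t \o V) 0 = eta]].

Definition flow_field (v : TM M) : TTM R n :=
  lift_velocity (flow^~ v) 0.

Definition anosov_splitting (k C : R)
    (Es Eu : TM M -> {vspace TTM R n}) : Prop :=
  forall v : TM M, SM v ->
  [/\ directv (Es v + Eu v + <[flow_field v]>),
      (forall xi, xi \in (Es v + Eu v + <[flow_field v]>)%VS <-> in_TSM v xi),
      (forall t xi, 0 <= t -> xi \in Es v ->
         sasaki_norm (flow t v) (Dflow t v xi)
           <= C * expR (- k * t) * sasaki_norm v xi) &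
      (forall t xi, 0 <= t -> xi \in Eu v ->
         sasaki_norm (flow (- t) v) (Dflow (- t) v xi)
           <= C * expR (- k * t) * sasaki_norm v xi)].

Definition anosov (k C : R) : Prop := exists Es Eu, anosov_splitting k C Es Eu.

End Riemannian.

(* sigma is an admissible value of the constant sigma(beta, k, C), uniformly in
   the manifold and in its dimension. *)
Definition conjugacy_constant (R : realType) (beta k C sigma : R) : Prop :=
  forall (n : nat) (M : manifold R n) (g : riemannian_metric M)
    (Es Eu : TM M -> {vspace TTM R n}),
  complete_metric g -> sectional_bounded_below g (- beta ^+ 2) ->
  anosov_splitting g k C Es Eu ->
  forall v : TM M, SM g v ->
  (exists xi, [/\ xi \in Es v, vertical g v xi & xi != 0]) ->
  conjugate_points_on g (geodesic_of g v) `[-1, sigma].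

(* Main.v *)
(* Call a unit vector v bad if E^s(v) contains a vertical vector, and good if no
   vector of its orbit is bad. The symplectic form of TM is invariant under the
   flow, so the vectors decaying in forward time form an isotropic space; counting
   dimensions, E^s(v) consists of all of them and, together with the flow direction,
   is Lagrangian.

   If v is good, this Lagrangian space gives n Jacobi fields that are a frame along
   c_v at all times. For the coefficients f of a Jacobi field J in this frame, Gm f'
   is constant, where Gm is the Gram matrix; hence J vanishes identically if it
   vanishes twice, and c_v has no conjugate points. Conversely, the defining
   property of sigma shows that a vector of an orbit without conjugate points is not
   bad, nor is a vector with foot outside K.

   Good vectors form a closed set: for good w near v, the slopes of the Lagrangian
   spaces of w are squeezed between those of the Jacobi fields vanishing at time T
   and at time -T, which stay bounded. Bad vectors form a closed set because decay
   is uniform. Good vectors also form an open set: by the escape condition, applied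
   to v and to -v, the times at which orbits starting near v meet K are bounded, so
   orbits having a bad vector converge to an orbit having a bad vector. For n > 1
   the unit tangent bundle is connected, so one good vector makes all of them good;
   for n = 1 there are no bad vectors. Limits are taken along ultrafilters. *)
Require Import Defs.
From HB Require Import structures.
From mathcomp Require Import all_boot all_order all_algebra.
From mathcomp Require Import all_classical all_reals all_analysis.
Import Order.TTheory GRing.Theory Num.Theory.
Import numFieldNormedType.Exports.
From mathcomp Require Import ring lra.
Set Implicit Arguments.
Unset Strict Implicit.
Unset Printing Implicit Defensive.
Local Open Scope classical_set_scope.
Local Open Scope ring_scope.

(** * Functions of class C^k *)

(** The splitting is given pointwise: neither invariance nor continuity of [Es] is part of it. Both
    come from the intrinsic description of [Es] by decay, together with constants [k], [C] that are
    the same at all vectors. Vectors of [T_pM] are coordinates in the chart attached to [p] and may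
    jump as [p] moves, so continuity and differentiability of fields, flow and tangent map can only
    be expressed in a fixed chart [q]. Smooth dependence of geodesics on initial vectors is proved
    there from uniform bounds over short times and continued along orbits; completeness supplies the
    geodesics themselves. [Dflow] is a choice among values on curves in [SM], hence it has to be
    identified with the linear map [dphi]. The delicate limit is that of good vectors: Lagrangian
    spaces that are graphs over the feet could tilt towards the vertical. The comparison fields
    prevent this, with [T] so small that the two-point problem along the limit orbit is solvable;
    solvability then passes to nearby orbits. Bounding a quadratic form suffices, because isotropy
    makes the bilinear form symmetric. *)

Section CkTheory.
Context {R : realType} {V : normedModType R}.
Implicit Types (U : set V) (k : nat).

Lemma Ck_continuous (W : normedModType R) k U (f : V -> W) x :
  Ck k U f -> U x -> {for x, continuous f}.
Proof. by case: k => [|k] [+ _]; apply. Qed.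

Lemma CkS_derivable (W : normedModType R) k U (f : V -> W) x v :
  Ck k.+1 U f -> U x -> derivable f x v.
Proof. by move=> [_ /(_ v)[+ _]]; apply. Qed.

Lemma CkS_derive (W : normedModType R) k U (f : V -> W) v :
  Ck k.+1 U f -> Ck k U ('D_v f).
Proof. by move=> [_ /(_ v)[_]]. Qed.

Lemma CkW (W : normedModType R) k U (f : V -> W) : Ck k.+1 U f -> Ck k U f.
Proof.
elim: k f => [|k IH] f fk; first by split=> //; case: fk.
split=> [|v]; first by case: fk.
split=> [x Ux|]; first exact: CkS_derivable fk Ux.
exact/IH/(CkS_derive v fk).
Qed.

Lemma open_near_eq (W : Type) U (f g : V -> W) x : open U ->
  {in U, f =1 g} -> U x -> \forall y \near x, f y = g y.
Proof.
move=> oU fg Ux; near=> y; apply: fg; rewrite inE; near: y.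
exact: open_nbhs_nbhs.
Unshelve. all: by end_near. Qed.

Lemma eq_Ck (W : normedModType R) k U (f g : V -> W) : open U ->
  {in U, f =1 g} -> Ck k U f -> Ck k U g.
Proof.
move=> oU; elim: k f g => [|k IH] f g fg [fc fk].
  split=> // x Ux; rewrite /prop_for /continuous_at -fg ?inE//.
  by apply: cvg_trans (fc _ Ux); apply: near_eq_cvg;
     apply: filterS (open_near_eq oU fg Ux) => y.
split=> [x Ux|v].
  rewrite /prop_for /continuous_at -fg ?inE//.
  by apply: cvg_trans (fc _ Ux); apply: near_eq_cvg;
     apply: filterS (open_near_eq oU fg Ux) => y.
have [fd fdk] := fk v; split=> [x Ux|].
  exact: (near_eq_derivable (open_near_eq oU fg Ux) (fd _ Ux)).
apply: IH fdk => x; rewrite inE => Ux.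
exact: (near_eq_derive v (open_near_eq oU fg Ux)).
Qed.

Lemma Ck_cst (W : normedModType R) k U (a : W) : Ck k U (fun=> a).
Proof.
elim: k a => [|k IH] a; first by split=> // x _; exact: cst_continuous.
split=> [x _|v]; first exact: cst_continuous.
split=> [x _|]; first exact: derivable_cst.
by rewrite (_ : 'D_v _ = fun=> 0) //; apply/funext => x; exact: derive_cst.
Qed.

Lemma CkD (W : normedModType R) k U (f g : V -> W) : open U ->
  Ck k U f -> Ck k U g -> Ck k U (fun x => f x + g x).
Proof.
move=> oU; elim: k f g => [|k IH] f g fk gk.
  by split=> // x Ux; apply: continuousD; [exact: Ck_continuous fk Ux|exact: Ck_continuous gk Ux].
split=> [x Ux|v].
  by apply: continuousD; [exact: Ck_continuous fk Ux|exact: Ck_continuous gk Ux].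
split=> [x Ux|].
  by apply: derivableD; [exact: CkS_derivable fk Ux|exact: CkS_derivable gk Ux].
apply: (eq_Ck oU _ (IH _ _ (CkS_derive v fk) (CkS_derive v gk))) => x.
by rewrite inE => Ux; rewrite deriveD//; [exact: CkS_derivable fk Ux|exact: CkS_derivable gk Ux].
Qed.

Lemma CkN (W : normedModType R) k U (f : V -> W) : open U ->
  Ck k U f -> Ck k U (fun x => - f x).
Proof.
move=> oU; elim: k f => [|k IH] f fk.
  by split=> // x Ux; apply: continuousN; exact: Ck_continuous fk Ux.
split=> [x Ux|v]; first by apply: continuousN; exact: Ck_continuous fk Ux.
split=> [x Ux|]; first by apply: derivableN; exact: CkS_derivable fk Ux.
apply: (eq_Ck oU _ (IH _ (CkS_derive v fk))) => x.
by rewrite inE => Ux; rewrite deriveN//; exact: CkS_derivable fk Ux.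
Qed.

Lemma CkM k U (f g : V -> R) : open U ->
  Ck k U f -> Ck k U g -> Ck k U (fun x => f x * g x).
Proof.
move=> oU; elim: k f g => [|k IH] f g fk gk.
  by split=> // x Ux; apply: continuousM; [exact: Ck_continuous fk Ux|exact: Ck_continuous gk Ux].
split=> [x Ux|v].
  by apply: continuousM; [exact: Ck_continuous fk Ux|exact: Ck_continuous gk Ux].
split=> [x Ux|].
  by apply: derivableM; [exact: CkS_derivable fk Ux|exact: CkS_derivable gk Ux].
apply: (@eq_Ck R k U (fun x => f x * 'D_v g x + g x * 'D_v f x)) => //.
  move=> x; rewrite inE => Ux; rewrite deriveM//.
  - exact: CkS_derivable fk Ux.
  - exact: CkS_derivable gk Ux.
by apply: CkD => //; apply: IH; do ?exact: CkS_derive; apply: CkW.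
Qed.

Lemma CkV k U (f : V -> R) : open U -> (forall x, U x -> f x != 0) ->
  Ck k U f -> Ck k U (fun x => (f x)^-1).
Proof.
move=> oU f0; elim: k => [|k IH] fk.
  by split=> // x Ux; apply: continuousV; [exact: f0|exact: Ck_continuous fk Ux].
split=> [x Ux|v]; first by apply: continuousV; [exact: f0|exact: Ck_continuous fk Ux].
split=> [x Ux|]; first by apply: derivableV; [exact: f0|exact: CkS_derivable fk Ux].
have fVk := IH (CkW fk).
apply: (@eq_Ck R k U (fun x => - ((f x)^-1 * (f x)^-1 * 'D_v f x))) => //.
  move=> x; rewrite inE => Ux; rewrite deriveV ?f0//; last exact: CkS_derivable fk Ux.
  by rewrite -exprVn expr2 scaleNr.
apply: CkN => //; apply: CkM => //; first exact: CkM.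
exact: CkS_derive.
Qed.

Lemma Ck_sum (W : normedModType R) (I : Type) (r : seq I) (P : pred I)
    k U (f : I -> V -> W) : open U ->
  (forall i, Ck k U (f i)) -> Ck k U (fun x => \sum_(i <- r | P i) f i x).
Proof.
move=> oU fk; elim: r => [|i r IH].
  by apply: (eq_Ck oU _ (Ck_cst k U 0)) => x _; rewrite big_nil.
case Pi : (P i); last by apply: (eq_Ck oU _ IH) => x _; rewrite big_cons Pi.
by apply: (eq_Ck oU _ (CkD oU (fk i) IH)) => x _; rewrite big_cons Pi.
Qed.

Lemma Ck_prod (I : Type) (r : seq I) (P : pred I) k U (f : I -> V -> R) :
  open U -> (forall i, Ck k U (f i)) ->
  Ck k U (fun x => \prod_(i <- r | P i) f i x).
Proof.
move=> oU fk; elim: r => [|i r IH].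
  by apply: (eq_Ck oU _ (@Ck_cst R k U 1)) => x _; rewrite big_nil.
case Pi : (P i); last by apply: (eq_Ck oU _ IH) => x _; rewrite big_cons Pi.
by apply: (eq_Ck oU _ (CkM oU (fk i) IH)) => x _; rewrite big_cons Pi.
Qed.

Lemma Ck_det n k U (A : V -> 'M[R]_n) : open U ->
  (forall i j, Ck k U (fun x => A x i j)) -> Ck k U (fun x => \det (A x)).
Proof.
move=> oU Ak; apply: Ck_sum => // s.
by apply: CkM => //; [exact: Ck_cst|apply: Ck_prod].
Qed.

(** Cramer's rule reduces the inverse to determinants, which are polynomial in the entries. *)
Lemma Ck_invmx n k U (A : V -> 'M[R]_n) : open U ->
  (forall x, U x -> A x \in unitmx) ->
  (forall i j, Ck k U (fun x => A x i j)) ->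
  forall i j, Ck k U (fun x => invmx (A x) i j).
Proof.
move=> oU Au Ak i j.
have d0 x : U x -> \det (A x) != 0 by move/Au; rewrite unitmxE unitfE.
apply: (@eq_Ck R k U (fun x => (\det (A x))^-1 *
    ((-1) ^+ (j + i) * \det (row' j (col' i (A x)))))) => //.
  move=> x; rewrite inE => Ux; rewrite /invmx (Au _ Ux) !mxE /cofactor.
  by [].
apply: CkM => //; first by apply: CkV => //; exact: Ck_det.
apply: CkM => //; first exact: Ck_cst.
apply: Ck_det => // a b.
by apply: (eq_Ck oU _ (Ak (lift j a) (lift i b))) => x _; rewrite !mxE.
Qed.

Lemma Ck_coord m n k U (f : V -> 'M[R]_(m, n)) : open U ->
  Ck k U f -> forall i j, Ck k U (fun x => f x i j).
Proof.
move=> oU + i j; elim: k f => [|k IH] f fk.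
  split=> // x Ux; apply: (@continuous_comp _ _ _ f (fun M : 'M[R]_(m, n) => M i j)).
    exact: Ck_continuous fk Ux.
  exact: coord_continuous.
split=> [x Ux|v].
  apply: (@continuous_comp _ _ _ f (fun M : 'M[R]_(m, n) => M i j)).
    exact: Ck_continuous fk Ux.
  exact: coord_continuous.
have fd x : U x -> derivable f x v by move=> Ux; exact: CkS_derivable fk Ux.
split=> [x /fd /derivable_mxP|]; first exact.
apply: (eq_Ck oU _ (IH _ (CkS_derive v fk))) => x; rewrite inE => /fd Ux.
by rewrite derive_mx// mxE.
Qed.

End CkTheory.

Lemma near_cvg (T : Type) (U : nbhsType) (F : set_system T) {FF : Filter F}
    (f g : T -> U) (G : set_system U) :
  (\forall s \near F, f s = g s) -> f @ F --> G -> g @ F --> G.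
Proof. by move=> fg; apply: cvg_trans; exact: near_eq_cvg. Qed.

Lemma cvg_sum_pt (R : realType) (W : normedModType R) (T I : Type)
    (F : set_system T) {FF : Filter F} (r : seq I) (P : pred I)
    (f : I -> T -> W) (l : I -> W) :
  (forall i, f i @ F --> l i) ->
  (fun s => \sum_(i <- r | P i) f i s) @ F --> \sum_(i <- r | P i) l i.
Proof.
move=> fl; elim: r => [|i r IH].
  by rewrite big_nil; apply: (near_cvg _ (cvg_cst (0 : W))); apply: nearW => s; rewrite big_nil.
rewrite big_cons; case Pi : (P i).
  by apply: (near_cvg _ (cvgD (fl i) IH)); apply: nearW => s; rewrite big_cons Pi.
by apply: (near_cvg _ IH); apply: nearW => s; rewrite big_cons Pi.
Qed.

Lemma cvg_coord (R : realType) (T : Type) (F : set_system T) {FF : Filter F}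
    p q (v : T -> 'M[R]_(p, q)) (w : 'M[R]_(p, q)) i j :
  v @ F --> w -> (fun s => v s i j) @ F --> w i j.
Proof.
move=> vw; apply: (@cvg_comp _ _ _ v (fun M : 'M[R]_(p, q) => M i j) _ _ _ vw).
exact: coord_continuous.
Qed.

(** * Directional derivatives of C^k functions of several variables *)

Section Differential.
Context {R : realType} {m : nat}.
Local Notation E := 'rV[R]_m.
Implicit Types (U : set E) (f : E -> R).

Lemma is_derive_line f (x h : E) (t : R) :
  derivable f (x + t *: h) h ->
  is_derive t (1 : R) (fun s : R => f (x + s *: h)) ('D_h f (x + t *: h)).
Proof.
move=> fd.
have eq : (fun s : R => s^-1 *: (((fun r : R => f (x + r *: h)) \o shift t) (s *: (1 : R)) - f (x + t *: h)))
   = (fun s : R => s^-1 *: ((f \o shift (x + t *: h)) (s *: h) - f (x + t *: h))).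
  apply/funext => s /=; congr (_ *: (f _ - _)).
  by rewrite [s *: _]mulr1 scalerDl addrCA.
by split; [rewrite /derivable eq|rewrite /derive eq].
Qed.

Lemma MVT_line U f (x h : E) : Ck 1 U f ->
  (forall t : R, 0 <= t <= 1 -> U (x + t *: h)) ->
  exists2 t : R, 0 <= t <= 1 & f (x + h) - f x = 'D_h f (x + t *: h).
Proof.
move=> fk Uh; pose g (s : R) := f (x + s *: h).
have gd (t : R) : 0 <= t <= 1 -> is_derive t (1 : R) g ('D_h f (x + t *: h)).
  by move=> /Uh t01; apply: is_derive_line; exact: CkS_derivable fk t01.
have [||t t01] := @MVT_segment R g (fun t => 'D_h f (x + t *: h)) 0 1 ler01.
- by move=> t; rewrite in_itv/= => /andP[/ltW t0 /ltW t1]; apply: gd; rewrite t0.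
- apply: derivable_within_continuous => t; rewrite in_itv/= => /gd.
  by move=> /@ex_derive.
by rewrite /g scale1r scale0r addr0 subr0 mulr1 => fE; exists t.
Qed.

Lemma is_deriveZdir f (x h : E) (a : R) : derivable f x h ->
  is_derive x (a *: h) f (a * 'D_h f x).
Proof.
move=> fd.
have := @is_derive_line f x h 0; rewrite scale0r addr0 => /(_ fd) gd.
pose g (s : R) := f (x + s *: h).
have ad : is_derive (0 : R) (1 : R) ( *%R a : R -> R) a.
  by apply: is_derive_eq; rewrite /GRing.scale/= mulr1.
have gd' : is_derive (a * 0) (1 : R) g ('D_h f x) by rewrite mulr0.
have cd : is_derive (0 : R) (1 : R) (g \o *%R a) ('D_h f x * a).
  exact: is_derive1_comp.
have eq : (fun s : R => s^-1 *: ((f \o shift x) (s *: (a *: h)) - f x)) =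
  (fun s : R => s^-1 *: (((g \o *%R a) \o shift 0) (s *: (1:R)) - (g \o *%R a) 0)).
  apply/funext => s /=; rewrite /g /= mulr0 scale0r addr0 addr0.
  by rewrite [s *: 1]mulr1 scalerA [a * s]mulrC [X in f X]addrC.
have [cd1 cd2] := cd.
by split; [rewrite /derivable eq|rewrite /derive eq mulrC].
Qed.

(** Meant for the intermediate points of the mean value theorem, whose parameter [th] is bounded but
    otherwise unknown. *)
Lemma cvg_segment (T : Type) (F : set_system T) {FF : Filter F} (x : E)
    (th : T -> R) (y d : T -> E) : (forall s, 0 <= th s <= 1) -> y @ F --> x ->
  d @ F --> (0 : E) -> (fun s => y s + th s *: d s) @ F --> x.
Proof.
move=> th01 yx d0; rewrite -[X in _ --> X]addr0; apply: cvgD => //.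
apply/norm_cvg0P.
apply: (@squeeze_cvgr _ _ _ _ (fun=> 0) (fun s => `|d s|)).
- apply: nearW => s; rewrite normr_ge0 normrZ ger0_norm; last by case/andP: (th01 s).
  by rewrite ler_piMl//; case/andP: (th01 s).
- exact: cvg_cst.
- exact/norm_cvg0P.
Qed.

Lemma near0_segment U (T : Type) (F : set_system T) {FF : Filter F} (x : T -> E)
    (x0 : E) (d : T -> E) : open U -> U x0 -> x @ F --> x0 -> d @ F --> (0 : E) ->
  \forall s \near F, forall t : R, 0 <= t <= 1 -> U (x s + t *: d s).
Proof.
move=> oU Ux xc d0.
have /nbhs_ballP[e e0 eU] : nbhs x0 U by exact: open_nbhs_nbhs.
near=> s => t /andP[t0 t1]; apply: eU; rewrite -ball_normE /ball_/= opprD addrA.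
rewrite (le_lt_trans (ler_normB _ _))// (splitr e) ltrD//.
  by near: s; move/cvgrPdist_lt : xc; apply; rewrite divr_gt0.
rewrite normrZ ger0_norm// (@le_lt_trans _ _ `|d s|)// ?ler_piMl//.
rewrite -[d s]subr0 distrC; near: s.
by move/cvgrPdist_lt : d0; apply; rewrite divr_gt0.
Unshelve. all: by end_near. Qed.

(** The parameter [th] is chosen for all indices at once, so that limits can be taken along [F];
    where the segment leaves [U] it takes the harmless value 0. *)
Lemma near_MVT U f (x : E) (T : Type) (F : set_system T) {FF : Filter F}
    (y d : T -> E) : open U -> Ck 1 U f -> U x ->
  y @ F --> x -> d @ F --> (0 : E) ->
  exists2 th : T -> R, (forall s, 0 <= th s <= 1) &
   \forall s \near F, f (y s + d s) - f (y s) = 'D_(d s) f (y s + th s *: d s).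
Proof.
move=> oU fk Ux yx d0.
have ex s : exists t : R, 0 <= t <= 1 /\
   ((forall t : R, 0 <= t <= 1 -> U (y s + t *: d s)) ->
   f (y s + d s) - f (y s) = 'D_(d s) f (y s + t *: d s)).
  have [Us|nU] := pselect (forall t : R, 0 <= t <= 1 -> U (y s + t *: d s)).
    by have [t t01 tE] := MVT_line fk Us; exists t; split.
  by exists 0; split=> //; rewrite lexx ler01.
exists (fun s => projT1 (cid (ex s))) => [s|].
  by case: (cid _) => t [].
apply: filterS (near0_segment oU Ux yx d0) => s Us.
by case: (cid _) => t /= [_]; apply.
Qed.

Lemma Ck1_deriveZ U f x (a : R) (v : E) : Ck 1 U f -> U x ->
  'D_(a *: v) f x = a * 'D_v f x.
Proof.
by move=> fk Ux; have [] := is_deriveZdir a (CkS_derivable (v := v) fk Ux).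
Qed.

(** [Ck] speaks of directional derivatives one at a time, so additivity in the direction needs the
    continuity of ['D_v f]: the increment along [s *: (u + v)] is split at [x + s *: u], and the
    mean value theorem handles the second half. *)
Lemma Ck1_deriveD U f x (u v : E) : open U -> Ck 1 U f -> U x ->
  'D_(u + v) f x = 'D_u f x + 'D_v f x.
Proof.
move=> oU fk Ux.
have fu : derivable f x u by exact: CkS_derivable fk Ux.
have cv : {for x, continuous ('D_v f)} by have := CkS_derive v fk => /Ck_continuous; apply.
have s0 (z : E) : (fun s : R => s *: z) @ 0^' --> (0 : E).
  rewrite -[X in _ --> X](scale0r z); apply: cvgZr_tmp.
  exact: cvg_within.
have yc : (fun s : R => x + s *: u) @ 0^' --> x.
  by rewrite -[X in _ --> X]addr0; apply: cvgD => //; exact: cvg_cst.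
have [th th01 thE] := near_MVT oU fk Ux yc (s0 v).
apply: cvg_lim => //=.
have fu' : (fun s : R => s^-1 *: (f (s *: u + x) - f x)) @ 0^' --> 'D_u f x by exact: fu.
have fv' : (fun s : R => 'D_v f ((x + s *: u) + th s *: (s *: v))) @ 0^' --> 'D_v f x.
  apply: (@cvg_comp _ _ _ _ ('D_v f) _ _ _ _ cv).
  exact: (cvg_segment th01 yc (s0 v)).
apply: (near_cvg _ (cvgD fu' fv')).
have nz : \forall s \near (0:R)^', s != 0 by exact: nbhs_dnbhs_neq.
near=> s => /=.
have sn0 : s != 0 by near: s.
have Uyt : U (x + s *: u + th s *: (s *: v)).
  by have : forall t : R, 0 <= t <= 1 -> U (x + s *: u + t *: (s *: v));
     [near: s; exact: near0_segment oU Ux yc (s0 v)|apply].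
have sE : f (x + s *: u + s *: v) - f (x + s *: u) = s * 'D_v f (x + s *: u + th s *: (s *: v)).
  rewrite -(Ck1_deriveZ s v fk Uyt).
  by near: s.
rewrite [LHS](_ : _ = s^-1 *: (f (s *: u + x) - f x) + 'D_v f (x + s *: u + th s *: (s *: v)))//.
have -> : 'D_v f (x + s *: u + th s *: (s *: v)) = s^-1 *: (f (x + s *: u + s *: v) - f (x + s *: u)).
  by rewrite sE -[RHS]/(s^-1 * (s * _)) mulKf.
rewrite -scalerDr; congr (_ *: _).
have -> : s *: (u + v) + x = x + s *: u + s *: v by rewrite scalerDr addrC addrA.
by rewrite [s *: u + x]addrC; ring.
Unshelve. all: by end_near. Qed.

Lemma Ck1_deriveE U f x (v : E) : open U -> Ck 1 U f -> U x ->
  'D_v f x = \sum_i v 0 i * 'D_(delta_mx 0 i) f x.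
Proof.
move=> oU fk Ux; rewrite {1}(row_sum_delta v).
elim/big_ind2 : _ => [|u a w b <- <-|i _]; first exact: derive0.
  exact: (Ck1_deriveD _ _ oU fk Ux).
exact: (Ck1_deriveZ _ _ fk Ux).
Qed.

(** Joint continuity in point and direction: the expansion in the standard basis leaves finitely
    many continuous functions of the point alone. *)
Lemma cvg_derive U f x (T : Type) (F : set_system T) {FF : Filter F}
    (y v : T -> E) (w : E) : open U -> Ck 1 U f -> U x ->
  y @ F --> x -> v @ F --> w -> (fun s => 'D_(v s) f (y s)) @ F --> 'D_w f x.
Proof.
move=> oU fk Ux yx vw; rewrite (Ck1_deriveE _ oU fk Ux).
have yU : \forall s \near F, U (y s) by apply: yx; exact: open_nbhs_nbhs.
apply: (@near_cvg _ _ F _ (fun s => \sum_i v s 0 i * 'D_(delta_mx 0 i) f (y s))).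
  by apply: filterS yU => s Us; rewrite -(Ck1_deriveE _ oU fk Us).
apply: cvg_sum_pt => i; apply: cvgM.
  exact: cvg_coord.
apply: (@cvg_comp _ _ _ y ('D_(delta_mx 0 i) f) _ _ _ yx).
by have := CkS_derive (delta_mx 0 i) fk => /Ck_continuous; apply.
Qed.

Lemma cvg_difference_quotient (V : normedModType R) (W : normedModType R)
  (c : V -> W) x v : derivable c x v ->
  (fun s : R => c (s *: v + x) - c x) @ 0^' --> (0 : W).
Proof.
move=> cd.
have -> : (0 : W) = (0 : R) *: 'D_v c x by rewrite scale0r.
have cd' : (fun s : R => s^-1 *: (c (s *: v + x) - c x)) @ 0^' --> 'D_v c x by exact: cd.
have i0 : (fun s : R => s) @ 0^' --> (0 : R) by exact: cvg_within.
apply: (near_cvg _ (cvgZ i0 cd')).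
have nz : \forall s \near (0:R)^', s != 0 by exact: nbhs_dnbhs_neq.
by apply: filterS nz => s s0; rewrite scalerA divff// scale1r.
Qed.

(** The mean value theorem on the segment from [c x] to the displaced point takes the place of a
    total differential of [f]; [c] needs to be differentiable in one direction only. *)
Lemma is_derive_comp U f (V : normedModType R) (c : V -> E) x v w :
  open U -> Ck 1 U f -> U (c x) -> is_derive x v c w ->
  is_derive x v (f \o c) ('D_w f (c x)).
Proof.
move=> oU fk Ux [cd cdE].
have d0 := cvg_difference_quotient cd.
have [th th01 thE] := near_MVT oU fk Ux (cvg_cst (c x)) d0.
have cd' : (fun s : R => s^-1 *: (c (s *: v + x) - c x)) @ 0^' --> w by rewrite -cdE; exact: cd.
suff H : (fun s : R => s^-1 *: ((f \o c) (s *: v + x) - (f \o c) x)) @ 0^' --> 'D_w f (c x).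
  split; first by apply/cvg_ex; exists ('D_w f (c x)).
  exact: cvg_lim H.
apply: (near_cvg _ (cvg_derive oU fk Ux (cvg_segment th01 (cvg_cst (c x)) d0) cd')).
near=> s; rewrite /= [c (_ + _)](_ : _ = c x + (c (s *: v + x) - c x)); last first.
  by rewrite [RHS]addrC subrK.
have -> : f (c x + (c (s *: v + x) - c x)) - f (c x) = 'D_(c (s *: v + x) - c x) f (c x + th s *: (c (s *: v + x) - c x)).
  by near: s.
have -> : c x + (c (s *: v + x) - c x) = c (s *: v + x) by rewrite addrC subrK.
rewrite [in RHS]/GRing.scale/= -(@Ck1_deriveZ U)//.
by have : forall t : R, 0 <= t <= 1 -> U (c x + t *: (c (s *: v + x) - c x));
   [near: s; exact: near0_segment oU Ux (cvg_cst (c x)) d0|apply].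
Unshelve. all: by end_near. Qed.

Lemma CkS_Ck1 (V W : normedModType R) k (U : set V) (f : V -> W) : Ck k.+1 U f -> Ck 1 U f.
Proof. by elim: k => // k IH /CkW. Qed.

(* Both second derivatives are limits of the same double difference. *)
Lemma Ck2_deriveC U f x (u v : E) : open U -> Ck 2 U f -> U x ->
  'D_u ('D_v f) x = 'D_v ('D_u f) x.
Proof.
move=> oU fk Ux.
pose D (u v : E) (s : R) := f (x + s *: u + s *: v) - f (x + s *: v) - (f (x + s *: u) - f x).
have DC : D u v = D v u.
  by apply/funext => s; rewrite /D [x + _ + _]addrAC; ring.
suff lim (a b : E) : (fun s : R => s^-1 * (s^-1 * D a b s)) @ 0^' --> 'D_b ('D_a f) x.
  have l1 := lim v u; have l2 := lim u v; rewrite DC in l2.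
  exact: (cvg_unique _ l1 l2).
have s0 (z : E) : (fun s : R => s *: z) @ 0^' --> (0 : E).
  rewrite -[X in _ --> X](scale0r z); apply: cvgZr_tmp.
  exact: cvg_within.
have [e e0 eU] : exists2 e : R, 0 < e & ball x e `<=` U.
  have /nbhs_ballP[e e0 eU] : nbhs x U by exact: open_nbhs_nbhs.
  by exists e.
have sab : \forall s \near (0:R)^', `|s *: a| + `|s *: b| < e.
  near=> s; rewrite (splitr e) ltrD//.
    by near: s; have /cvgr_norm_lt := s0 a; apply; rewrite normr0 divr_gt0.
  by near: s; have /cvgr_norm_lt := s0 b; apply; rewrite normr0 divr_gt0.
(* Two mean values: [p.1] comes from direction [a], applied to the difference [h] of two parallel
   increments, and [p.2] from direction [b], applied to ['D_a f]. *)
have key s : exists p : R * R, (0 <= p.1 <= 1) /\ (0 <= p.2 <= 1) /\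
    (`|s *: a| + `|s *: b| < e ->
     D a b s = s * (s * 'D_b ('D_a f) (x + p.1 *: (s *: a) + p.2 *: (s *: b)))).
  have [sabe|nsabe] := boolP (`|s *: a| + `|s *: b| < e); last first.
    by exists (0, 0); rewrite /= lexx ler01.
  have inU (t t' : R) : 0 <= t <= 1 -> 0 <= t' <= 1 -> U (x + t *: (s *: a) + t' *: (s *: b)).
    move=> /andP[t0 t1] /andP[t0' t1']; apply: eU; rewrite -ball_normE /ball_/=.
    rewrite -addrA opprD addrA subrr sub0r normrN (le_lt_trans _ sabe)//.
    rewrite (le_trans (ler_normD _ _))// lerD// normrZ ger0_norm// ler_piMl//.
  have fk1 := CkS_Ck1 fk.
  pose h (t : R) := f ((x + s *: b) + t *: (s *: a)) - f (x + t *: (s *: a)).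
  have hd (t : R) : 0 <= t <= 1 -> is_derive t (1 : R) h
      ('D_(s *: a) f (x + s *: b + t *: (s *: a)) - 'D_(s *: a) f (x + t *: (s *: a))).
    move=> t01; apply: is_deriveB; apply: is_derive_line.
      by apply: (CkS_derivable fk1); rewrite addrAC -[s *: b]scale1r; apply: inU => //; rewrite ler01 lexx.
    by apply: (CkS_derivable fk1); rewrite -[x + _]addr0 -[0](scale0r (s *: b)); apply: inU => //; rewrite lexx ler01.
  have [||t t01] := @MVT_segment R h (fun t => 'D_(s *: a) f (x + s *: b + t *: (s *: a)) - 'D_(s *: a) f (x + t *: (s *: a))) 0 1 ler01.
  - by move=> t; rewrite in_itv/= => /andP[/ltW t0 /ltW t1]; apply: hd; rewrite t0.
  - apply: derivable_within_continuous => t; rewrite in_itv/= => /hd.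
    by move=> /@ex_derive.
  rewrite in_itv/= in t01.
  have U1 : U (x + t *: (s *: a) + s *: b).
    by rewrite -[s *: b]scale1r; apply: inU => //; rewrite ler01 lexx.
  have U0 : U (x + t *: (s *: a)).
    by rewrite -[x + _]addr0 -[0](scale0r (s *: b)); apply: inU => //; rewrite lexx ler01.
  rewrite [x + s *: b + _]addrAC (Ck1_deriveZ _ _ fk1 U1) (Ck1_deriveZ _ _ fk1 U0).
  have fak : Ck 1 U ('D_a f) by exact: CkS_derive.
  have [|t' t01' tE'] := @MVT_line U ('D_a f) (x + t *: (s *: a)) (s *: b) fak.
    by move=> t' t01'; exact: inU.
  rewrite subr0 mulr1 -mulrBr tE' (Ck1_deriveZ _ _ fak (inU _ _ t01 t01')) => hE.
  exists (t, t'); split=> //; split=> // _; rewrite -hE /h scale1r scale0r addr0 /D.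
  by rewrite [x + s *: b + _]addrAC !addr0; ring.
pose p s := projT1 (cid (key s)).
have p1 s : 0 <= (p s).1 <= 1 by rewrite /p; case: (cid _) => ? [].
have p2 s : 0 <= (p s).2 <= 1 by rewrite /p; case: (cid _) => ? [? [? ?]].
have pE s : `|s *: a| + `|s *: b| < e -> D a b s =
    s * (s * 'D_b ('D_a f) (x + (p s).1 *: (s *: a) + (p s).2 *: (s *: b))).
  by rewrite /p; case: (cid _) => ? [? [? H]] /H.
have pc : (fun s => x + (p s).1 *: (s *: a) + (p s).2 *: (s *: b)) @ 0^' --> x.
  apply: (cvg_segment p2 _ (s0 b)); apply: (cvg_segment p1 _ (s0 a)); exact: cvg_cst.
have fabc : {for x, continuous ('D_b ('D_a f))}.
  by have := CkS_derive b (CkS_derive a fk) => /Ck_continuous; apply.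
apply: (near_cvg _ (cvg_comp _ _ pc fabc)) => //.
have nz : \forall s \near (0:R)^', s != 0 by exact: nbhs_dnbhs_neq.
near=> s; have sn0 : s != 0 by near: s.
rewrite pE; last by near: s.
by rewrite /= mulKf// mulKf.
Unshelve. all: by end_near. Qed.

End Differential.

Section RowNorm.
Context {R : realType} {m : nat}.
Implicit Types h : 'rV[R]_m.

Lemma coord_norm_le h i : `|h 0 i| <= `|h|.
Proof.
by rewrite [leRHS]/Num.Def.normr/= mx_normrE; exact: (le_bigmax _ _ (0, i)).
Qed.

Lemma row_norm_le h (a : R) : 0 <= a -> (forall i, `|h 0 i| <= a) -> `|h| <= a.
Proof.
move=> a0 ha; rewrite [leLHS]/Num.Def.normr/= mx_normrE.
by apply: bigmax_le => // -[i j] _ /=; rewrite [i]ord1.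
Qed.

Lemma sum_norm_le (f : 'I_m -> R) (a : R) :
  (forall i, `|f i| <= a) -> `|\sum_i f i| <= m%:R * a.
Proof.
move=> fa; rewrite (le_trans (ler_norm_sum _ _ _))//.
rewrite (le_trans (ler_sum _ (fun i _ => fa i)))// sumr_const card_ord.
by rewrite mulr_natl.
Qed.

End RowNorm.

Section LocalBounds.
Context {R : realType} {m : nat}.
Local Notation E := 'rV[R]_m.
Implicit Types (U : set E) (z h : E).

Lemma finite_near_bounded (V : normedModType R) (I : finType) (g : I -> V -> R) (z0 : V) :
  (forall i, {for z0, continuous (g i)}) ->
  exists2 M : R, 0 < M & \forall z \near z0, forall i, `|g i z| <= M.
Proof.
move=> gc; exists (1 + \sum_i (`|g i z0| + 1)).
  by rewrite ltr_pwDl// sumr_ge0.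
apply: filter_forall => i; have /cvgr_norm_le := gc i.
move=> /(_ (`|g i z0| + 1)) => /(_ (ltr_pwDr ltr01 (lexx _))).
apply: filterS => z /le_trans; apply.
by rewrite (bigD1 i)//= addrCA ler_wpDr// addr_ge0// sumr_ge0.
Qed.

Definition dfield (F : E -> E) z h : E :=
  \row_j 'D_h (fun z => F z 0 j) z.

(** All that the flow estimates need from a field of class C^2, with a single constant: size,
    linearity of the derivative, Lipschitz bounds for the field and its derivative, and a quadratic
    Taylor remainder. *)
Definition tame (F : E -> E) (B : set E) (L : R) : Prop :=
  [/\ forall z h, B z -> `|F z| <= L /\ `|dfield F z h| <= L * `|h|,
      forall z h h' (a : R), B z ->
        dfield F z (a *: h + h') = a *: dfield F z h + dfield F z h',
      forall z z', B z -> B z' -> `|F z' - F z| <= L * `|z' - z|,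
      forall z z' h, B z -> B z' ->
        `|dfield F z' h - dfield F z h| <= L * `|z' - z| * `|h| &
      forall z z', B z -> B z' ->
        `|F z' - F z - dfield F z (z' - z)| <= L * `|z' - z| ^+ 2].

Lemma tame_near U (F : E -> E) z0 : open U -> U z0 ->
  (forall j, Ck 2 U (fun z => F z 0 j)) ->
  exists r L : R, [/\ 0 < r, 0 < L, ball z0 r `<=` U & tame F (ball z0 r) L].
Proof.
move=> oU Uz0 Fk.
pose f j z := F z 0 j.
pose e i : E := delta_mx 0 i.
have fk j : Ck 2 U (f j) by exact: Fk.
have fk1 j : Ck 1 U (f j) by exact: CkW.
have dfk j i : Ck 1 U ('D_(e i) (f j)) by exact: CkS_derive.
have [M0 M00 H0] : exists2 M : R, 0 < M & \forall z \near z0, forall j, `|f j z| <= M.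
  by apply: finite_near_bounded => j; exact: Ck_continuous (fk j) Uz0.
have [M1 M10 H1] : exists2 M : R, 0 < M & \forall z \near z0,
    forall p : 'I_m * 'I_m, `|'D_(e p.1) (f p.2) z| <= M.
  by apply: finite_near_bounded => -[i j] /=; exact: Ck_continuous (dfk j i) Uz0.
have [M2 M20 H2] : exists2 M : R, 0 < M & \forall z \near z0,
    forall p : 'I_m * 'I_m * 'I_m, `|'D_(e p.2) ('D_(e p.1.1) (f p.1.2)) z| <= M.
  apply: finite_near_bounded => -[[i j] k] /=.
  exact: Ck_continuous (CkS_derive (e k) (dfk j i)) Uz0.
have HU : \forall z \near z0, U z by exact: open_nbhs_nbhs.
have /nbhs_ballP[r /= r0 rP] : \forall z \near z0, U z /\ ((forall j, `|f j z| <= M0) /\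
   ((forall p : 'I_m * 'I_m, `|'D_(e p.1) (f p.2) z| <= M1) /\
   (forall p : 'I_m * 'I_m * 'I_m, `|'D_(e p.2) ('D_(e p.1.1) (f p.1.2)) z| <= M2))).
  by do 3 (apply: filterI => //).
pose M := M0 + M1 + M2.
have M0' : 0 < M by rewrite !addr_gt0.
(* In the maximum norm each expansion in the basis costs a factor [m], and second derivatives cost
   two; [m + 1] instead of [m] keeps [L] positive in dimension 0. *)
pose L := (m%:R + 1) ^+ 2 * M.
have m1 : 1 <= m%:R + 1 :> R by rewrite ler_wpDl.
have mM : m%:R * M <= L.
  rewrite /L ler_wpM2r ?(ltW M0')// (@le_trans _ _ (m%:R + 1))// ?ler_wpDr//.
  by rewrite ler_eXnr.
have mmM : m%:R * (m%:R * M) <= L.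
  by rewrite /L mulrA ler_wpM2r ?(ltW M0')// -expr2 lerXn2r ?nnegrE ?addr_ge0 ?ler_wpDr.
have M1' : M <= L by rewrite /L ler_peMl ?(ltW M0')// exprn_ege1.
exists r, L; split=> //; first by rewrite mulr_gt0// exprn_gt0// ltr_wpDl.
  by move=> z /rP[].
have seg z z' (t : R) : ball z0 r z -> ball z0 r z' -> 0 <= t <= 1 -> ball z0 r (z + t *: (z' - z)).
  rewrite -!ball_normE /= => zr zr' /andP[t0 t1].
  have -> : z0 - (z + t *: (z' - z)) = (1 - t) *: (z0 - z) + t *: (z0 - z').
    by apply/rowP => i; rewrite !mxE; ring.
  rewrite (le_lt_trans (ler_normD _ _))// !normrZ (ger0_norm t0) ger0_norm ?subr_ge0//.
  have [->|tn0] := eqVneq t 0; first by rewrite subr0 mul1r mul0r addr0.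
  have -> : r = (1 - t) * r + t * r by ring.
  rewrite ler_ltD// ?ler_wpM2l ?subr_ge0 ?(ltW zr)// ltr_pM2l// lt_neqAle eq_sym tn0//.
have b0 z j : ball z0 r z -> `|f j z| <= M.
  move=> /rP[_ [+ _]] => /(_ j) /le_trans; apply.
  by rewrite /M -addrA ler_wpDr// addr_ge0 ?ltW.
have b1 z j i : ball z0 r z -> `|'D_(e i) (f j) z| <= M.
  move=> /rP[_ [_ [+ _]]] => /(_ (i, j)) /le_trans; apply.
  by rewrite /M addrAC ler_wpDl// addr_ge0 ?ltW.
have b2 z j i k : ball z0 r z -> `|'D_(e k) ('D_(e i) (f j)) z| <= M.
  move=> /rP[_ [_ [_ +]]] => /(_ (i, j, k)) /le_trans; apply.
  by rewrite /M ler_wpDl// addr_ge0 ?ltW.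
have bD (g : E -> R) z h K : Ck 1 U g -> ball z0 r z -> (forall i, `|'D_(e i) g z| <= K) ->
    `|'D_h g z| <= m%:R * K * `|h|.
  move=> gk /rP[Uz _] gK; rewrite (Ck1_deriveE _ oU gk Uz) -mulrA.
  apply: sum_norm_le => i; rewrite normrM mulrC ler_pM//.
  exact: coord_norm_le.
have D2 z z' j i : ball z0 r z -> ball z0 r z' ->
    `|'D_(e i) (f j) z' - 'D_(e i) (f j) z| <= m%:R * M * `|z' - z|.
  move=> zr zr'.
  have [|t t01] := @MVT_line R m U ('D_(e i) (f j)) z (z' - z) (dfk j i).
    by move=> t /(seg _ _ _ zr zr')/rP[].
  rewrite subrKC => ->; apply: bD => //; first exact: seg.
  by move=> k; apply: b2; exact: seg.
have Dh z z' j h : ball z0 r z -> ball z0 r z' ->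
    `|'D_h (f j) z' - 'D_h (f j) z| <= m%:R * (m%:R * M * `|z' - z|) * `|h|.
  move=> zr zr'; have [Uz _] := rP _ zr; have [Uz' _] := rP _ zr'.
  rewrite !(Ck1_deriveE _ oU (fk1 j))// -sumrB -mulrA.
  apply: sum_norm_le => i; rewrite -mulrBr normrM mulrC ler_pM//.
    exact: D2.
  exact: coord_norm_le.
have L0 : 0 <= L by rewrite (le_trans _ M1')// ltW.
split.
- move=> z h zr; split.
    by apply: row_norm_le => // j; rewrite (le_trans (b0 _ j zr)).
  apply: row_norm_le => [|j]; first by rewrite mulr_ge0.
  rewrite mxE (le_trans (@bD (f j) z h M (fk1 j) zr _))//.
    by move=> i; exact: b1.
  by rewrite ler_wpM2r.
- move=> z h h' a /rP[Uz _]; apply/rowP => j; rewrite !mxE.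
  by rewrite (Ck1_deriveD _ _ oU (fk1 j) Uz) (Ck1_deriveZ _ _ (fk1 j) Uz).
- move=> z z' zr zr'; apply: row_norm_le => [|j]; first by rewrite mulr_ge0.
  have [|t t01] := @MVT_line R m U (f j) z (z' - z) (fk1 j).
    by move=> t /(seg _ _ _ zr zr')/rP[].
  rewrite subrKC !mxE -/(f j z') -/(f j z) => ->.
  rewrite (le_trans (@bD (f j) _ (z' - z) M (fk1 j) (seg _ _ _ zr zr' t01) _))//.
    by move=> i; apply: b1; exact: seg.
  by rewrite ler_wpM2r.
- move=> z z' h zr zr'; apply: row_norm_le => [|j]; first by rewrite mulr_ge0 // mulr_ge0.
  rewrite !mxE (le_trans (Dh _ _ j h zr zr'))//.
  by rewrite mulrA mulrA -[m%:R * m%:R * M]mulrA !ler_wpM2r.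
- move=> z z' zr zr'; apply: row_norm_le => [|j]; first by rewrite mulr_ge0// exprn_ge0.
  have [|t t01] := @MVT_line R m U (f j) z (z' - z) (fk1 j).
    by move=> t /(seg _ _ _ zr zr')/rP[].
  rewrite subrKC !mxE -/(f j z') -/(f j z) => ->.
  rewrite (le_trans (Dh _ _ j _ zr (seg _ _ _ zr zr' t01)))//.
  rewrite addrAC subrr add0r normrZ.
  have t0 : `|t| <= 1 by case/andP: t01 => t0 t1; rewrite ger0_norm.
  rewrite expr2 !mulrA ler_wpM2r// (@le_trans _ _ (m%:R * (m%:R * M) * `|z' - z|))//.
    rewrite ler_wpM2r// -[m%:R * m%:R * M]mulrA ler_piMr// mulr_ge0// mulr_ge0//.
    exact: ltW.
  by rewrite ler_wpM2r.
Qed.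

End LocalBounds.

(** * Differential inequalities and flows *)

(* Pointwise forms: unifying the library's [f \- g] with lambda-abstractions over matrices does not terminate in reasonable time. *)
Section PointwiseDerive.
Context {R : realType} {V W : normedModType R}.
Implicit Types (f g : V -> W) (x v : V).

Lemma is_deriveB_pt f g x v df dg : is_derive x v f df -> is_derive x v g dg ->
  is_derive x v (fun t => f t - g t) (df - dg).
Proof. by move=> ? ?; exact: is_deriveB. Qed.

Lemma is_deriveD_pt f g x v df dg : is_derive x v f df -> is_derive x v g dg ->
  is_derive x v (fun t => f t + g t) (df + dg).
Proof. by move=> ? ?; exact: is_deriveD. Qed.

Lemma is_deriveZ_pt f (a : R) x v df : is_derive x v f df ->
  is_derive x v (fun t => a *: f t) (a *: df).
Proof. by move=> ?; exact: is_deriveZ. Qed.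

Lemma is_derive1P (f : R -> W) (t : R) (l : W) : is_derive t (1 : R) f l <->
  (fun h : R => h^-1 *: (f (t + h) - f t)) @ 0^' --> l.
Proof.
have e : (fun h : R => h^-1 *: (f (t + h) - f t)) =
    (fun h : R => h^-1 *: ((f \o shift t) (h *: (1 : R)) - f t)).
  by apply/funext => h /=; rewrite [h *: _]mulr1 [_ + t]addrC.
rewrite e; split=> [[d <-]|H]; first exact: d.
by split; [apply/cvg_ex; exists l|exact: cvg_lim H].
Qed.

Lemma derivable1_continuous (f : R -> W) (t : R) : derivable f t 1 -> {for t, continuous f}.
Proof. by move=> /derivable1_diffP/differentiable_continuous. Qed.

Lemma is_derive_scale (r : R) (w : W) : is_derive r (1 : R) (fun r : R => r *: w) w.
Proof.
apply/is_derive1P; apply: (near_cvg _ (cvg_cst w)).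
have nz : \forall s \near (0:R)^', s != 0 by exact: nbhs_dnbhs_neq.
apply: filterS nz => h h0.
by rewrite -scalerBl addrAC subrr add0r scalerA mulVf// scale1r.
Qed.

End PointwiseDerive.

Section OneDim.
Context {R : realType}.

(* Connectedness of the line, in the form needed to continue local properties along curves. *)
Lemma trans_local_total (r : R -> R -> Prop) :
  (forall a b c, r a b -> r b c -> r a c) ->
  (forall t : R, exists2 e : R, 0 < e &
     forall a b, `|a - t| < e -> `|b - t| < e -> r a b) ->
  forall a b, r a b.
Proof.
move=> rT rL a b.
have rr t : exists2 e : R, 0 < e & forall u, `|u - t| < e -> r t u /\ r u t.
  have [e e0 re] := rL t; exists e => // u ut.
  by split; apply: re; rewrite // subrr normr0.
have aa : r a a by have [e e0 /(_ a)] := rr a; rewrite subrr normr0 => /(_ e0) [].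
have nbe (t e : R) : 0 < e -> nbhs t [set u | `|u - t| < e].
  by move=> e0; apply/nbhs_ballP; exists e => // u; rewrite -ball_normE /= distrC.
suff -> : r a = setT by [].
have /connected_intervalP cT : is_interval [set: R] by [].
apply: cT; first by exists a.
  exists (r a); last by rewrite setTI.
  rewrite openE => t at_; have [e e0 re] := rr t.
  by apply: filterS (nbe t e e0) => u /re[tu _]; exact: rT at_ tu.
exists (r a); last by rewrite setTI.
move=> t; have [e e0 re] := rr t.
by move/(_ _ (nbe t e e0)) => [u [au /re[_ ut]]]; exact: rT au ut.
Qed.

Context {m : nat}.
Local Notation E := 'rV[R]_m.
Implicit Types (y : R -> E) (F : E -> E).

(** Coordinatewise, which loses no factor because the norm is the maximum over the coordinates; the
    endpoints come in either order since time runs both ways. *)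
Lemma MVT_norm y (a b K : R) : (forall t, t \in `[Num.min a b, Num.max a b] ->
    derivable y t 1 /\ `|'D_1 y t| <= K) ->
  `|y b - y a| <= K * `|b - a|.
Proof.
wlog ab : a b / a <= b.
  move=> H yK; have [ab|/ltW ba] := leP a b; first exact: H.
  by rewrite distrC [`|b - a|]distrC; apply: H => //; rewrite minC maxC.
rewrite min_l// max_r// => yK.
have K0 : 0 <= K.
  have [_] := yK a (ltac:(by rewrite in_itv/= lexx ab)).
  exact: le_trans.
apply: row_norm_le => [|i]; first by rewrite mulr_ge0.
pose g (t : R) : R := y t 0 i; pose dg (t : R) : R := ('D_1 y t) 0 i.
have yd (t : R) : t \in `[a, b] -> is_derive t (1 : R) g (dg t).
  move=> /yK[yd _]; split; first by move/derivable_mxP : yd; apply.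
  by rewrite /dg derive_mx// mxE.
have yd' t (tab : t \in `]a, b[) := yd t (subset_itv_oo_cc tab).
have gc : {within `[a, b], continuous g}.
  by apply: derivable_within_continuous => t /yd [].
have [t tab] := MVT_segment ab yd' gc.
have -> : (y b - y a) 0 i = g b - g a by rewrite !mxE.
move=> ->; rewrite normrM ler_wpM2r//.
by have [_] := yK t tab; apply: le_trans; exact: coord_norm_le.
Qed.

Lemma between_dist (a b r : R) : r \in `[Num.min a b, Num.max a b] ->
  `|r - a| <= `|b - a|.
Proof.
rewrite in_itv/=; have [ab|/ltW ab] := leP a b => /andP[r1 r2].
  by rewrite !ger0_norm ?subr_ge0// lerD2r.
by rewrite !ler0_norm ?subr_le0// lerN2 lerD2r.
Qed.

Lemma norm_le_itv (t a b : R) (tau : R) : `|a| <= tau -> `|b| <= tau ->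
  t \in `[Num.min a b, Num.max a b] -> `|t| <= tau.
Proof.
rewrite !ler_norml in_itv/= => /andP[a1 a2] /andP[b1 b2] /andP[t1 t2].
by apply/andP; split; [apply: le_trans t1; rewrite le_min a1|apply: le_trans t2 _; rewrite ge_max a2].
Qed.

(* The maximum of [`|y|] controls itself, because [L * tau <= 1 / 2]. *)
Lemma short_time_bound y (tau L e : R) : 0 < tau -> 0 <= L -> L * tau <= 2^-1 ->
  (forall t, `|t| <= tau -> derivable y t 1 /\ `|'D_1 y t| <= L * `|y t| + e) ->
  forall t, `|t| <= tau -> `|y t| <= 2 * (`|y 0| + tau * e).
Proof.
move=> tau0 L0 Lt yd.
have [||c ctau cmax] := @EVT_max R (fun t => `|y t|) (- tau) tau.
- by rewrite ge0_cp ?ltW.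
- apply: continuous_in_subspaceT => t; rewrite inE/= in_itv/= -ler_norml => /yd[yd1 _].
  by apply: continuous_comp; [exact: derivable1_continuous|exact: norm_continuous].
rewrite in_itv/= -ler_norml in ctau.
have e0 : 0 <= L * `|y c| + e by have [_] := yd _ ctau; exact: le_trans.
have yc : `|y c| <= 2 * (`|y 0| + tau * e).
  have : `|y c - y 0| <= (L * `|y c| + e) * `|c - 0|.
    apply: MVT_norm => t /(norm_le_itv _ ctau).
    rewrite normr0 => /(_ (ltW tau0)) tt; have [td ty] := yd t tt; split=> //.
    by rewrite (le_trans ty)// lerD2r ler_wpM2l// cmax// in_itv/= -ler_norml.
  rewrite subr0 => h1.
  have h2 : (L * `|y c| + e) * `|c| <= 2^-1 * `|y c| + tau * e.
    rewrite (@le_trans _ _ ((L * `|y c| + e) * tau))// ?ler_wpM2l// mulrDl.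
    by rewrite mulrAC [e * _]mulrC lerD2r ler_wpM2r.
  have h3 : `|y c| <= `|y 0| + `|y c - y 0|.
    by rewrite -{1}[y c](subrKC (y 0)) ler_normD.
  lra.
by move=> t tt; rewrite (le_trans _ yc)// cmax// in_itv/= -ler_norml.
Qed.

Lemma flow_lipschitz F (B : set E) (L tau : R) (y1 y2 : R -> E) : tame F B L ->
  0 < tau -> 0 <= L -> L * tau <= 2^-1 ->
  (forall t, `|t| <= tau -> B (y1 t) /\ is_derive t 1 y1 (F (y1 t))) ->
  (forall t, `|t| <= tau -> B (y2 t) /\ is_derive t 1 y2 (F (y2 t))) ->
  forall t, `|t| <= tau -> `|y1 t - y2 t| <= 2 * `|y1 0 - y2 0|.
Proof.
move=> [_ _ FL _ _] tau0 L0 Lt h1 h2 t tt.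
have -> : 2 * `|y1 0 - y2 0| = 2 * (`|y1 0 - y2 0| + tau * 0) by rewrite mulr0 addr0.
have := @short_time_bound (fun t => y1 t - y2 t) tau L 0 tau0 L0 Lt; apply => // {tt}t tt.
have [By1 d1] := h1 t tt; have [By2 d2] := h2 t tt.
have [d ->] := is_deriveB_pt d1 d2.
by rewrite addr0; split=> //; exact: FL.
Qed.

Lemma dfield_tameB F B L z h h' : tame F B L -> B z ->
  dfield F z (h - h') = dfield F z h - dfield F z h'.
Proof.
move=> [_ DL _ _ _] Bz; have := DL z h' h (-1) Bz.
by rewrite !scaleN1r addrC [RHS]addrC.
Qed.

Lemma dfield_tameZ F B L z a h : tame F B L -> B z ->
  dfield F z (a *: h) = a *: dfield F z h.
Proof.
move=> tF Bz; have := tF => -[_ DL _ _ _].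
by rewrite -[a *: h]addr0 DL// -(subrr h) (dfield_tameB _ _ tF Bz) !subrr addr0.
Qed.

(* The difference quotients of the flow form a Cauchy family, uniformly in time; their limit solves the linearized equation. *)
Lemma flow_derivable F (B : set E) (L tau s0 : R) (z : R -> R -> E) (zeta0 : E) :
  tame F B L -> 0 < tau -> 0 <= L -> L * tau <= 2^-1 -> 0 < s0 ->
  (forall s t, `|s| < s0 -> `|t| <= tau ->
     B (z s t) /\ is_derive t (1 : R) (z s) (F (z s t))) ->
  is_derive (0 : R) (1 : R) (fun s => z s 0) zeta0 ->
  exists zeta : R -> E, [/\ zeta 0 = zeta0,
    forall t, `|t| <= tau -> is_derive (0 : R) (1 : R) (fun s => z s t) (zeta t) &
    forall t, `|t| < tau ->
      is_derive t (1 : R) zeta (dfield F (z 0 t) (zeta t))].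
Proof.
move=> tF tau0 L0 Lt s00 hz /is_derive1P z0d.
have := tF => -[FB DL FL DFL FQ].
pose q s t := s^-1 *: (z s t - z 0 t).
have z0s t : `|t| <= tau -> B (z 0 t) /\ is_derive t (1 : R) (z 0) (F (z 0 t)).
  by apply: hz; rewrite normr0.
have q0c : (fun s => q s 0) @ 0^' --> zeta0.
  by apply: (near_cvg _ z0d); apply: nearW => s; rewrite /q add0r.
pose K := `|zeta0| + 1.
have K0 : 0 < K by rewrite ltr_wpDl.
pose P (s : R) := [/\ s != 0, `|s| < s0 & `|q s 0| <= K].
have nP : \forall s \near (0:R)^', P s.
  have n1 : \forall s \near (0:R)^', s != 0 by exact: nbhs_dnbhs_neq.
  have n2 : \forall s \near (0:R)^', `|s| < s0 by exact: dnbhs0_lt.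
  have n3 : \forall s \near (0:R)^', `|q s 0| <= K.
    by have /cvgr_norm_le := q0c; apply; rewrite /K ltrDl.
  by near=> s; split; near: s.
have qd s t : `|s| < s0 -> `|t| <= tau ->
    is_derive t (1 : R) (q s) (s^-1 *: (F (z s t) - F (z 0 t))).
  move=> ss tt; have [_ d1] := hz s t ss tt; have [_ d2] := z0s t tt.
  exact: is_deriveZ_pt (is_deriveB_pt d1 d2).
have zq (s t : R) : s != 0 -> z s t - z 0 t = s *: q s t.
  by move=> sn0; rewrite /q scalerA divff// scale1r.
have nzq (s t : R) : s != 0 -> `|z s t - z 0 t| = `|s| * `|q s t|.
  by move=> sn0; rewrite zq// normrZ.
have qL s t : P s -> `|t| <= tau -> `|q s t| <= 2 * K.
  move=> [sn0 ss qK] tt; rewrite (@le_trans _ _ (2 * `|q s 0|))//; last by rewrite ler_wpM2l.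
  have := flow_lipschitz tF tau0 L0 Lt (hz s ^~ ss) z0s tt.
  by rewrite (nzq _ _ sn0) (nzq _ _ sn0) mulrCA ler_pM2l// normr_gt0.
(* From the Taylor remainder of [F] over an increment of size at most [2 * K * |s|], divided by
   [s]. *)
pose C := L * (2 * K) ^+ 2.
have C0 : 0 <= C by rewrite mulr_ge0// exprn_ge0// mulr_ge0// ltW.
have err s t : P s -> `|t| <= tau ->
    `|s^-1 *: (F (z s t) - F (z 0 t)) - dfield F (z 0 t) (q s t)| <= C * `|s|.
  move=> Ps tt; have [sn0 ss _] := Ps.
  have [Bz _] := hz s t ss tt; have [Bz0 _] := z0s t tt.
  have -> : dfield F (z 0 t) (q s t) = s^-1 *: dfield F (z 0 t) (z s t - z 0 t).
    by rewrite zq// (dfield_tameZ s _ tF Bz0) scalerA mulVf// scale1r.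
  rewrite -scalerBr normrZ (le_trans (ler_wpM2l _ (FQ _ _ Bz0 Bz)))//.
  rewrite (nzq _ _ sn0) normfV.
  have -> : `|s|^-1 * (L * (`|s| * `|q s t|) ^+ 2) = L * `|q s t| ^+ 2 * `|s|.
    by field; rewrite normr_eq0.
  rewrite /C ler_wpM2r// ler_wpM2l// lerXn2r ?nnegrE//.
    by rewrite mulr_ge0// ltW.
  exact: qL.
have diff s s' t : P s -> P s' -> `|t| <= tau ->
    `|q s t - q s' t| <= 2 * (`|q s 0 - q s' 0| + tau * (C * (`|s| + `|s'|))).
  move=> Ps Ps'; have [sn0 ss _] := Ps; have [sn0' ss' _] := Ps'.
  apply: (short_time_bound (y := fun t => q s t - q s' t) tau0 L0 Lt) => {}t tt.
  have [d ->] := is_deriveB_pt (qd s t ss tt) (qd s' t ss' tt); split=> //.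
  have [Bz0 _] := z0s t tt.
  set A := _ *: _; set A' := _ *: _.
  have -> : A - A' = dfield F (z 0 t) (q s t - q s' t)
      + ((A - dfield F (z 0 t) (q s t)) - (A' - dfield F (z 0 t) (q s' t))).
    rewrite (dfield_tameB _ _ tF Bz0); set u := dfield _ _ _; set u' := dfield _ _ _.
    by move: A A' u u' => A A' u u'; apply/rowP => i; rewrite !mxE; ring.
  rewrite (le_trans (ler_normD _ _))// lerD//; first by have [_] := FB _ (q s t - q s' t) Bz0.
  by rewrite (le_trans (ler_normB _ _))// mulrDr lerD// err.
have n0 : (fun s : R => `|s|) @ 0^' --> (0 : R).
  have i0 : (fun s : R => s) @ 0^' --> (0 : R) by exact: cvg_within.
  by apply/norm_cvg0P.
have qc t : `|t| <= tau -> cvg ((fun s => q s t) @ 0^').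
  move=> tt; apply/cauchy_cvgP/cauchy_exP => e e0.
  (* With [s], [s'] and the distances of the initial quotients to [zeta0] below [d], the bound in
     [diff] is at most half of [e]. *)
  pose d := e / (4 * (2 + tau * (2 * C))).
  have c0 : 0 < 4 * (2 + tau * (2 * C)).
    by rewrite mulr_gt0// ltr_wpDr// mulr_ge0 ?(ltW tau0)// mulr_ge0.
  have d0 : 0 < d by rewrite divr_gt0.
  have n1 : \forall s \near (0:R)^', [/\ P s, `|s| < d & `|q s 0 - zeta0| < d].
    have n2 : \forall s \near (0:R)^', `|s| < d by exact: dnbhs0_lt.
    have n3 : \forall s \near (0:R)^', `|q s 0 - zeta0| < d.
      by near=> s; rewrite distrC; near: s; have /cvgrPdist_lt := q0c; exact.
    by near=> s; split; near: s.
  near ((0 : R)^') => s.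
  have [Ps sd qsd] : [/\ P s, `|s| < d & `|q s 0 - zeta0| < d] by near: s.
  exists (q s t).
  suff : \forall s' \near (0 : R)^', ball (q s t) e (q s' t) by [].
  near=> s'; rewrite -ball_normE /=.
  have [Ps' sd' qsd'] : [/\ P s', `|s'| < d & `|q s' 0 - zeta0| < d] by near: s'.
  rewrite (le_lt_trans (diff s s' t Ps Ps' tt))//.
  have h1 : `|q s 0 - q s' 0| <= 2 * d.
    have -> : q s 0 - q s' 0 = (q s 0 - zeta0) - (q s' 0 - zeta0).
      by rewrite opprB addrC addrA subrK addrC.
    by rewrite (le_trans (ler_normB _ _))// mulr2n mulrDl !mul1r lerD// ltW.
  have h2 : tau * (C * (`|s| + `|s'|)) <= tau * (C * (2 * d)).
    by rewrite ler_wpM2l ?(ltW tau0)// ler_wpM2l// mulr2n mulrDl !mul1r lerD// ltW.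
  have h3 : e = d * (4 * (2 + tau * (2 * C))) by rewrite /d divfK// gt_eqF.
  have h4 : 0 <= tau * (C * (2 * d)).
    by rewrite mulr_ge0 ?(ltW tau0)// mulr_ge0// mulr_ge0// ltW.
  rewrite (@le_lt_trans _ _ (2 * (2 * d + tau * (C * (2 * d)))))//.
    by rewrite ler_wpM2l// lerD.
  have -> : e = 2 * (2 * d + tau * (C * (2 * d))) * 2 by rewrite {1}h3; ring.
  by rewrite ltr_pMr ?ltr1n// mulr_gt0// ltr_wpDr// mulr_gt0.
pose zeta t := lim ((fun s => q s t) @ 0^').
have zc t : `|t| <= tau -> (fun s => q s t) @ 0^' --> zeta t by move=> /qc.
have t0 : `|0 : R| <= tau by rewrite normr0 ltW.
have zeta00 : zeta 0 = zeta0 by apply: cvg_lim.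
pose Eb s := 2 * (`|q s 0 - zeta0| + tau * (C * `|s|)).
have Ebc : Eb @ 0^' --> (0 : R).
  suff : Eb @ 0^' --> 2 * (`|zeta0 - zeta0| + tau * (C * 0)).
    by rewrite subrr normr0 !mulr0 addr0 mulr0.
  apply: cvgM; first exact: cvg_cst.
  apply: cvgD; first by apply: cvg_norm; apply: cvgB => //; exact: cvg_cst.
  by apply: cvgM; [exact: cvg_cst|apply: cvgM => //; exact: cvg_cst].
have qz s t : P s -> `|t| <= tau -> `|q s t - zeta t| <= Eb s.
  move=> Ps tt.
  have l1 : (fun s' => `|q s t - q s' t|) @ 0^' --> `|q s t - zeta t|.
    by apply: cvg_norm; apply: cvgB; [exact: cvg_cst|exact: zc].
  have l2 : (fun s' => 2 * (`|q s 0 - q s' 0| + tau * (C * (`|s| + `|s'|)))) @ 0^' --> Eb s.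
    rewrite /Eb -[X in C * X]addr0; apply: cvgM; first exact: cvg_cst.
    apply: cvgD; first by apply: cvg_norm; apply: cvgB; [exact: cvg_cst|exact: q0c].
    apply: cvgM; first exact: cvg_cst.
    apply: cvgM; first exact: cvg_cst.
    by apply: cvgD => //; exact: cvg_cst.
  apply: (ler_cvg_to l1 l2); near=> s'; apply: diff => //.
  by near: s'.
have zetaK t : `|t| <= tau -> `|zeta t| <= 2 * K.
  move=> tt; apply: (ler_cvg_to (cvg_norm (zc t tt)) (cvg_cst (2 * K))).
  by near=> s; apply: qL => //; near: s.
have zlip t t' : `|t| <= tau -> `|t'| <= tau -> `|zeta t' - zeta t| <= L * (2 * K) * `|t' - t|.
  move=> tt tt'.
  have l1 : (fun s => `|q s t' - q s t|) @ 0^' --> `|zeta t' - zeta t|.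
    by apply: cvg_norm; apply: cvgB; exact: zc.
  apply: (ler_cvg_to l1 (cvg_cst _)); near=> s.
  have Ps : P s by near: s.
  have [sn0 ss _] := Ps.
  apply: MVT_norm => r /(norm_le_itv tt tt') rr.
  have [d ->] := qd s r ss rr; split=> //.
  have [Bz _] := hz s r ss rr; have [Bz0 _] := z0s r rr.
  rewrite normrZ (le_trans (ler_wpM2l _ (FL _ _ Bz0 Bz)))// (nzq _ _ sn0) normfV.
  rewrite mulrCA -[L * (2 * K)]/(L * _) ler_wpM2l// mulKf ?normr_eq0//.
  exact: qL.
exists zeta; split=> //.
  move=> t tt; apply/is_derive1P; apply: (near_cvg _ (zc t tt)).
  by apply: nearW => s; rewrite /q add0r.
move=> t tt; have tt' := ltW tt.
have [Bzt _] := z0s t tt'.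
set w := dfield F (z 0 t) (zeta t).
(* Controls the change of the right-hand side [dfield F (z 0 r) (zeta r)] away from [r = t]: the
   first term is due to the motion of [z 0], the second to that of [zeta]. *)
pose C2 := L * L * (2 * K) + L * (L * (2 * K)).
have C20 : 0 <= C2 by rewrite addr_ge0// ?mulr_ge0// ?mulr_ge0// ltW.
have zz r r' : `|r| <= tau -> `|r'| <= tau -> `|z 0 r' - z 0 r| <= L * `|r' - r|.
  move=> rt rt'; apply: MVT_norm => u /(norm_le_itv rt rt') ut.
  have [Bz [d ->]] := z0s u ut; split=> //.
  by have [] := FB _ 0 Bz.
have dw r : `|r| <= tau -> `|dfield F (z 0 r) (zeta r) - w| <= C2 * `|r - t|.
  move=> rt; have [Bzr _] := z0s r rt.
  have -> : dfield F (z 0 r) (zeta r) - w =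
    (dfield F (z 0 r) (zeta r) - dfield F (z 0 t) (zeta r)) + dfield F (z 0 t) (zeta r - zeta t).
    by rewrite (dfield_tameB _ _ tF Bzt) addrA subrK.
  rewrite (le_trans (ler_normD _ _))// /C2 mulrDl lerD//.
    rewrite (le_trans (DFL _ _ _ Bzt Bzr))// -mulrA.
    rewrite [leRHS](_ : _ = L * ((L * `|r - t|) * (2 * K))); last by ring.
    rewrite ler_wpM2l// ler_pM//; first exact: zz.
    exact: zetaK.
  have [_ /le_trans] := FB _ (zeta r - zeta t) Bzt; apply.
  by rewrite -!mulrA ler_wpM2l// mulrA mulrA -[L * 2 * K]mulrA zlip.
(* The derivative in time and the limit in [s] are interchanged through an inequality: for fixed [s]
   the mean value bound applies to [q s r - r *: w], and only afterwards does [s] tend to 0. *)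
have key h : `|t + h| <= tau -> `|zeta (t + h) - zeta t - h *: w| <= C2 * `|h| * `|h|.
  move=> th.
  have l1 : (fun s => `|q s (t + h) - q s t - h *: w|) @ 0^' --> `|zeta (t + h) - zeta t - h *: w|.
    apply: cvg_norm; apply: cvgB; last exact: cvg_cst.
    by apply: cvgB; exact: zc.
  have l2 : (fun s => (C * `|s| + L * Eb s + C2 * `|h|) * `|h|) @ 0^' --> C2 * `|h| * `|h|.
    suff : (fun s => (C * `|s| + L * Eb s + C2 * `|h|) * `|h|) @ 0^' --> (C * 0 + L * 0 + C2 * `|h|) * `|h|.
      by rewrite !mulr0 !add0r.
    apply: cvgM; last exact: cvg_cst.
    apply: cvgD; last exact: cvg_cst.
    by apply: cvgD; apply: cvgM => //; exact: cvg_cst.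
  apply: (ler_cvg_to l1 l2); near=> s.
  have Ps : P s by near: s.
  have [sn0 ss _] := Ps.
  pose y r := q s r - r *: w.
  have -> : q s (t + h) - q s t - h *: w = y (t + h) - y t.
    by rewrite /y scalerDl; move: (q s (t + h)) (q s t) (w) => a b w'; apply/rowP => i; rewrite !mxE; ring.
  have -> : `|h| = `|t + h - t| by rewrite addrC addrA addNr add0r.
  apply: MVT_norm => r rI; have rt := norm_le_itv tt' th rI.
  have rh : `|r - t| <= `|t + h - t|.
    exact: between_dist.
  have idw : is_derive r (1 : R) (fun r : R => r *: w) w.
    exact: is_derive_scale.
  have [d ->] := is_deriveB_pt (qd s r ss rt) idw; split=> //.
  have [Bzr _] := z0s r rt.
  set A := _ *: _.
  have -> : A - w = (A - dfield F (z 0 r) (q s r)) + dfield F (z 0 r) (q s r - zeta r)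
     + (dfield F (z 0 r) (zeta r) - w).
    rewrite (dfield_tameB _ _ tF Bzr); set u := dfield _ _ _; set u' := dfield _ _ _.
    by move: A u u' (w) => A u u' w'; apply/rowP => i; rewrite !mxE; ring.
  rewrite (le_trans (ler_normD _ _))// lerD//; last first.
    by rewrite (le_trans (dw r rt))// ler_wpM2l.
  rewrite (le_trans (ler_normD _ _))// lerD//; first exact: err.
  have [_ /le_trans] := FB _ (q s r - zeta r) Bzr; apply.
  by rewrite ler_wpM2l// qz.
apply/is_derive1P/cvgrPdist_le => e e0; near=> h.
have hn0 : h != 0 by near: h; exact: nbhs_dnbhs_neq.
have th : `|t + h| <= tau.
  rewrite (le_trans (ler_normD _ _))// -lerBrDl ltW//; near: h.
  by apply: dnbhs0_lt; rewrite subr_gt0.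
have hC : C2 * `|h| <= e.
  have : `|h| < e / (C2 + 1) by near: h; apply: dnbhs0_lt; rewrite divr_gt0// ltr_wpDl.
  rewrite ltr_pdivlMr ?ltr_wpDl// => /ltW; apply: le_trans.
  by rewrite mulrDr mulr1 mulrC ler_wpDr.
rewrite distrC (_ : _ - w = h^-1 *: (zeta (t + h) - zeta t - h *: w)); last first.
  by rewrite [RHS]scalerBr scalerA mulVf// scale1r.
rewrite normrZ normfV mulrC ler_pdivrMr ?normr_gt0//.
by rewrite (le_trans (key h th))// ler_wpM2r.
Unshelve. all: by end_near. Qed.

End OneDim.

(** * Chain and product rules for vector-valued maps, second derivatives *)

Section RowCalculus.
Context {R : realType} {m p : nat}.
Local Notation E := 'rV[R]_m.
Local Notation F := 'rV[R]_p.
Implicit Types (U : set E) (f : E -> F).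

Lemma is_derive_rowP (V : normedModType R) (c : V -> F) x v w :
  is_derive x v c w <-> forall j, is_derive x v (fun y => c y 0 j : R) (w 0 j).
Proof.
split=> [[cd <-] j|H].
  by split; [move/derivable_mxP : cd; apply|rewrite derive_mx// mxE].
have cd : derivable c x v by apply/derivable_mxP => i j; rewrite ord1; case: (H j).
split=> //; rewrite derive_mx//; apply/rowP => j; rewrite mxE.
by case: (H j).
Qed.

Lemma derive_rowE U f x v j : Ck 1 U f -> U x ->
  ('D_v f x) 0 j = 'D_v (fun y => f y 0 j : R) x.
Proof.
by move=> fk Ux; rewrite derive_mx ?mxE//; exact: CkS_derivable fk Ux.
Qed.

Lemma derive_lin U f x (a : R) (u v : E) : open U -> Ck 1 U f -> U x ->
  'D_(a *: u + v) f x = a *: 'D_u f x + 'D_v f x.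
Proof.
move=> oU fk Ux; apply/rowP => j; have fj : Ck 1 U (fun y => f y 0 j : R) by exact: Ck_coord.
have e1 := derive_rowE (a *: u + v) j fk Ux.
have e2 := Ck1_deriveD (a *: u) v oU fj Ux.
have e3 := Ck1_deriveZ a u fj Ux.
have e4 := derive_rowE u j fk Ux; have e5 := derive_rowE v j fk Ux.
by rewrite [LHS]e1 [LHS]e2 [X in X + _]e3 -e4 -e5 [RHS]mxE; congr (_ + _); rewrite mxE.
Qed.

Lemma is_derive_comp_row U f (V : normedModType R) (c : V -> E) x v w :
  open U -> Ck 1 U f -> U (c x) -> is_derive x v c w ->
  is_derive x v (f \o c) ('D_w f (c x)).
Proof.
move=> oU fk Ux cd; apply/is_derive_rowP => j.
rewrite (derive_rowE _ _ fk Ux).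
have fj : Ck 1 U (fun y => f y 0 j : R) by exact: Ck_coord.
exact: (is_derive_comp oU fj Ux cd).
Qed.

End RowCalculus.

Section Products.
Context {R : realType} {V : normedModType R}.

Lemma is_derive_quotP (W : normedModType R) (f : V -> W) x v l : is_derive x v f l <->
  (fun h : R => h^-1 *: (f (h *: v + x) - f x)) @ 0^' --> l.
Proof.
split=> [[d <-]|H]; first exact: d.
by split; [apply/cvg_ex; exists l|exact: cvg_lim H].
Qed.

Lemma line_eq_is_derive (W : normedModType R) (f g : V -> W) x v l : f x = g x ->
  (\forall h \near (0 : R)^', f (h *: v + x) = g (h *: v + x)) ->
  is_derive x v f l -> is_derive x v g l.
Proof.
move=> fgx fg /is_derive_quotP fd; apply/is_derive_quotP.
by apply: (near_cvg _ fd); apply: filterS fg => h ->; rewrite fgx.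
Qed.

Lemma line_cvg (W : normedModType R) (f : V -> W) x v l : is_derive x v f l ->
  (fun h : R => f (h *: v + x)) @ 0^' --> f x.
Proof.
move=> [fd _].
have H : (fun s : R => f (s *: v + x) - f x + f x) @ 0^' --> 0 + f x.
  by apply: cvgD; [exact: cvg_difference_quotient|exact: cvg_cst].
by rewrite add0r in H; apply: (near_cvg _ H); apply: nearW => h; rewrite subrK.
Qed.

Lemma is_deriveM_pt (f g : V -> R) x v df dg : is_derive x v f df -> is_derive x v g dg ->
  is_derive x v (fun t => f t * g t) (df * g x + f x * dg).
Proof.
move=> fd gd; have -> : df * g x + f x * dg = f x *: dg + g x *: df.
  by rewrite addrC [df * _]mulrC.
exact: is_deriveM fd gd.
Qed.

Lemma is_derive_sum_pt (I : Type) (r : seq I) (P : pred I) (f : I -> V -> R) (df : I -> R) x v :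
  (forall i, is_derive x v (f i) (df i)) ->
  is_derive x v (fun t => \sum_(i <- r | P i) f i t) (\sum_(i <- r | P i) df i).
Proof.
move=> fd; elim: r => [|i r IH].
  rewrite big_nil (_ : (fun _ => _) = cst 0); first exact: is_derive_cst.
  by apply/funext => t; rewrite big_nil.
rewrite big_cons (_ : (fun _ => _) = (fun t => if P i then f i t + \sum_(j <- r | P j) f j t
    else \sum_(j <- r | P j) f j t)); last by apply/funext => t; rewrite big_cons.
by case: (P i) => //; exact: is_deriveD_pt.
Qed.

End Products.

(* Otherwise unification unfolds derivatives down to filters on matrices. *)
#[local] Opaque derive derivable.

Section SecondOrder.
Context {R : realType} {m : nat}.
Local Notation E := 'rV[R]_m.
Implicit Types (U : set E).

Lemma is_derive_derive U (f : E -> R) (V : normedModType R) (y w : V -> E) x v dy dw :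
  open U -> Ck 2 U f -> U (y x) -> is_derive x v y dy -> is_derive x v w dw ->
  is_derive x v (fun s => 'D_(w s) f (y s)) ('D_(w x) ('D_dy f) (y x) + 'D_dw f (y x)).
Proof.
move=> oU fk Ux yd wd; have fk1 : Ck 1 U f by exact: CkS_Ck1 fk.
pose e i : E := delta_mx 0 i.
have dfk i : Ck 1 U ('D_(e i) f) by exact: CkS_derive.
pose h s := \sum_i w s 0 i * 'D_(e i) f (y s).
have hd : is_derive x v h (\sum_i (dw 0 i * 'D_(e i) f (y x) + w x 0 i * 'D_dy ('D_(e i) f) (y x))).
  apply: is_derive_sum_pt => i; apply: is_deriveM_pt.
    by move/is_derive_rowP : wd.
  exact: (is_derive_comp oU (dfk i) Ux yd).
have e1 : 'D_(w x) ('D_dy f) (y x) + 'D_dw f (y x) = \sum_i (dw 0 i * 'D_(e i) f (y x) + w x 0 i * 'D_dy ('D_(e i) f) (y x)).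
  rewrite big_split/= addrC -(Ck1_deriveE _ oU fk1 Ux); congr (_ + _).
  have dk : Ck 1 U ('D_dy f) by exact: CkS_derive.
  rewrite (Ck1_deriveE _ oU dk Ux); apply: eq_bigr => i _.
  by rewrite (Ck2_deriveC _ _ oU fk Ux).
rewrite e1; apply: (line_eq_is_derive _ _ hd); first by rewrite /h -(Ck1_deriveE _ oU fk1 Ux).
have nU : \forall s \near (0 : R)^', U (y (s *: v + x)).
  by apply: (line_cvg yd); exact: open_nbhs_nbhs.
by apply: filterS nU => s Us; rewrite /h -(Ck1_deriveE _ oU fk1 Us).
Qed.

End SecondOrder.

Section SecondOrderRow.
Context {R : realType} {m p : nat}.
Local Notation E := 'rV[R]_m.
Implicit Types (U : set E) (f : E -> 'rV[R]_p).

Lemma is_derive_derive_row U f (V : normedModType R) (y w : V -> E) x v dy dw :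
  open U -> Ck 2 U f -> U (y x) -> is_derive x v y dy -> is_derive x v w dw ->
  is_derive x v (fun s => 'D_(w s) f (y s)) ('D_(w x) ('D_dy f) (y x) + 'D_dw f (y x)).
Proof.
move=> oU fk Ux yd wd; have fk1 : Ck 1 U f by exact: CkS_Ck1 fk.
apply/is_derive_rowP => j.
have fj : Ck 2 U (fun y => f y 0 j : R) by exact: Ck_coord.
have fdy : Ck 1 U ('D_dy f) by exact: CkS_derive.
have e1 := derive_rowE (w x) j fdy Ux; have e2 := derive_rowE dw j fk1 Ux.
rewrite mxE [X in X + _]e1 [X in _ + X]e2.
have H := is_derive_derive oU fj Ux yd wd.
rewrite (near_eq_derive (w x) (g := 'D_dy (fun y => f y 0 j : R))); last first.
  by apply: open_near_eq oU _ Ux => z; rewrite inE => Uz; exact: derive_rowE fk1 Uz.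
apply: (line_eq_is_derive _ _ H); first exact/esym/(derive_rowE (w x) j fk1 Ux).
have nU : \forall s \near (0 : R)^', U (y (s *: v + x)).
  by apply: (line_cvg yd); exact: open_nbhs_nbhs.
by apply: filterS nU => s Us; exact/esym/(derive_rowE _ j fk1 Us).
Qed.

Lemma Ck2_deriveC_row U f x (u v : E) : open U -> Ck 2 U f -> U x ->
  'D_u ('D_v f) x = 'D_v ('D_u f) x.
Proof.
move=> oU fk Ux; have fk1 : Ck 1 U f by exact: CkS_Ck1 fk.
have fd w : Ck 1 U ('D_w f) by exact: CkS_derive.
apply/rowP => j; have e1 := derive_rowE u j (fd v) Ux; have e2 := derive_rowE v j (fd u) Ux.
rewrite [LHS]e1 [RHS]e2.
have fj : Ck 2 U (fun y => f y 0 j : R) by exact: Ck_coord.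
have e w w' : 'D_w (fun z => 'D_w' f z 0 j : R) x = 'D_w ('D_w' (fun y => f y 0 j : R)) x.
  apply: near_eq_derive; apply: open_near_eq oU _ Ux => z; rewrite inE => Uz.
  exact: derive_rowE fk1 Uz.
by rewrite [LHS](e u v) [RHS](e v u); exact: (Ck2_deriveC _ _ oU fj Ux).
Qed.

End SecondOrderRow.

(** * Coordinates of vectors *)

(** The transition map between two charts; the time bounds that are also called [tau] are
    unrelated. *)
Definition tau (R : realType) (n : nat) (M : manifold R n) (q p : M) (x : 'rV[R]_n) : 'rV[R]_n :=
  chart p (ichart q x).

(* Change of coordinates of tangent vectors at [P], from [chart q] to [chart p]. *)
HB.lock Definition tr (R : realType) (n : nat) (M : manifold R n) (q p P : M) (v : 'rV[R]_n) : 'rV[R]_n :=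
  'D_v (tau q p) (chart q P).
Arguments tr {R n M} q p P v.

(* [tc q P] is [tcoord q P]; [vec q P] is its inverse. *)
Notation tc q P := (tr P q P).
Notation vec q P := (tr q P P).

Section Charts.
Context {R : realType} {n : nat} {M : manifold R n}.
Local Notation V := 'rV[R]_n.
Implicit Types (p q r P : M) (x y u v w : V) (c : R -> M).

Definition cdom q : set V := chart q @` dom M q.

Definition overlap q p : set V := chart q @` (dom M q `&` dom M p).

Lemma cdom_chart q P : dom M q P -> cdom q (chart q P).
Proof. by move=> qP; exists P. Qed.

Lemma overlap_chart q p P : dom M q P -> dom M p P -> overlap q p (chart q P).
Proof. by move=> qP pP; exists P. Qed.

Lemma ichartK q x : cdom q x -> chart q (ichart q x) = x.
Proof. by move=> [P qP <-]; rewrite chartK. Qed.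

Lemma ichart_dom q x : cdom q x -> dom M q (ichart q x).
Proof. by move=> [P qP <-]; rewrite chartK. Qed.

Lemma open_cdom q : open (cdom q).
Proof. exact: chart_open. Qed.

Lemma overlapE q p : overlap q p = cdom q `&` (ichart q @^-1` dom M p).
Proof.
apply/seteqP; split=> x.
  by move=> [P [qP pP] <-]; split; [exists P|rewrite /= chartK].
by move=> [[P qP <-]]; rewrite /= chartK// => pP; exists P.
Qed.

Lemma open_overlap q p : open (overlap q p).
Proof.
rewrite openE => x; rewrite overlapE => -[qx px] /=; apply: filterI.
  by apply: open_nbhs_nbhs; split=> //; exact: open_cdom.
have ic : {for x, continuous (ichart q)} by exact: ichart_continuous.
apply: ic; apply: open_nbhs_nbhs; split=> //; exact: dom_open.
Qed.

Lemma tau_Ck k q p : Ck k (overlap q p) (tau q p).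
Proof. exact: chart_smooth. Qed.

Lemma tcoordE q P v : tcoord q P v = tc q P v.
Proof. by rewrite tr.unlock. Qed.

Lemma tvecE q x v : cdom q x -> tvec q x v = vec q (ichart q x) v.
Proof. by move=> qx; rewrite tr.unlock ichartK. Qed.

Lemma tr_unlockE q p P v : tr q p P v = 'D_v (tau q p) (chart q P).
Proof. by rewrite tr.unlock. Qed.

Lemma tr_lin q p P (a : R) u v : dom M q P -> dom M p P ->
  tr q p P (a *: u + v) = a *: tr q p P u + tr q p P v.
Proof.
move=> qP pP; rewrite tr.unlock; exact: (derive_lin _ _ _ (@open_overlap q p) (@tau_Ck 1 q p) (overlap_chart qP pP)).
Qed.

Lemma tr0 q p P : tr q p P 0 = 0.
Proof. rewrite tr.unlock; exact: derive0. Qed.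

Lemma trD q p P u v : dom M q P -> dom M p P -> tr q p P (u + v) = tr q p P u + tr q p P v.
Proof. by move=> qP pP; rewrite -{1}[u]scale1r tr_lin// scale1r. Qed.

Lemma trZ q p P (a : R) u : dom M q P -> dom M p P -> tr q p P (a *: u) = a *: tr q p P u.
Proof. by move=> qP pP; have := tr_lin a u 0 qP pP; rewrite tr0 !addr0. Qed.

Lemma near_cdom q x : cdom q x -> \forall y \near x, cdom q y.
Proof. by move=> qx; apply: open_nbhs_nbhs; split=> //; exact: open_cdom. Qed.

Lemma near_overlap q p x : overlap q p x -> \forall y \near x, overlap q p y.
Proof. by move=> qx; apply: open_nbhs_nbhs; split=> //; exact: open_overlap. Qed.

Lemma tr_id q P v : dom M q P -> tr q q P v = v.
Proof.
move=> qP; rewrite tr.unlock -[RHS](derive_id (chart q P) v).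
apply: near_eq_derive; apply: filterS (near_cdom (cdom_chart qP)) => y qy.
by rewrite /tau ichartK.
Qed.

(** The cocycle rule, which is the chain rule for transition maps. *)
Lemma tr_comp q p r P v : dom M q P -> dom M p P -> dom M r P ->
  tr q r P v = tr p r P (tr q p P v).
Proof.
move=> qP pP rP.
have H : is_derive (chart q P) v (tau q p) (tr q p P v).
  rewrite tr.unlock; split=> //; apply: CkS_derivable (@tau_Ck 1 q p) (overlap_chart qP pP).
have tP : tau q p (chart q P) = chart p P by rewrite /tau chartK.
have H2 := @is_derive_comp_row R n n (overlap p r) (tau p r) _ (tau q p) (chart q P) v (tr q p P v)
   (@open_overlap p r) (@tau_Ck 1 p r).
rewrite tP in H2; have [_ H3] := H2 (overlap_chart pP rP) H.
rewrite [RHS]tr_unlockE -[RHS]H3 [LHS]tr_unlockE; apply: near_eq_derive.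
apply: filterS (near_overlap (overlap_chart qP pP)) => y.
by rewrite overlapE => -[qy py]; rewrite /tau /= chartK.
Qed.

Lemma trK q p P v : dom M q P -> dom M p P -> tr p q P (tr q p P v) = v.
Proof. by move=> qP pP; rewrite -tr_comp// tr_id. Qed.

Lemma tc_vec q P v : dom M q P -> tc q P (vec q P v) = v.
Proof. by move=> qP; rewrite trK//; exact: dom_center. Qed.

Lemma vec_tc q P v : dom M q P -> vec q P (tc q P v) = v.
Proof. by move=> qP; rewrite trK//; exact: dom_center. Qed.

Lemma tc_id P v : tc P P v = v.
Proof. by rewrite tr_id//; exact: dom_center. Qed.

Lemma tr_tc q p P v : dom M q P -> dom M p P -> tr q p P (tc q P v) = tc p P v.
Proof. by move=> qP pP; rewrite -tr_comp//; exact: dom_center. Qed.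

Lemma tc_lin q P (a : R) u v : dom M q P -> tc q P (a *: u + v) = a *: tc q P u + tc q P v.
Proof. by move=> qP; rewrite tr_lin//; exact: dom_center. Qed.

Lemma tcD q P u v : dom M q P -> tc q P (u + v) = tc q P u + tc q P v.
Proof. by move=> qP; rewrite trD//; exact: dom_center. Qed.

Lemma tcZ q P a v : dom M q P -> tc q P (a *: v) = a *: tc q P v.
Proof. by move=> qP; rewrite trZ//; exact: dom_center. Qed.

Lemma vecZ q P a v : dom M q P -> vec q P (a *: v) = a *: vec q P v.
Proof. by move=> qP; rewrite trZ//; exact: dom_center. Qed.

Lemma tc_inj q P u v : dom M q P -> tc q P u = tc q P v -> u = v.
Proof. by move=> qP uv; rewrite -(vec_tc u qP) uv vec_tc. Qed.

Lemma near_dom q c t : {for t, continuous c} -> dom M q (c t) ->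
  \forall s \near t, dom M q (c s).
Proof.
move=> cc qt; apply: cc; apply: open_nbhs_nbhs; split=> //; exact: dom_open.
Qed.

Lemma near_eq_derive1 (W : normedModType R) (f g : R -> W) (t : R) l :
  (\forall s \near t, f s = g s) -> is_derive t (1 : R) f l -> is_derive t (1 : R) g l.
Proof. exact: near_eq_is_derive. Qed.

Lemma curve_chart_change q p c t w : {for t, continuous c} ->
  dom M q (c t) -> dom M p (c t) ->
  is_derive t (1 : R) (fun s => chart q (c s)) w ->
  is_derive t (1 : R) (fun s => chart p (c s)) (tr q p (c t) w).
Proof.
move=> cc qt pt cd.
have H := is_derive_comp_row (@open_overlap q p) (@tau_Ck 1 q p) (overlap_chart qt pt) cd.
rewrite -tr_unlockE in H; apply: near_eq_derive1 H; apply: filterS (near_dom cc qt) => s qs.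
by rewrite /= /tau chartK.
Qed.

Lemma curve_chart q c t : curve_derivable c t -> dom M q (c t) ->
  is_derive t (1 : R) (fun s => chart q (c s)) (tc q (c t) (velocity c t)).
Proof.
move=> [cc cd] qt; apply: (curve_chart_change cc (dom_center (c t)) qt).
by split; [exact: cd|rewrite /velocity derive1E].
Qed.

Lemma curve_derivableP q c t w : dom M q (c t) -> {for t, continuous c} ->
  is_derive t (1 : R) (fun s => chart q (c s)) w ->
  curve_derivable c t /\ velocity c t = vec q (c t) w.
Proof.
move=> qt cc cd.
have [d e] := curve_chart_change cc qt (dom_center (c t)) cd.
by split; [split|rewrite /velocity derive1E e].
Qed.

(* The second-order term makes the derivative of a field along a curve depend on the chart. *)
Lemma field_chart_change q p c (X : R -> V) t w dX : {for t, continuous c} ->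
  dom M q (c t) -> dom M p (c t) ->
  is_derive t (1 : R) (fun s => chart q (c s)) w ->
  is_derive t (1 : R) (fun s => tc q (c s) (X s)) dX ->
  is_derive t (1 : R) (fun s => tc p (c s) (X s))
    ('D_(tc q (c t) (X t)) ('D_w (tau q p)) (chart q (c t)) + tr q p (c t) dX).
Proof.
move=> cc qt pt cd Xd.
have H := is_derive_derive_row (@open_overlap q p) (@tau_Ck 2 q p) (overlap_chart qt pt) cd Xd.
rewrite -tr_unlockE in H; apply: near_eq_derive1 H.
apply: filterS2 (near_dom cc qt) (near_dom cc pt) => s qs ps.
by rewrite -tr_unlockE tr_tc.
Qed.

End Charts.

(** * The Levi-Civita connection in charts *)

HB.lock Definition ip (R : realType) (n : nat) (M : manifold R n) (g : riemannian_metric M)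
  (P : M) (u v : 'rV[R]_n) : R := inner g P u v.
Arguments ip {R n M} g P u v.

HB.lock Definition ginner (R : realType) (n : nat) (M : manifold R n) (g : riemannian_metric M)
  (q : M) (x u v : 'rV[R]_n) : R := ip g (ichart q x) (tvec q x u) (tvec q x v).
Arguments ginner {R n M} g q x u v.

HB.lock Definition mcoef (R : realType) (n : nat) (M : manifold R n) (g : riemannian_metric M)
  (q : M) (i j : 'I_n) (x : 'rV[R]_n) : R := metric_coef g q x i j.
Arguments mcoef {R n M} g q i j x.

HB.lock Definition Gam (R : realType) (n : nat) (M : manifold R n) (g : riemannian_metric M)
  (q : M) (x u v : 'rV[R]_n) : 'rV[R]_n :=
  \row_k \sum_(i < n) \sum_(j < n) christoffel g q x k i j * u 0 i * v 0 j.
Arguments Gam {R n M} g q x u v.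

(** The part of the product rule for an inner product in which the metric itself is differentiated,
    in direction [u]. *)
HB.lock Definition dmetric (R : realType) (n : nat) (M : manifold R n) (g : riemannian_metric M)
  (q : M) (x u v w : 'rV[R]_n) : R :=
  \sum_i \sum_j v 0 i * w 0 j * 'D_u (mcoef g q i j) x.
Arguments dmetric {R n M} g q x u v w.

Section Metric.
Context {R : realType} {n : nat} {M : manifold R n} (g : riemannian_metric M).
Local Notation V := 'rV[R]_n.
Implicit Types (p q P : M) (x y u v w h : V).

Lemma ip_sym P u v : ip g P u v = ip g P v u.
Proof.
rewrite ip.unlock /inner.
have -> : (u *m gram g P *m v^T) 0 0 = ((u *m gram g P *m v^T)^T) 0 0 by rewrite [RHS]mxE.
by rewrite !trmx_mul trmxK gram_sym mulmxA.
Qed.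

Lemma ip_lin P (a : R) u v w :
  ip g P (a *: u + v) w = a * ip g P u w + ip g P v w.
Proof. by rewrite ip.unlock /inner !mulmxDl -!scalemxAl !mxE. Qed.

Lemma ip0l P u : ip g P 0 u = 0.
Proof. by rewrite ip.unlock /inner !mul0mx mxE. Qed.

Lemma ipDl P u v w : ip g P (u + v) w = ip g P u w + ip g P v w.
Proof. by have := ip_lin P 1 u v w; rewrite scale1r mul1r. Qed.

Lemma ipZl P a u w : ip g P (a *: u) w = a * ip g P u w.
Proof. by have := ip_lin P a u 0 w; rewrite addr0 ip0l addr0. Qed.

Lemma ipDr P u v w : ip g P w (u + v) = ip g P w u + ip g P w v.
Proof. by rewrite ![ip g P w _]ip_sym ipDl. Qed.

Lemma ipZr P a u w : ip g P w (a *: u) = a * ip g P w u.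
Proof. by rewrite ![ip g P w _]ip_sym ipZl. Qed.

Lemma ip0r P u : ip g P u 0 = 0.
Proof. by rewrite ip_sym ip0l. Qed.

Lemma ipNl P u w : ip g P (- u) w = - ip g P u w.
Proof. by rewrite -scaleN1r ipZl mulN1r. Qed.

Lemma ipNr P u w : ip g P w (- u) = - ip g P w u.
Proof. by rewrite -scaleN1r ipZr mulN1r. Qed.

Lemma ip_gt0 P u : u != 0 -> 0 < ip g P u u.
Proof. rewrite ip.unlock; exact: gram_pos. Qed.

Lemma ip_ge0 P u : 0 <= ip g P u u.
Proof. by have [->|/(ip_gt0 P)/ltW//] := eqVneq u 0; rewrite ip0l. Qed.

Lemma ip_eq0 P u : ip g P u u = 0 -> u = 0.
Proof. by move=> u0; apply/eqP/negPn/negP => /(ip_gt0 P); rewrite u0 ltxx. Qed.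

Lemma ip_le P u v : ip g P u v <= (ip g P u u + ip g P v v) / 2.
Proof.
have := ip_ge0 P (u - v).
by rewrite ipDl !ipDr !ipNl !ipNr (ip_sym P v u); lra.
Qed.

Lemma ipE q P u v : dom M q P ->
  ip g P u v = ginner g q (chart q P) (tc q P u) (tc q P v).
Proof.
move=> qP; rewrite ginner.unlock (tvecE (tc q P u) (cdom_chart qP)) (tvecE (tc q P v) (cdom_chart qP)).
by rewrite chartK// (vec_tc u qP) (vec_tc v qP).
Qed.

Lemma ginner_sym q x u v : ginner g q x u v = ginner g q x v u.
Proof. rewrite ginner.unlock; exact: ip_sym. Qed.

Lemma tvec_lin q x (a : R) u v : cdom q x ->
  tvec q x (a *: u + v) = a *: tvec q x u + tvec q x v.
Proof.
move=> qx; rewrite (tvecE _ qx) (tvecE u qx) (tvecE v qx) tr_lin//; first exact: ichart_dom.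
exact: dom_center.
Qed.

Lemma ginner_lin q x (a : R) u v w : cdom q x ->
  ginner g q x (a *: u + v) w = a * ginner g q x u w + ginner g q x v w.
Proof. by move=> qx; rewrite ginner.unlock tvec_lin// ip_lin. Qed.

Lemma ginner0 q x w : cdom q x -> ginner g q x 0 w = 0.
Proof.
by move=> qx; have := ginner_lin 1 0 0 w qx; rewrite scaler0 addr0 mul1r => /esym/eqP; rewrite addrC -subr_eq0 addrK => /eqP.
Qed.

Lemma ginnerD q x u v w : cdom q x -> ginner g q x (u + v) w = ginner g q x u w + ginner g q x v w.
Proof. by move=> qx; have := ginner_lin 1 u v w qx; rewrite scale1r mul1r. Qed.

Lemma ginnerZ q x (a : R) u w : cdom q x -> ginner g q x (a *: u) w = a * ginner g q x u w.
Proof. by move=> qx; have := ginner_lin a u 0 w qx; rewrite addr0 ginner0// addr0. Qed.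

Lemma ginnerDr q x u v w : cdom q x -> ginner g q x w (u + v) = ginner g q x w u + ginner g q x w v.
Proof. by move=> qx; rewrite ![ginner g q x w _]ginner_sym ginnerD. Qed.

Lemma ginner_sum q x u w : cdom q x ->
  ginner g q x u w = \sum_i u 0 i * ginner g q x (delta_mx 0 i) w.
Proof.
move=> qx; rewrite {1}(row_sum_delta u).
elim/big_ind2 : _ => [|a b c d <- <-|i _]; first exact: ginner0.
  exact: ginnerD.
exact: ginnerZ.
Qed.

Lemma ginner_coef q x u v : cdom q x ->
  ginner g q x u v = \sum_i \sum_j u 0 i * v 0 j * mcoef g q i j x.
Proof.
move=> qx; rewrite (ginner_sum _ _ qx); apply: eq_bigr => i _.
rewrite ginner_sym (ginner_sum _ _ qx) mulr_sumr; apply: eq_bigr => j _.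
by rewrite mulrA ginner_sym mcoef.unlock mxE ginner.unlock ip.unlock.
Qed.

Lemma mcoef_sym q x i j : mcoef g q i j x = mcoef g q j i x.
Proof. by rewrite mcoef.unlock [LHS]mxE [RHS]mxE; have := ip_sym (ichart q x) (tvec q x (delta_mx 0 i)) (tvec q x (delta_mx 0 j)); rewrite ip.unlock. Qed.

Lemma mcoef_Ck q i j k : Ck k (cdom q) (mcoef g q i j).
Proof.
apply: (eq_Ck (@open_cdom _ _ _ q) _ (@gram_smooth _ _ _ g q i j k)) => x _.
by rewrite mcoef.unlock [RHS]mxE.
Qed.

Lemma ginner_eq0 q x u : cdom q x -> ginner g q x u u = 0 -> u = 0.
Proof.
rewrite ginner.unlock => qx /ip_eq0; rewrite (tvecE _ qx) => u0.
by rewrite -(tc_vec u (ichart_dom qx)) u0 tr0.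
Qed.

Lemma mcoefE q x i j : metric_coef g q x i j = mcoef g q i j x.
Proof. by rewrite mcoef.unlock. Qed.

Lemma metric_coef_unit q x : cdom q x -> metric_coef g q x \in unitmx.
Proof.
move=> qx; rewrite unitmxE unitfE; apply/negP => /det0P[v v0 vg].
move/eqP : v0; apply; apply: (ginner_eq0 qx); rewrite (ginner_coef _ _ qx) exchange_big big1//= => j _.
have /(congr1 (fun A : 'rV[R]_n => A 0 j)) := vg; rewrite !mxE => e.
transitivity (v 0 j * \sum_i v 0 i * metric_coef g q x i j); last by rewrite e mulr0.
by rewrite mulr_sumr; apply: eq_bigr => i _; rewrite mcoefE mulrCA mulrA.
Qed.

Lemma christoffel_Ck q k i j m : Ck m (cdom q) (fun x => christoffel g q x k i j).
Proof.
have oq := @open_cdom _ _ _ q.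
apply: CkM => //; first exact: Ck_cst.
apply: Ck_sum => // l; apply: CkM => //.
  apply: Ck_invmx => // [x qx|a b]; first exact: metric_coef_unit.
  by have := mcoef_Ck q a b m; rewrite mcoef.unlock.
have pk a b c : Ck m (cdom q) (fun x => partial a (fun y => metric_coef g q y b c) x).
  by have := CkS_derive (delta_mx 0 a) (mcoef_Ck q b c m.+1); rewrite mcoef.unlock.
by apply: CkD => //; [apply: CkD|apply: CkN].
Qed.

Lemma christoffel_sym q x k i j : cdom q x -> christoffel g q x k i j = christoffel g q x k j i.
Proof.
move=> qx; rewrite /christoffel; congr (_ * _); apply: eq_bigr => l _; congr (_ * _).
rewrite [partial i _ _ + _]addrC; congr (_ - _).
by congr (partial l _ x); apply/funext => y; rewrite !mcoefE mcoef_sym.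
Qed.

Lemma Gam_sym q x u v : cdom q x -> Gam g q x u v = Gam g q x v u.
Proof.
move=> qx; rewrite Gam.unlock; apply/rowP => k; rewrite !mxE exchange_big; apply: eq_bigr => i _ /=.
by apply: eq_bigr => j _; rewrite (christoffel_sym _ _ _ qx) mulrAC.
Qed.

Lemma Gam_lin q x (a : R) u v w : Gam g q x (a *: u + v) w = a *: Gam g q x u w + Gam g q x v w.
Proof.
rewrite Gam.unlock; apply/rowP => k; rewrite !mxE mulr_sumr -big_split; apply: eq_bigr => i _ /=.
by rewrite mulr_sumr -big_split; apply: eq_bigr => j _ /=; rewrite !mxE; ring.
Qed.

Lemma Gam_linr q x (a : R) u v w : Gam g q x w (a *: u + v) = a *: Gam g q x w u + Gam g q x w v.
Proof.
rewrite Gam.unlock; apply/rowP => k; rewrite !mxE mulr_sumr -big_split; apply: eq_bigr => i _ /=.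
by rewrite mulr_sumr -big_split; apply: eq_bigr => j _ /=; rewrite !mxE; ring.
Qed.

Lemma metric_deriveE q x h i j : cdom q x ->
  'D_h (mcoef g q i j) x =
  \sum_l h 0 l * partial l (mcoef g q i j) x.
Proof.
move=> qx; exact: (Ck1_deriveE _ (@open_cdom _ _ _ q) (mcoef_Ck q i j 1) qx).
Qed.

Lemma dmetric_sym q x u v w : dmetric g q x u v w = dmetric g q x u w v.
Proof.
rewrite dmetric.unlock exchange_big; apply: eq_bigr => i _; apply: eq_bigr => j _ /=.
rewrite [v 0 j * _]mulrC (_ : mcoef g q j i = mcoef g q i j)//.
by apply/funext => y; exact: mcoef_sym.
Qed.

Lemma is_derive_ginner0 q (W : normedModType R) (y X Y : W -> V) (s v : W) dy dX dY :
  cdom q (y s) -> is_derive s v y dy -> is_derive s v X dX -> is_derive s v Y dY ->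
  is_derive s v (fun s => ginner g q (y s) (X s) (Y s))
    (ginner g q (y s) dX (Y s) + ginner g q (y s) (X s) dY +
     dmetric g q (y s) dy (X s) (Y s)).
Proof.
move=> qy yd Xd Yd.
pose F s := \sum_i \sum_j X s 0 i * Y s 0 j * mcoef g q i j (y s).
have Fd : is_derive s v F (\sum_i \sum_j
    ((dX 0 i * Y s 0 j + X s 0 i * dY 0 j) * mcoef g q i j (y s) +
     X s 0 i * Y s 0 j * 'D_dy (mcoef g q i j) (y s))).
  apply: is_derive_sum_pt => i; apply: is_derive_sum_pt => j.
  apply: is_deriveM_pt; first by apply: is_deriveM_pt; move/is_derive_rowP : Xd Yd => + /is_derive_rowP.
  exact: (is_derive_comp (@open_cdom _ _ _ q) (mcoef_Ck q i j 1) qy yd).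
have -> : ginner g q (y s) dX (Y s) + ginner g q (y s) (X s) dY +
     dmetric g q (y s) dy (X s) (Y s) =
   (\sum_i \sum_j
    ((dX 0 i * Y s 0 j + X s 0 i * dY 0 j) * mcoef g q i j (y s) +
     X s 0 i * Y s 0 j * 'D_dy (mcoef g q i j) (y s))).
  rewrite !(ginner_coef _ _ qy) dmetric.unlock -!big_split; apply: eq_bigr => i _ /=.
  by rewrite -!big_split; apply: eq_bigr => j _ /=; ring.
apply: (line_eq_is_derive _ _ Fd); first by rewrite (ginner_coef _ _ qy).
have nU : \forall h \near (0 : R)^', cdom q (y (h *: v + s)).
  have yc := line_cvg yd; exact: (yc _ (near_cdom qy)).
by apply: filterS nU => h qh; rewrite (ginner_coef _ _ qh).
Qed.

(* Koszul's formula *)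
Lemma koszul q x u v w : cdom q x ->
  2 * ginner g q x (Gam g q x u v) w = dmetric g q x u v w + dmetric g q x v u w - dmetric g q x w u v.
Proof.
move=> qx.
pose d l i j := partial l (mcoef g q i j) x.
pose s i j l := d i j l + d j i l - d l i j.
have T1 : dmetric g q x u v w =
    \sum_i \sum_j \sum_m u 0 i * v 0 j * w 0 m * d i j m.
  transitivity (\sum_j \sum_m \sum_i u 0 i * v 0 j * w 0 m * d i j m).
    rewrite ?dmetric.unlock; apply: eq_bigr => i _; apply: eq_bigr => j _; rewrite metric_deriveE// mulr_sumr.
    by apply: eq_bigr => l _; rewrite /d; ring.
  transitivity (\sum_j \sum_i \sum_m u 0 i * v 0 j * w 0 m * d i j m).
    by apply: eq_bigr => j _; exact: exchange_big.
  exact: exchange_big.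
have T2 : dmetric g q x v u w =
    \sum_i \sum_j \sum_m u 0 i * v 0 j * w 0 m * d j i m.
  transitivity (\sum_i \sum_m \sum_j u 0 i * v 0 j * w 0 m * d j i m).
    rewrite ?dmetric.unlock; apply: eq_bigr => i _; apply: eq_bigr => j _; rewrite metric_deriveE// mulr_sumr.
    by apply: eq_bigr => l _; rewrite /d; ring.
  by apply: eq_bigr => j _; exact: exchange_big.
have T3 : dmetric g q x w u v =
    \sum_i \sum_j \sum_m u 0 i * v 0 j * w 0 m * d m i j.
  rewrite ?dmetric.unlock; apply: eq_bigr => i _; apply: eq_bigr => j _; rewrite metric_deriveE// mulr_sumr.
  by apply: eq_bigr => l _; rewrite /d; ring.
have -> : dmetric g q x u v w + dmetric g q x v u w - dmetric g q x w u v =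
  \sum_i \sum_j \sum_m u 0 i * v 0 j * w 0 m * s i j m.
  rewrite T1 T2 T3.
  move: (d) @s => {T1 T2 T3}d s; rewrite -sumrN -!big_split; apply: eq_bigr => i _ /=.
  rewrite -sumrN -!big_split; apply: eq_bigr => j _ /=.
  by rewrite -sumrN -!big_split; apply: eq_bigr => m _ /=; rewrite /s; ring.
have gi l m : \sum_k invmx (metric_coef g q x) k l * mcoef g q k m x = (l == m)%:R.
  have := mulmxV (metric_coef_unit qx) => /(congr1 (fun A : 'M[R]_n => A m l)).
  rewrite !mxE eq_sym => <-; apply: eq_bigr => k _.
  by rewrite mulrC !mcoefE mcoef_sym.
have dl m (f : 'I_n -> R) :
    \sum_l (\sum_k invmx (metric_coef g q x) k l * mcoef g q k m x) * f l = f m.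
  rewrite (bigD1 m)//= gi eqxx mul1r big1 ?addr0// => l /negbTE lm.
  by rewrite gi lm mul0r.
rewrite (ginner_coef _ _ qx) exchange_big /= mulr_sumr.
transitivity (\sum_m \sum_i \sum_j u 0 i * v 0 j * w 0 m * s i j m); last first.
  rewrite exchange_big; apply: eq_bigr => i _ /=; exact: exchange_big.
apply: eq_bigr => m _.
transitivity (w 0 m * \sum_i \sum_j u 0 i * v 0 j * \sum_l (\sum_k invmx (metric_coef g q x) k l * mcoef g q k m x) * s i j l); last first.
  rewrite mulr_sumr; apply: eq_bigr => i _; rewrite mulr_sumr; apply: eq_bigr => j _.
  rewrite dl; ring.
transitivity (\sum_k \sum_i \sum_j \sum_l w 0 m * (u 0 i * v 0 j * ((invmx (metric_coef g q x) k l * mcoef g q k m x) * s i j l))).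
  rewrite mulr_sumr; apply: eq_bigr => k _; rewrite Gam.unlock mxE mulr_suml mulr_suml mulr_sumr.
  apply: eq_bigr => i _; rewrite mulr_suml mulr_suml mulr_sumr; apply: eq_bigr => j _.
  rewrite /christoffel !mulr_sumr !mulr_suml mulr_sumr; apply: eq_bigr => l _.
  have pE a b e : partial a (fun y => metric_coef g q y b e) x = d a b e by rewrite /d mcoef.unlock.
  by rewrite !pE /s; field.
rewrite exchange_big mulr_sumr; apply: eq_bigr => i _ /=.
rewrite exchange_big mulr_sumr; apply: eq_bigr => j _ /=.
rewrite exchange_big !mulr_sumr; apply: eq_bigr => l _ /=.
by rewrite mulr_suml !mulr_sumr; apply: eq_bigr.
Qed.

(** Koszul's formulas for [(u, v, w)] and [(u, w, v)] are added: the derivatives in the directions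
    [v] and [w] cancel. *)
Lemma metric_compat q x u v w : cdom q x ->
  dmetric g q x u v w = ginner g q x (Gam g q x u v) w + ginner g q x v (Gam g q x u w).
Proof.
move=> qx; have := koszul u v w qx; have := koszul u w v qx.
by rewrite (dmetric_sym q x u w v) (ginner_sym q x v (Gam g q x u w)); lra.
Qed.

Lemma is_derive_ginner q (W : normedModType R) (y X Y : W -> V) (s v : W) dy dX dY :
  cdom q (y s) -> is_derive s v y dy -> is_derive s v X dX -> is_derive s v Y dY ->
  is_derive s v (fun s => ginner g q (y s) (X s) (Y s))
    (ginner g q (y s) (dX + Gam g q (y s) dy (X s)) (Y s) +
     ginner g q (y s) (X s) (dY + Gam g q (y s) dy (Y s))).
Proof.
move=> qy yd Xd Yd; apply: is_derive_eq (is_derive_ginner0 qy yd Xd Yd) _.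
rewrite (metric_compat dy (X s) (Y s) qy) addrACA.
by rewrite -(ginnerD dX (Gam g q (y s) dy (X s)) (Y s) qy) -(ginnerDr dY (Gam g q (y s) dy (Y s)) (X s) qy).
Qed.

End Metric.

Section CkScale.
Context {R : realType} {V W : normedModType R}.

Lemma is_deriveZl_pt (b : V -> R) (w : W) x v db : is_derive x v b db ->
  is_derive x v (fun x => b x *: w) (db *: w).
Proof.
move/is_derive_quotP => H; apply/is_derive_quotP.
apply: (near_cvg _ (cvgZ H (cvg_cst w))); apply: nearW => h /=.
by rewrite -scalerBl scalerA.
Qed.

Lemma Ck_scalel k (U : set V) (a : V -> R) (w : W) : open U -> Ck k U a ->
  Ck k U (fun x => a x *: w).
Proof.
have ac x (b : V -> R) : {for x, continuous b} -> {for x, continuous (fun x => b x *: w)}.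
  by move=> bc; apply: cvgZ; [exact: bc|exact: cvg_cst].
move=> oU; elim: k a => [|k IH] a ak.
  split=> // x Ux; apply: ac; exact: (Ck_continuous ak Ux).
split=> [x Ux|v]; first by apply: ac; exact: (Ck_continuous ak Ux).
have da x (Ux : U x) : is_derive x v (fun x => a x *: w) ('D_v a x *: w).
  by apply: is_deriveZl_pt; split=> //; exact: (CkS_derivable ak Ux).
split=> [x Ux|]; first by case: (da x Ux).
apply: (eq_Ck oU _ (IH _ (CkS_derive v ak))) => x; rewrite inE => Ux.
by case: (da x Ux).
Qed.

End CkScale.

Section CkRow.
Context {R : realType} {V : normedModType R} {p : nat}.

Lemma Ck_row k (U : set V) (f : V -> 'rV[R]_p) : open U ->
  (forall j, Ck k U (fun x => f x 0 j : R)) -> Ck k U f.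
Proof.
move=> oU fk.
have H : Ck k U (fun x => \sum_j f x 0 j *: (delta_mx 0 j : 'rV[R]_p)).
  by apply: Ck_sum => // j; exact: Ck_scalel.
by apply: (eq_Ck oU _ H) => x _; rewrite -row_sum_delta.
Qed.

End CkRow.

Section Connection.
Context {R : realType} {n : nat} {M : manifold R n} (g : riemannian_metric M).
Local Notation V := 'rV[R]_n.
Implicit Types (p q P : M) (x y u v w h : V) (c : R -> M).

Lemma Gam0l q x u : Gam g q x 0 u = 0.
Proof.
by have /eqP := Gam_lin g q x 1 0 0 u; rewrite !scale1r addr0 eq_sym -subr_eq0 addrK => /eqP.
Qed.

Lemma GamZ q x (a : R) u w : Gam g q x (a *: u) w = a *: Gam g q x u w.
Proof. by have := Gam_lin g q x a u 0 w; rewrite addr0 Gam0l addr0. Qed.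

Lemma GamDr q x u v w : Gam g q x w (u + v) = Gam g q x w u + Gam g q x w v.
Proof. by have := Gam_linr g q x 1 u v w; rewrite !scale1r. Qed.

Lemma ginner_ip q P u v : dom M q P ->
  ginner g q (chart q P) u v = ip g P (vec q P u) (vec q P v).
Proof. by move=> qP; rewrite (ipE g _ _ qP) !tc_vec. Qed.

Lemma ginner_tr q p P u v : dom M q P -> dom M p P ->
  ginner g q (chart q P) u v = ginner g p (chart p P) (tr q p P u) (tr q p P v).
Proof.
move=> qP pP; rewrite !ginner_ip//.
have PP := dom_center P.
by rewrite -(tr_comp u qP pP PP) -(tr_comp v qP pP PP).
Qed.

Lemma is_derive_id_pt x h : is_derive x h (fun y : V => y) h.
Proof. exact: is_derive_id. Qed.

Lemma is_derive_cst_pt (W : normedModType R) x h (w : W) : is_derive x h (fun=> w) (0 : W).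
Proof. exact: is_derive_cst. Qed.

(** The uniqueness argument for the Levi-Civita connection replaces a computation with inverse
    matrices. Let [B] be the inner product of the defect [A] with a third vector. It is symmetric in
    the first two arguments, since Christoffel symbols and second derivatives are, and skew in the
    last two, since both connections preserve the metric. Such a form vanishes. *)
Lemma Gam_tr q p P u v : dom M q P -> dom M p P ->
  tr q p P (Gam g q (chart q P) u v) =
  Gam g p (chart p P) (tr q p P u) (tr q p P v) + 'D_u ('D_v (tau q p)) (chart q P).
Proof.
move=> qP pP; set x := chart q P; set x' := chart p P; set T := tr q p P.
have qx : cdom q x := cdom_chart qP; have px' : cdom p x' := cdom_chart pP.
have ox : overlap q p x := overlap_chart qP pP.
have oo := @open_overlap _ _ _ q p; have tk k := @tau_Ck _ _ _ k q p.
have tx : tau q p x = x' by rewrite /tau /x chartK.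
have Dt h : is_derive x h (tau q p) (T h).
  by rewrite /T tr_unlockE; split=> //; exact: CkS_derivable (tk 1%N) ox.
have DDt h w : is_derive x h ('D_w (tau q p)) ('D_h ('D_w (tau q p)) x).
  split=> //; exact: (CkS_derivable (CkS_derive w (tk 2%N)) ox).
have TE w : 'D_w (tau q p) x = T w by rewrite /T tr_unlockE.
pose A u v := T (Gam g q x u v) - ('D_u ('D_v (tau q p)) x + Gam g p x' (T u) (T v)).
pose B u v w := ginner g p x' (A u v) (T w).
have As a b : A a b = A b a.
  by rewrite /A (Gam_sym g a b qx) (Gam_sym g (T a) (T b) px') (Ck2_deriveC_row a b oo (tk 2%N) ox).
have key a b w : B w a b + B w b a = 0.
  have H1 := is_derive_ginner g qx (is_derive_id_pt x w) (is_derive_cst_pt x w a) (is_derive_cst_pt x w b).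
  have H2 : is_derive x w (fun y => ginner g p (tau q p y) ('D_a (tau q p) y) ('D_b (tau q p) y))
     (ginner g p x' ('D_w ('D_a (tau q p)) x + Gam g p x' (T w) (T a)) (T b) +
      ginner g p x' (T a) ('D_w ('D_b (tau q p)) x + Gam g p x' (T w) (T b))).
    have := @is_derive_ginner _ _ _ g p _ (tau q p) ('D_a (tau q p)) ('D_b (tau q p)) x w
       (T w) ('D_w ('D_a (tau q p)) x) ('D_w ('D_b (tau q p)) x).
    rewrite tx !TE => H; apply: H => //.
  have H3 : is_derive x w (fun y => ginner g q y a b)
     (ginner g p x' ('D_w ('D_a (tau q p)) x + Gam g p x' (T w) (T a)) (T b) +
      ginner g p x' (T a) ('D_w ('D_b (tau q p)) x + Gam g p x' (T w) (T b))).
    apply: near_eq_is_derive H2; apply: filterS (near_overlap ox) => y [Q [qQ pQ] <-].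
    by rewrite (ginner_tr a b qQ pQ) !tr_unlockE /tau chartK.
  have [_ E1] := H1; have [_ E3] := H3; move: E3; rewrite E1.
  rewrite !add0r (ginner_tr (Gam g q x w a) b qP pP) (ginner_tr a (Gam g q x w b) qP pP).
  rewrite -/x' -/T /B /A => E.
  rewrite (ginner_sym g p x' (T a)) in E.
  rewrite (ginner_sym g p x' (T a)) in E.
  have GB z z' w' : ginner g p x' (z - z') w' = ginner g p x' z w' - ginner g p x' z' w'.
    by rewrite (ginnerD g _ _ _ px') -scaleN1r (ginnerZ g _ _ _ px') mulN1r.
  have e1 := GB (T (Gam g q x w a)) ('D_w ('D_a (tau q p)) x + Gam g p x' (T w) (T a)) (T b).
  have e2 := GB (T (Gam g q x w b)) ('D_w ('D_b (tau q p)) x + Gam g p x' (T w) (T b)) (T a).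
  rewrite [X in X + _]e1 [X in _ + X]e2.
  by move/eqP: E; rewrite -subr_eq0 opprD addrACA => /eqP.
have B0 a b w : B a b w = 0.
  have Bs a' b' w' : B a' b' w' = B b' a' w' by rewrite /B As.
  have := key b w a; have := key w a b; have := key a b w.
  by rewrite (Bs b a) (Bs w a) (Bs w b); lra.
apply/eqP; rewrite -subr_eq0 [_ + 'D_u _ _]addrC; apply/eqP.
apply: (ginner_eq0 (g := g) px'); rewrite -/(A u v).
by have := B0 u v (tr p q P (A u v)); rewrite /B /T (trK _ pP qP).
Qed.

Lemma covD_unfold c X t : covD g c X t =
  derive1 (fun s => tc (c t) (c s) (X s)) t + Gam g (c t) (chart (c t) (c t)) (velocity c t) (X t).
Proof.
rewrite /covD Gam.unlock; congr (derive1 _ t + _).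
by apply/funext => s; rewrite tcoordE.
Qed.

Lemma field_derivableE c X t :
  field_derivable c X t = derivable (fun s => tc (c t) (c s) (X s)) t 1.
Proof.
rewrite /field_derivable; congr (derivable _ t 1).
by apply/funext => s; rewrite tcoordE.
Qed.

Lemma covD_chart q c X t dX : curve_derivable c t -> dom M q (c t) ->
  is_derive t (1 : R) (fun s => tc q (c s) (X s)) dX ->
  field_derivable c X t /\
  tc q (c t) (covD g c X t) =
    dX + Gam g q (chart q (c t)) (tc q (c t) (velocity c t)) (tc q (c t) (X t)).
Proof.
move=> cd qt Xd; have [cc _] := cd; set P := c t.
have PP : dom M P P := dom_center P.
have [d e] := field_chart_change cc qt PP (curve_chart cd qt) Xd.
split; first by rewrite field_derivableE.
rewrite covD_unfold derive1E e -/P.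
set w := tc q P (velocity c t); set X' := tc q P (X t).
have Tw : tr q P P w = velocity c t by rewrite /w vec_tc.
have TX : tr q P P X' = X t by rewrite /X' vec_tc.
have GT := Gam_tr w X' qt PP; rewrite Tw TX in GT.
have S := Ck2_deriveC_row w X' (@open_overlap _ _ _ q P) (@tau_Ck _ _ _ 2 q P) (overlap_chart qt PP).
have E : 'D_X' ('D_w (tau q P)) (chart q P) + tr q P P dX + Gam g P (chart P P) (velocity c t) (X t) =
    tr q P P (dX + Gam g q (chart q P) w X').
  by rewrite (trD dX (Gam g q (chart q P) w X') qt PP) GT S addrAC addrC [_ + Gam _ _ _ _ _]addrC.
by rewrite E (tc_vec _ qt).
Qed.

Lemma field_chart q c X t : curve_derivable c t -> field_derivable c X t -> dom M q (c t) ->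
  is_derive t (1 : R) (fun s => tc q (c s) (X s))
    (tc q (c t) (covD g c X t) -
     Gam g q (chart q (c t)) (tc q (c t) (velocity c t)) (tc q (c t) (X t))).
Proof.
move=> cd; rewrite field_derivableE => Xd qt; have [cc _] := cd.
have PP := dom_center (c t).
have H := field_chart_change cc PP qt (curve_chart cd PP) (@derivableP _ _ _ _ _ _ Xd).
have [d e] := H; have H' := @derivableP _ _ _ _ _ _ d.
by have [_ ->] := covD_chart cd qt H'; rewrite addrK.
Qed.

Lemma is_derive_ip c X Y t : curve_derivable c t -> field_derivable c X t -> field_derivable c Y t ->
  is_derive t (1 : R) (fun s => ip g (c s) (X s) (Y s))
    (ip g (c t) (covD g c X t) (Y t) + ip g (c t) (X t) (covD g c Y t)).
Proof.
move=> cd Xd Yd; have [cc _] := cd; set P := c t; have PP := dom_center P.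
have := is_derive_ginner g (cdom_chart PP) (curve_chart cd PP) (field_chart cd Xd PP) (field_chart cd Yd PP).
rewrite -/P !subrK -!ipE// => H.
apply: near_eq_derive1 H; apply: filterS (near_dom cc PP) => s Ps.
by rewrite -ipE.
Qed.

Lemma Gam_Ck k q u v : Ck k (cdom q) (fun y => Gam g q y u v).
Proof.
have oq := @open_cdom _ _ _ q; apply: Ck_row => // l; rewrite Gam.unlock.
have H : Ck k (cdom q) (fun x => \sum_i \sum_j christoffel g q x l i j * u 0 i * v 0 j).
  apply: Ck_sum => // i; apply: Ck_sum => // j.
  by apply: CkM => //; [apply: CkM => //; [exact: christoffel_Ck|exact: Ck_cst]|exact: Ck_cst].
by apply: (eq_Ck oq _ H) => x _; rewrite mxE.
Qed.

Lemma is_derive_Gam q x h u v : cdom q x ->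
  is_derive x h (fun y => Gam g q y u v) ('D_h (fun y => Gam g q y u v) x).
Proof. by move=> qx; split=> //; exact: CkS_derivable (Gam_Ck 1 q u v) qx. Qed.

(** [R(u, v)w] for fields with constant coordinates in [chart q]; these commute, so no bracket term
    appears. *)
Definition Riem q x u v w : V :=
  'D_u (fun y => Gam g q y v w) x - 'D_v (fun y => Gam g q y u w) x +
  (Gam g q x u (Gam g q x v w) - Gam g q x v (Gam g q x u w)).

Lemma Gam_coordE q x u v l :
  Gam g q x u v 0 l = \sum_i \sum_j christoffel g q x l i j * u 0 i * v 0 j.
Proof. by rewrite Gam.unlock mxE. Qed.

Lemma dGam_coordE q x u v w l : cdom q x ->
  ('D_u (fun y => Gam g q y v w) x) 0 l =
  \sum_i \sum_j \sum_k u 0 i * v 0 j * w 0 k * partial i (fun y => christoffel g q y l j k) x.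
Proof.
move=> qx; rewrite (derive_rowE _ _ (Gam_Ck 1 q v w) qx).
have H : is_derive x u (fun y => \sum_j \sum_k christoffel g q y l j k * v 0 j * w 0 k)
   (\sum_j \sum_k \sum_i u 0 i * v 0 j * w 0 k * partial i (fun y => christoffel g q y l j k) x).
  apply: is_derive_sum_pt => j; apply: is_derive_sum_pt => k.
  have Hc : is_derive x u (fun y => christoffel g q y l j k) ('D_u (fun y => christoffel g q y l j k) x).
    by split=> //; exact: CkS_derivable (christoffel_Ck g q l j k 1) qx.
  apply: is_derive_eq (is_deriveM_pt (is_deriveM_pt Hc (is_derive_cst_pt x u (v 0 j))) (is_derive_cst_pt x u (w 0 k))) _.
  rewrite !mulr0 !addr0 (Ck1_deriveE _ (@open_cdom _ _ _ q) (christoffel_Ck g q l j k 1) qx) !mulr_suml.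
  by apply: eq_bigr => i _; rewrite /partial; ring.
rewrite (_ : (fun y => Gam g q y v w 0 l) = (fun y => \sum_j \sum_k christoffel g q y l j k * v 0 j * w 0 k)).
  have [_ ->] := H.
  transitivity (\sum_j \sum_i \sum_k u 0 i * v 0 j * w 0 k * partial i (fun y => christoffel g q y l j k) x).
    by apply: eq_bigr => j _; exact: exchange_big.
  exact: exchange_big.
by apply/funext => y; exact: Gam_coordE.
Qed.

Lemma GamGam_coordE q x u v w l :
  Gam g q x u (Gam g q x v w) 0 l =
  \sum_i \sum_j \sum_k u 0 i * v 0 j * w 0 k * \sum_m christoffel g q x l i m * christoffel g q x m j k.
Proof.
rewrite Gam_coordE; apply: eq_bigr => i _.
transitivity (\sum_m \sum_j \sum_k u 0 i * v 0 j * w 0 k * (christoffel g q x l i m * christoffel g q x m j k)).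
  apply: eq_bigr => m _; rewrite Gam_coordE mulr_sumr; apply: eq_bigr => j _.
  by rewrite mulr_sumr; apply: eq_bigr => k _; ring.
rewrite exchange_big; apply: eq_bigr => j _ /=.
by rewrite exchange_big; apply: eq_bigr => k _ /=; rewrite mulr_sumr.
Qed.

Lemma curvatureE P u v w : curvature g P u v w = Riem P (chart P P) u v w.
Proof.
have Px : cdom P (chart P P) := cdom_chart (dom_center P).
set x := chart P P in Px *.
apply/rowP => l; rewrite [LHS]mxE -/x.
have -> : Riem P x u v w 0 l = ('D_u (fun y => Gam g P y v w) x) 0 l - ('D_v (fun y => Gam g P y u w) x) 0 l
  + (Gam g P x u (Gam g P x v w) 0 l - Gam g P x v (Gam g P x u w) 0 l) by rewrite !mxE.
rewrite !dGam_coordE// !GamGam_coordE.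
have sw (f : 'I_n -> 'I_n -> 'I_n -> R) :
   \sum_i \sum_j \sum_k v 0 i * u 0 j * w 0 k * f i j k = \sum_i \sum_j \sum_k u 0 i * v 0 j * w 0 k * f j i k.
  rewrite exchange_big; apply: eq_bigr => i _; apply: eq_bigr => j _; apply: eq_bigr => k _ /=.
  by rewrite [v 0 j * _]mulrC.
rewrite (sw (fun i j k => partial i (fun y => christoffel g P y l j k) x)).
rewrite (sw (fun i j k => \sum_m christoffel g P x l i m * christoffel g P x m j k)).
rewrite -!sumrB -!big_split; apply: eq_bigr => i _ /=.
rewrite -!sumrB -!big_split; apply: eq_bigr => j _ /=.
rewrite -!sumrB -!big_split; apply: eq_bigr => k _ /=.
by rewrite sumrB mulrDr !mulrBr.
Qed.

Lemma GamNr q x u w : Gam g q x w (- u) = - Gam g q x w u.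
Proof.
have := Gam_linr g q x (-1) u 0 w; rewrite !addr0 !scaleN1r => ->.
by have /eqP := Gam_linr g q x 1 0 0 w; rewrite !scale1r addr0 eq_sym -subr_eq0 addrK => /eqP ->; rewrite addr0.
Qed.

Lemma ginner_Ck k q u v : Ck k (cdom q) (fun y => ginner g q y u v).
Proof.
have oq := @open_cdom _ _ _ q.
have H : Ck k (cdom q) (fun y => \sum_i \sum_j u 0 i * v 0 j * mcoef g q i j y).
  apply: Ck_sum => // i; apply: Ck_sum => // j; apply: CkM => //; first exact: Ck_cst.
  exact: mcoef_Ck.
by apply: (eq_Ck oq _ H) => x; rewrite inE => qx; rewrite (ginner_coef g _ _ qx).
Qed.

Lemma ginnerN q x u w : cdom q x -> ginner g q x (- u) w = - ginner g q x u w.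
Proof. by move=> qx; rewrite -scaleN1r (ginnerZ g _ _ _ qx) mulN1r. Qed.

Lemma Riem_skew12 q x u v w : Riem q x u v w = - Riem q x v u w.
Proof. by rewrite /Riem opprD !opprB. Qed.

Lemma Riem_bianchi q x u v w : cdom q x ->
  Riem q x u v w + Riem q x v w u + Riem q x w u v = 0.
Proof.
move=> qx.
have S a b h : 'D_h (fun y => Gam g q y a b) x = 'D_h (fun y => Gam g q y b a) x.
  apply: near_eq_derive; apply: filterS (near_cdom qx) => y qy; exact: Gam_sym.
rewrite /Riem (S w u v) (S w v u) (S v u w).
rewrite (Gam_sym g w v qx) (Gam_sym g w u qx) (Gam_sym g v u qx).
move: ('D_u _ x) ('D_v _ x) ('D_w _ x) (Gam g q x u _) (Gam g q x v _) (Gam g q x w _) => a b d e f h.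
by apply/rowP => i; rewrite !mxE; ring.
Qed.

(* Skewness comes from the symmetry of second derivatives of the metric coefficients. *)
Lemma Riem_skew34 q x u v a b : cdom q x ->
  ginner g q x (Riem q x u v a) b = - ginner g q x (Riem q x u v b) a.
Proof.
move=> qx; have oq := @open_cdom _ _ _ q.
pose F y := ginner g q y a b.
have dF h y : cdom q y -> 'D_h F y = ginner g q y (Gam g q y h a) b + ginner g q y a (Gam g q y h b).
  move=> qy; have [_ ->] := is_derive_ginner g qy (is_derive_id_pt y h) (is_derive_cst_pt y h a) (is_derive_cst_pt y h b).
  by rewrite !add0r.
pose dG h z w := 'D_h (fun y => Gam g q y z w) x.
pose G := Gam g q x.
have ddF h k : 'D_k ('D_h F) x =
    (ginner g q x (dG k h a + G k (G h a)) b + ginner g q x (G h a) (G k b)) +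
    (ginner g q x (G k a) (G h b) + ginner g q x a (dG k h b + G k (G h b))).
  have H1 := is_derive_ginner g qx (is_derive_id_pt x k) (is_derive_Gam k h a qx) (is_derive_cst_pt x k b).
  have H2 := is_derive_ginner g qx (is_derive_id_pt x k) (is_derive_cst_pt x k a) (is_derive_Gam k h b qx).
  have [_ e] := is_deriveD_pt H1 H2; move: e; rewrite !add0r => <-.
  apply: near_eq_derive; apply: filterS (near_cdom qx) => y qy; exact: dF.
have := Ck2_deriveC u v oq (ginner_Ck 2 q a b) qx; rewrite -/F !ddF.
have GE h k z : Riem q x h k z = (dG h k z + G h (G k z)) - (dG k h z + G k (G h z)).
  rewrite /Riem -/(dG h k z) -/(dG k h z) -/(G k z) -/(G h z) -/(G _ _) -/(G _ _).
  by rewrite opprD addrACA.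
rewrite !GE.
have gD z z' w : ginner g q x (z - z') w = ginner g q x z w - ginner g q x z' w.
  by rewrite (ginnerD g _ _ _ qx) (ginnerN _ _ qx).
rewrite (gD (dG u v a + _)) (gD (dG u v b + _)).
rewrite (ginner_sym g q x a) (ginner_sym g q x a (dG v u b + _)).
lra.
Qed.

(** The classical deduction from the two skew symmetries and four instances of the Bianchi identity;
    what remains is linear arithmetic in the values of [r]. *)
Lemma Riem_pair q x u v a b : cdom q x ->
  ginner g q x (Riem q x u v a) b = ginner g q x (Riem q x a b u) v.
Proof.
move=> qx; pose r u v a b := ginner g q x (Riem q x u v a) b.
have s1 (c d e f : V) : r c d e f = - r d c e f by rewrite /r Riem_skew12 (ginnerN _ _ qx).
have s2 (c d e f : V) : r c d e f = - r c d f e by rewrite /r Riem_skew34.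
have s3 (c d e f : V) : r c d e f + r d e c f + r e c d f = 0.
  by rewrite /r -!(ginnerD g _ _ _ qx) Riem_bianchi// ginner0.
rewrite -/(r u v a b) -/(r a b u v).
have := s3 u v a b; have := s3 v a b u; have := s3 a b u v; have := s3 b u v a.
have := s1 v a u b; have := s2 v a u b; have := s1 a u v b; have := s2 a u v b.
have := s1 u v b a; have := s2 u v a b; have := s1 a b u v; have := s2 a b u v.
have := s1 a b v u; have := s2 a b v u; have := s1 b v a u; have := s2 b v a u; have := s1 v b a u.
have := s1 b u a v; have := s2 b u a v; have := s1 u b a v; have := s2 u b a v.
have := s1 b u v a; have := s2 b u v a; have := s1 u v b a; have := s2 u v b a; have := s1 v b u a; have := s2 v b u a.
have := s1 v a b u; have := s2 v a b u; have := s2 v b a u; have := s2 u b v a.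
have := s1 a u b v; have := s2 a u b v.
move: (r) => r'; lra.
Qed.

(** Self-adjointness of the Jacobi operator [R(-, w)w]; the invariance of the symplectic form rests
    on it. *)
Lemma curvature_jacobi_sym P u v w :
  ip g P (curvature g P u w w) v = ip g P u (curvature g P v w w).
Proof.
have Px : cdom P (chart P P) := cdom_chart (dom_center P); have PP := dom_center P.
rewrite [RHS]ip_sym !curvatureE !(ipE g _ _ PP) !tc_id.
by rewrite Riem_pair// Riem_skew12 (ginnerN _ _ Px) Riem_skew34// opprK.
Qed.

End Connection.

(** * Geodesics *)

Section RowMx.
Context {R : realType} {V : normedModType R} {p q : nat}.

Lemma is_derive_row_mx (a : V -> 'rV[R]_p) (b : V -> 'rV[R]_q) x v da db :
  is_derive x v a da -> is_derive x v b db ->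
  is_derive x v (fun s => row_mx (a s) (b s)) (row_mx da db).
Proof.
move=> /is_derive_rowP ad /is_derive_rowP bd; apply/is_derive_rowP => j.
case: (split_ordP j) => k ->.
  rewrite row_mxEl (_ : (fun _ => _) = (fun y => a y 0 k)); first exact: ad.
  by apply/funext => y; rewrite row_mxEl.
rewrite row_mxEr (_ : (fun _ => _) = (fun y => b y 0 k)); first exact: bd.
by apply/funext => y; rewrite row_mxEr.
Qed.

Lemma is_derive_lsubmx (a : V -> 'rV[R]_(p + q)) x v da :
  is_derive x v a da -> is_derive x v (fun s => lsubmx (a s)) (lsubmx da).
Proof.
move=> /is_derive_rowP ad; apply/is_derive_rowP => j.
rewrite mxE (_ : (fun _ => _) = (fun y => a y 0 (lshift q j))); first exact: ad.
by apply/funext => y; rewrite mxE.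
Qed.

Lemma is_derive_rsubmx (a : V -> 'rV[R]_(p + q)) x v da :
  is_derive x v a da -> is_derive x v (fun s => rsubmx (a s)) (rsubmx da).
Proof.
move=> /is_derive_rowP ad; apply/is_derive_rowP => j.
rewrite mxE (_ : (fun _ => _) = (fun y => a y 0 (rshift p j))); first exact: ad.
by apply/funext => y; rewrite mxE.
Qed.

Lemma norm_row_mx (a : 'rV[R]_p) (b : 'rV[R]_q) : `|row_mx a b| = Num.max `|a| `|b|.
Proof.
apply/le_anti/andP; split; last first.
  rewrite ge_max; apply/andP; split; apply: row_norm_le => // i.
    by rewrite -(row_mxEl a b); exact: coord_norm_le.
  by rewrite -(row_mxEr a b); exact: coord_norm_le.
apply: row_norm_le => [|j]; first by rewrite le_max normr_ge0.
case: (split_ordP j) => k ->; rewrite ?row_mxEl ?row_mxEr le_max coord_norm_le ?orbT//.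
Qed.

Lemma norm_lsubmx_le (a : 'rV[R]_(p + q)) : `|lsubmx a| <= `|a|.
Proof. by rewrite -[leRHS](congr1 Num.norm (hsubmxK a)) norm_row_mx le_max lexx. Qed.

Lemma cvg_rowP (m : nat) (T : Type) (F : set_system T) {FF : Filter F} (f : T -> 'rV[R]_m) (l : 'rV[R]_m) :
  (forall j, (fun s => f s 0 j : R) @ F --> (l 0 j : R)) -> f @ F --> l.
Proof.
move=> fl; apply/cvgrPdist_le => e e0.
have H : \forall s \near F, forall j, `|l 0 j - f s 0 j| <= e.
  by apply: filter_forall => j; move/cvgrPdist_le : (fl j); exact.
apply: filterS H => s H; apply: row_norm_le => [|j]; first exact: ltW.
by rewrite !mxE; exact: H.
Qed.

Lemma cvg_row_mx (T : Type) (F : set_system T) {FF : Filter F} (f : T -> 'rV[R]_p) (g : T -> 'rV[R]_q) (l : 'rV[R]_p) (l' : 'rV[R]_q) :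
  f @ F --> l -> g @ F --> l' -> (fun s => row_mx (f s) (g s)) @ F --> row_mx l l'.
Proof.
move=> fl gl; apply: cvg_rowP => j; case: (split_ordP j) => k ->.
  rewrite row_mxEl (_ : (fun _ => _) = (fun s => f s 0 k)); first exact: cvg_coord.
  by apply/funext => y; rewrite row_mxEl.
rewrite row_mxEr (_ : (fun _ => _) = (fun s => g s 0 k)); first exact: cvg_coord.
by apply/funext => y; rewrite row_mxEr.
Qed.

Lemma cvg_lsubmx (T : Type) (F : set_system T) {FF : Filter F} (f : T -> 'rV[R]_(p + q)) (l : 'rV[R]_(p + q)) :
  f @ F --> l -> (fun s => lsubmx (f s)) @ F --> lsubmx l.
Proof.
move=> fl; apply: cvg_rowP => j; rewrite mxE (_ : (fun _ => _) = (fun s => f s 0 (lshift q j))).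
  exact: cvg_coord.
by apply/funext => y; rewrite mxE.
Qed.

Lemma cvg_rsubmx (T : Type) (F : set_system T) {FF : Filter F} (f : T -> 'rV[R]_(p + q)) (l : 'rV[R]_(p + q)) :
  f @ F --> l -> (fun s => rsubmx (f s)) @ F --> rsubmx l.
Proof.
move=> fl; apply: cvg_rowP => j; rewrite mxE (_ : (fun _ => _) = (fun s => f s 0 (rshift p j))).
  exact: cvg_coord.
by apply/funext => y; rewrite mxE.
Qed.

End RowMx.

(** * Shifting and reversing geodesics *)

Section Reparametrization.
Context {R : realType} {n : nat} {M : manifold R n} (g : riemannian_metric M).
Local Notation V := 'rV[R]_n.
Implicit Types (c : R -> M) (X J : R -> V) (a t : R).

Lemma is_derive_shift1 (W : normedModType R) (f : R -> W) a t l :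
  is_derive (a + t) (1 : R) f l <-> is_derive t (1 : R) (fun s => f (a + s)) l.
Proof.
split=> /is_derive1P H; apply/is_derive1P.
  by apply: (near_cvg _ H); apply: nearW => h; rewrite addrA.
by apply: (near_cvg _ H); apply: nearW => h; rewrite addrA.
Qed.

Lemma derivable_shift1 (W : normedModType R) (f : R -> W) a t :
  derivable f (a + t) 1 -> derivable (fun s => f (a + s)) t 1.
Proof.
by move=> fd; have [] := (is_derive_shift1 f a t _).1 (@derivableP _ _ _ _ _ _ fd).
Qed.

Lemma derive1_shift1 (W : normedModType R) (f : R -> W) a t :
  derive1 (fun s => f (a + s)) t = derive1 f (a + t).
Proof.
rewrite /derive1.
have -> : (fun h : R => h^-1 *: (f (a + (h + t)) - f (a + t))) =
  (fun h : R => h^-1 *: (f (h + (a + t)) - f (a + t))) by apply/funext => h; rewrite addrCA.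
by [].
Qed.

Lemma velocity_shift c a t : velocity (fun s => c (a + s)) t = velocity c (a + t).
Proof. exact: (derive1_shift1 (chart (c (a + t)) \o c) a t). Qed.

Lemma velocity_lift_shift c a t : velocity_lift (fun s => c (a + s)) t = velocity_lift c (a + t).
Proof. by rewrite /velocity_lift velocity_shift. Qed.

Lemma covD_shift c X a t : covD g (fun s => c (a + s)) (fun s => X (a + s)) t = covD g c X (a + t).
Proof.
by rewrite !covD_unfold velocity_shift (derive1_shift1 (fun s => tc (c (a + t)) (c s) (X s)) a t).
Qed.

Lemma curve_derivable_shift c a t : curve_derivable c (a + t) -> curve_derivable (fun s => c (a + s)) t.
Proof.
move=> [cc cd]; split; last exact: (derivable_shift1 cd).
apply: (@continuous_comp _ _ _ (fun s : R => a + s) c) => //.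
by apply: cvgD; [exact: cvg_cst|exact: cvg_id].
Qed.

Lemma field_derivable_shift c X a t : field_derivable c X (a + t) ->
  field_derivable (fun s => c (a + s)) (fun s => X (a + s)) t.
Proof. exact: derivable_shift1. Qed.

Lemma velocity_shiftE c a : velocity (fun s => c (a + s)) = (fun s => velocity c (a + s)).
Proof. by apply/funext => s; exact: velocity_shift. Qed.

Lemma covD_shiftE c X a : covD g (fun s => c (a + s)) (fun s => X (a + s)) = (fun s => covD g c X (a + s)).
Proof. by apply/funext => s; exact: covD_shift. Qed.

Lemma geodesic_shift c a : geodesic g c -> geodesic g (fun s => c (a + s)).
Proof.
move=> cg t; have [cd vd cE] := cg (a + t); rewrite velocity_shiftE; split.
- exact: curve_derivable_shift.
- exact: (@field_derivable_shift c (velocity c)).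
- by rewrite covD_shift.
Qed.

Lemma jacobi_shift c J a : jacobi_field g c J ->
  jacobi_field g (fun s => c (a + s)) (fun s => J (a + s)).
Proof.
move=> Jj t; have [d1 d2 E] := Jj (a + t); rewrite covD_shiftE; split.
- exact: field_derivable_shift.
- exact: (@field_derivable_shift c (covD g c J)).
- by rewrite covD_shift velocity_shift.
Qed.

(** Conjugate points seen from another base point of a geodesic are conjugate points of the geodesic
    itself. This carries the interval [[-1, sigma]], taken at an arbitrary time of an orbit, over to
    the whole line. *)
Lemma conjugate_shift c a (I : set R) :
  conjugate_points_on g (fun s => c (a + s)) I -> conjugate_points_on g c setT.
Proof.
move=> [b [d [J [_ _ bd Jj [J0 Jb Jd]]]]].
exists (a + b), (a + d), (fun s => J (s - a)).
have ea : (fun s => c (a + (- a + s))) = c by apply/funext => s; rewrite addrA subrr add0r.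
have := jacobi_shift (- a) Jj; rewrite ea => Jj'.
split; [by []|by []|by rewrite ltrD2l| |].
  by rewrite (_ : (fun s => J (s - a)) = (fun s => J (- a + s)))//; apply/funext => s; rewrite addrC.
split; [|by rewrite [a + b]addrC addrK|by rewrite [a + d]addrC addrK].
move=> H; apply: J0; apply/funext => s; have := congr1 (fun f => f (s + a)) H.
by rewrite /= addrK.
Qed.

Lemma is_derive_opp1 (W : normedModType R) (f : R -> W) t l :
  is_derive (- t) (1 : R) f l -> is_derive t (1 : R) (fun s => f (- s)) (- l).
Proof.
move=> /is_derive1P H; apply/is_derive1P.
have oc : (fun h : R => - h) @ 0^' --> 0^'.
  move=> A [e /= e0 eA]; exists e => //= h; rewrite /ball /= sub0r normrN => he h0.
  by apply: eA; rewrite /ball/= ?sub0r ?opprK ?oppr_eq0.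
have H2 : (fun h : R => - ((- h)^-1 *: (f (- t + - h) - f (- t)))) @ 0^' --> - l.
  by apply: cvgN; exact: (cvg_comp _ _ oc H).
apply: (near_cvg _ H2); apply: nearW => h.
by rewrite invrN scaleNr opprK opprD.
Qed.

(** Escape controls only large positive times; reversal transfers it to negative ones. *)
Lemma geodesic_opp c : geodesic g c -> geodesic g (fun s => c (- s)).
Proof.
move=> cg.
have vE s : curve_derivable (fun s => c (- s)) s /\ velocity (fun s => c (- s)) s = - velocity c (- s).
  have [cd _ _] := cg (- s); have [cc cd'] := cd.
  have := is_derive_opp1 (curve_chart cd (dom_center (c (- s)))); rewrite tc_id => H.
  have cc' : {for s, continuous (fun s => c (- s))}.
    by apply: (@continuous_comp _ _ _ (fun s : R => - s) c) => //; exact: oppr_continuous.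
  have [d ->] := curve_derivableP (dom_center (c (- s))) cc' H.
  by rewrite tc_id.
move=> t; have [cd vd cE] := cg (- t); have [cd' vE'] := vE t.
set q := c (- t); have qq : dom M q (c (- t)) := dom_center q.
have := is_derive_opp1 (is_deriveZ_pt (-1) (field_chart g cd vd qq)).
rewrite cE !tr0 sub0r => H.
have near_d : \forall s \near t, dom M q (c (- s)) by have [cc _] := cd'; apply: (near_dom cc).
have H' : is_derive t (1 : R) (fun s => tc q (c (- s)) (velocity (fun s => c (- s)) s))
    (- (-1 *: - Gam g q (chart q (c (- t))) (tc q (c (- t)) (velocity c (- t))) (tc q (c (- t)) (velocity c (- t))))).
  apply: near_eq_derive1 H; apply: filterS near_d => s qs.
  by have [_ ->] := vE s; rewrite -(scaleN1r (velocity c (- s))) (tcZ _ _ qs).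
have [fd E] := covD_chart g cd' qq H'.
split; [exact: cd'|exact: fd|].
apply: (tc_inj qq); rewrite E vE' tr0.
rewrite -(scaleN1r (velocity c (- t))) tcZ// GamZ.
have -> u v : Gam g q u v (-1 *: v) = - Gam g q u v v by rewrite scaleN1r GamNr.
exact: addNr.
Qed.

Lemma velocity_opp c t : geodesic g c -> velocity (fun s => c (- s)) t = - velocity c (- t).
Proof.
move=> cg; have [cd _ _] := cg (- t).
have := is_derive_opp1 (curve_chart cd (dom_center (c (- t)))); rewrite tc_id => H.
have cc' : {for t, continuous (fun s => c (- s))}.
  by have [cc _] := cd; apply: (@continuous_comp _ _ _ (fun s : R => - s) c) => //; exact: oppr_continuous.
by have [d ->] := curve_derivableP (dom_center (c (- t))) cc' H; rewrite tc_id.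
Qed.

End Reparametrization.

Section LinearComposition.
Context {R : realType}.

Lemma Ck_lin_comp (m p' k : nat) (U : set 'rV[R]_p') (f : 'rV[R]_p' -> R)
    (l : 'rV[R]_m -> 'rV[R]_p') : open U ->
  (forall (a : R) u w, l (a *: u + w) = a *: l u + l w) -> continuous l ->
  Ck k U f -> Ck k (l @^-1` U) (f \o l).
Proof.
move=> oU ll lc; elim: k f => [|k IH] f fk.
  by split=> // x Ux; apply: continuous_comp; [exact: lc|exact: (Ck_continuous fk Ux)].
split=> [x Ux|v]; first by apply: continuous_comp; [exact: lc|exact: (Ck_continuous fk Ux)].
have ld x : is_derive x v l (l v).
  apply/is_derive_quotP; apply: (near_cvg _ (cvg_cst (l v))).
  have nz : \forall s \near (0:R)^', s != 0 by exact: nbhs_dnbhs_neq.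
  by apply: filterS nz => s s0; rewrite ll addrK scalerA mulVf// scale1r.
have fd x (Ux : U (l x)) := is_derive_comp oU (CkS_Ck1 fk) Ux (ld x).
split=> [x Ux|]; first by case: (fd x Ux).
have oU' : open (l @^-1` U) by apply: open_comp => // x _; exact: lc.
apply: (eq_Ck oU' _ (IH _ (CkS_derive (l v) fk))) => x; rewrite inE => Ux.
by case: (fd x Ux).
Qed.

Lemma Ck_coord_lin (p' m k : nat) (U : set 'rV[R]_m) (l : 'rV[R]_m -> 'rV[R]_p') (j : 'I_p') :
  (forall (a : R) u w, l (a *: u + w) = a *: l u + l w) -> continuous l ->
  Ck k U (fun z => l z 0 j : R).
Proof.
move=> ll lc; have cc : continuous (fun z => l z 0 j : R).
  by move=> z; apply: (@continuous_comp _ _ _ l (fun A : 'rV[R]_p' => A 0 j : R)); [exact: lc|exact: coord_continuous].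
case: k => [|k]; first by split=> // x _; exact: cc.
split=> [x _|v]; first exact: cc.
have ld x : is_derive x v (fun z => l z 0 j : R) (l v 0 j).
  apply/is_derive_quotP; apply: (near_cvg _ (cvg_cst (l v 0 j))).
  have nz : \forall s \near (0:R)^', s != 0 by exact: nbhs_dnbhs_neq.
  by apply: filterS nz => s s0; rewrite ll mxE addrK mxE [_ *: _]mulKf.
split=> [x _|]; first by case: (ld x).
rewrite (_ : 'D_v _ = fun=> l v 0 j); first exact: Ck_cst.
by apply/funext => x; case: (ld x).
Qed.

Lemma lsubmx_continuous p' q' : continuous (fun z : 'rV[R]_(p' + q') => lsubmx z).
Proof. move=> z; have h : (fun z : 'rV[R]_(p' + q') => z) @ z --> z by exact: cvg_id.
exact: (cvg_lsubmx h). Qed.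

Lemma lsubmx_lin p' q' (a : R) (u w : 'rV[R]_(p' + q')) : lsubmx (a *: u + w) = a *: lsubmx u + lsubmx w.
Proof. by rewrite linearP. Qed.

Lemma rsubmx_lin p' q' (a : R) (u w : 'rV[R]_(p' + q')) : rsubmx (a *: u + w) = a *: rsubmx u + rsubmx w.
Proof. by rewrite linearP. Qed.

Lemma rsubmx_continuous p' q' : continuous (fun z : 'rV[R]_(p' + q') => rsubmx z).
Proof. move=> z; have h : (fun z : 'rV[R]_(p' + q') => z) @ z --> z by exact: cvg_id.
exact: (cvg_rsubmx h). Qed.

End LinearComposition.

(* Coordinates on [TM] over [chart q]. *)
HB.lock Definition zc (R : realType) (n : nat) (M : manifold R n) (q : M) (v : TM M) : 'rV[R]_(n + n) :=
  row_mx (chart q v.1) (tc q v.1 v.2).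
Arguments zc {R n M} q v.

Section Lift.
Context {R : realType} {n : nat} {M : manifold R n} (g : riemannian_metric M).
Local Notation V := 'rV[R]_n.
Local Notation E := 'rV[R]_(n + n).
Implicit Types (p q P : M) (x y u w : V) (c : R -> M) (v : TM M) (z h : E) (xi : TTM R n).

Definition zdom q : set E := [set z | cdom q (lsubmx z)].

Definition zinv q z : TM M :=
  (ichart q (lsubmx z), vec q (ichart q (lsubmx z)) (rsubmx z)).

Lemma zc_dom q v : dom M q v.1 -> zdom q (zc q v).
Proof. by move=> qv; rewrite /zdom zc.unlock /= row_mxKl; exact: cdom_chart. Qed.

Lemma zinvK q z : zdom q z -> zc q (zinv q z) = z.
Proof.
move=> qz; rewrite zc.unlock /zinv /= ichartK// tc_vec; first exact: hsubmxK.
exact: ichart_dom.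
Qed.

Lemma zcK q v : dom M q v.1 -> zinv q (zc q v) = v.
Proof. by case: v => P w /= qP; rewrite /zinv zc.unlock /= row_mxKl row_mxKr chartK// vec_tc. Qed.

Lemma zinv_dom q z : zdom q z -> dom M q (zinv q z).1.
Proof. exact: ichart_dom. Qed.

Lemma open_zdom q : open (zdom q).
Proof.
apply: (@open_comp _ _ (fun z : E => lsubmx z)); last exact: open_cdom.
by move=> z _; exact: lsubmx_continuous.
Qed.

Lemma zc_inj q v v' : dom M q v.1 -> dom M q v'.1 -> zc q v = zc q v' -> v = v'.
Proof. by move=> qv qv' e; rewrite -(zcK qv) e zcK. Qed.

(* The geodesic vector field in these coordinates. *)
Definition gfield q z : E :=
  row_mx (rsubmx z) (- Gam g q (lsubmx z) (rsubmx z) (rsubmx z)).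

Lemma gfield_Ck k q j : Ck k (zdom q) (fun z => gfield q z 0 j : R).
Proof.
have oz := @open_zdom q.
case: (split_ordP j) => i ->.
  rewrite (_ : (fun _ => _) = (fun z : E => rsubmx z 0 i)); last first.
    by apply/funext => z; rewrite row_mxEl.
  by apply: Ck_coord_lin; [exact: rsubmx_lin|exact: rsubmx_continuous].
have H : Ck k (zdom q) (fun z : E => - \sum_a \sum_b christoffel g q (lsubmx z) i a b * (rsubmx z 0 a) * (rsubmx z 0 b)).
  apply: CkN => //; apply: Ck_sum => // a; apply: Ck_sum => // b.
  have Hr e : Ck k (zdom q) (fun z : E => rsubmx z 0 e : R).
    by apply: Ck_coord_lin; [exact: rsubmx_lin|exact: rsubmx_continuous].
  apply: CkM => //; apply: CkM => //.
  have := Ck_lin_comp (@open_cdom _ _ _ q) (@lsubmx_lin R n n) (@lsubmx_continuous R n n) (christoffel_Ck g q i a b k).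
  exact.
by apply: (eq_Ck oz _ H) => z _; rewrite row_mxEr mxE Gam_coordE.
Qed.

Lemma is_derive_Gam3 q (W : normedModType R) (y X Y : W -> V) (s v : W) dy dX dY :
  cdom q (y s) -> is_derive s v y dy -> is_derive s v X dX -> is_derive s v Y dY ->
  is_derive s v (fun s => Gam g q (y s) (X s) (Y s))
    ('D_dy (fun y => Gam g q y (X s) (Y s)) (y s) +
     (Gam g q (y s) dX (Y s) + Gam g q (y s) (X s) dY)).
Proof.
move=> qy yd Xd Yd; apply/is_derive_rowP => l.
pose F s := \sum_i \sum_j christoffel g q (y s) l i j * X s 0 i * Y s 0 j.
have cd i j : is_derive s v (fun s => christoffel g q (y s) l i j) ('D_dy (fun y => christoffel g q y l i j) (y s)).
  exact: (is_derive_comp (@open_cdom _ _ _ q) (christoffel_Ck g q l i j 1) qy yd).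
have Xl i : is_derive s v (fun s => X s 0 i : R) (dX 0 i) by move/is_derive_rowP : Xd.
have Yl i : is_derive s v (fun s => Y s 0 i : R) (dY 0 i) by move/is_derive_rowP : Yd.
have Fd : is_derive s v F (\sum_i \sum_j
    (('D_dy (fun y => christoffel g q y l i j) (y s) * X s 0 i + christoffel g q (y s) l i j * dX 0 i) * Y s 0 j
     + christoffel g q (y s) l i j * X s 0 i * dY 0 j)).
  apply: is_derive_sum_pt => i; apply: is_derive_sum_pt => j.
  exact: is_deriveM_pt (is_deriveM_pt (cd i j) (Xl i)) (Yl j).
rewrite (_ : (fun _ => _) = F); last by apply/funext => r; rewrite Gam_coordE.
apply: is_derive_eq Fd _; rewrite !mxE !Gam_coordE (derive_rowE _ l (Gam_Ck g 1 q (X s) (Y s)) qy).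
have e : 'D_dy (fun y => Gam g q y (X s) (Y s) 0 l : R) (y s) =
    \sum_i \sum_j 'D_dy (fun y => christoffel g q y l i j) (y s) * X s 0 i * Y s 0 j.
  rewrite (_ : (fun _ => _) = (fun y => \sum_i \sum_j christoffel g q y l i j * X s 0 i * Y s 0 j)); last first.
    by apply/funext => r; rewrite Gam_coordE.
  have H : is_derive (y s) dy (fun y => \sum_i \sum_j christoffel g q y l i j * X s 0 i * Y s 0 j)
     (\sum_i \sum_j 'D_dy (fun y => christoffel g q y l i j) (y s) * X s 0 i * Y s 0 j).
    apply: is_derive_sum_pt => i; apply: is_derive_sum_pt => j.
    have Hc : is_derive (y s) dy (fun y => christoffel g q y l i j) ('D_dy (fun y => christoffel g q y l i j) (y s)).
      by split=> //; exact: (CkS_derivable (christoffel_Ck g q l i j 1) qy).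
    apply: is_derive_eq (is_deriveM_pt (is_deriveM_pt Hc (is_derive_cst_pt (y s) dy (X s 0 i : R))) (is_derive_cst_pt (y s) dy (Y s 0 j : R))) _.
    by rewrite !mulr0 !addr0.
  by case: H.
rewrite [X in X + _]e -!big_split; apply: eq_bigr => i _ /=.
rewrite -!big_split; apply: eq_bigr => j _ /=.
by rewrite mulrDl addrA.
Qed.

Lemma is_derive_gfield q z h : zdom q z ->
  is_derive z h (gfield q) (row_mx (rsubmx h)
    (- ('D_(lsubmx h) (fun y => Gam g q y (rsubmx z) (rsubmx z)) (lsubmx z) +
        (Gam g q (lsubmx z) (rsubmx h) (rsubmx z) + Gam g q (lsubmx z) (rsubmx z) (rsubmx h))))).
Proof.
move=> qz; have idd : is_derive z h (fun z : E => z) h by exact: is_derive_id_pt.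
have ld : is_derive z h (fun z : E => lsubmx z) (lsubmx h) := is_derive_lsubmx idd.
have rd : is_derive z h (fun z : E => rsubmx z) (rsubmx h) := is_derive_rsubmx idd.
have H := is_derive_Gam3 qz ld rd rd.
have nG : is_derive z h (fun z : E => -1 *: Gam g q (lsubmx z) (rsubmx z) (rsubmx z)) (-1 *: ('D_(lsubmx h) (fun y => Gam g q y (rsubmx z) (rsubmx z)) (lsubmx z) +
        (Gam g q (lsubmx z) (rsubmx h) (rsubmx z) + Gam g q (lsubmx z) (rsubmx z) (rsubmx h)))).
  exact: is_deriveZ_pt.
rewrite scaleN1r in nG; have -> : gfield q = fun z => row_mx (rsubmx z) (-1 *: Gam g q (lsubmx z) (rsubmx z) (rsubmx z)).
  by apply/funext => y; rewrite scaleN1r.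
exact: (is_derive_row_mx rd nG).
Qed.

Lemma dfield_gfield q z h : zdom q z -> dfield (gfield q) z h = row_mx (rsubmx h)
    (- ('D_(lsubmx h) (fun y => Gam g q y (rsubmx z) (rsubmx z)) (lsubmx z) +
        (Gam g q (lsubmx z) (rsubmx h) (rsubmx z) + Gam g q (lsubmx z) (rsubmx z) (rsubmx h)))).
Proof.
move=> qz; apply/rowP => j; rewrite mxE.
by have /is_derive_rowP/(_ j)[] := is_derive_gfield h qz.
Qed.

Lemma geodesic_gfield q c t : geodesic g c -> dom M q (c t) ->
  is_derive t (1 : R) (fun s => zc q (velocity_lift c s)) (gfield q (zc q (velocity_lift c t))).
Proof.
move=> cg qt; have [cd fd c0] := cg t.
have xd := curve_chart cd qt.
have wd := field_chart g cd fd qt.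
rewrite c0 tr0 sub0r in wd.
rewrite zc.unlock /gfield row_mxKl row_mxKr; exact: (is_derive_row_mx xd wd).
Qed.

End Lift.

#[local] Opaque derive1 velocity covD.

Section Continuation.
Context {R : realType}.

(** The property [Q t], that [P] holds up to [t], is shown to be locally constant and then spread by
    [trans_local_total]; no supremum is formed. *)
Lemma real_induction (tau : R) (P : R -> Prop) : P 0 ->
  (forall t, 0 <= t < tau -> (forall s, 0 <= s <= t -> P s) ->
     exists2 e : R, 0 < e & forall s, t < s < t + e -> P s) ->
  (forall t, 0 < t <= tau -> (forall s, 0 <= s < t -> P s) -> P t) ->
  forall t, 0 <= t <= tau -> P t.
Proof.
move=> P0 Pr Pl.
pose Q t := forall s, 0 <= s <= t -> s <= tau -> P s.
suff QQ t : Q t by move=> t /andP[t0 tt]; apply: (QQ t) => //; rewrite t0 lexx.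
have Qd a b : a <= b -> Q b -> Q a.
  by move=> ab Qb s /andP[s0 sa]; apply: Qb; rewrite s0 (le_trans sa ab).
have Qneg (b : R) : b < 0 -> Q b.
  by move=> b0 s /andP[s0 sb]; have := le_lt_trans (le_trans s0 sb) b0; rewrite ltxx.
have rT : forall a b : R, Q a -> Q b.
  apply: trans_local_total => [a b c ab bc /ab/bc//|{}t].
  have [t0|t0] := ltP t 0.
    exists (- t) => [|a b _]; first by rewrite oppr_gt0.
    by rewrite ltr_distl addrC subrr => /andP[_ b0] _; exact: Qneg.
  have [tt|tt] := ltP tau t.
    exists (t - tau); first by rewrite subr_gt0.
    move=> a b; rewrite !ltr_distl => /andP[a1 _] /andP[b1 _] Qa s /andP[s0 _] st.
    by apply: Qa => //; rewrite s0 (le_trans st)// ltW//; lra.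
  (* Either no point near [t] satisfies [Q], or every point below [t] does. *)
  have [[e e0 He]|H] := pselect (exists2 e : R, 0 < e & forall s, Q s -> s <= t - e).
    exists e => // a b; rewrite ltr_distl => /andP[a1 _] _ /He; lra.
  have Qlt s : s < t -> Q s.
    move=> st; apply: contrapT => nQ; apply: H; exists (t - s); first by rewrite subr_gt0.
    move=> s' Qs'; rewrite opprB addrCA subrr addr0 leNgt; apply/negP => ss'; apply: nQ.
    by apply: Qd Qs'; exact: ltW.
  have Pt : P t.
    have [t0'|] := ltP 0 t; last by move=> t0'; have -> : t = 0 by apply/le_anti; rewrite t0 t0'.
    apply: Pl; first by rewrite t0'.
    move=> s /andP[s0 st]; apply: (Qlt ((s + t) / 2)); [lra|rewrite s0/=; lra|lra].
  have Qt : Q t.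
    move=> s /andP[s0]; rewrite le_eqVlt => /orP[/eqP->//|st] ss.
    by apply: (Qlt s st) => //; rewrite s0 lexx.
  have [tt'|tt'] := ltP t tau.
    have Ps s : 0 <= s <= t -> P s by move=> /andP[s0 st]; apply: Qt; rewrite ?s0 ?st// (le_trans st).
    have [e e0 He] := Pr t (introT andP (conj t0 tt')) Ps.
    exists e => // a b _; rewrite ltr_distl => /andP[_ b1] _ s /andP[s0 sb] ss.
    have [st|ts] := leP s t; first by apply: Ps; rewrite s0.
    by apply: He; rewrite ts/=; lra.
  exists 1 => // a b _ _ _ s /andP[s0 sb] ss.
  by apply: Qt => //; rewrite s0 (le_trans ss tt').
by apply: rT (Qneg (-1) _); rewrite oppr_lt0.
Qed.

Lemma nbhs_dist (t : R) (P : set R) : (\forall s \near t, P s) ->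
  exists2 e : R, 0 < e & forall s, `|s - t| < e -> P s.
Proof.
move=> /nbhs_ballP[e /= e0 H]; exists e => // s st; apply: H.
by rewrite -ball_normE/= distrC.
Qed.

Lemma derive0_cst (m : nat) (f : R -> 'rV[R]_m) :
  (forall t, is_derive t (1 : R) f 0) -> forall a b, f a = f b.
Proof.
move=> fd a b; apply/eqP; rewrite eq_sym -subr_eq0 -normr_le0.
rewrite (le_trans (@MVT_norm _ _ f a b 0 _)) ?mul0r// => t _.
by have [d ->] := fd t; rewrite normr0.
Qed.

Lemma derive0_cstR (f : R -> R) :
  (forall t, is_derive t (1 : R) f 0) -> forall a b, f a = f b.
Proof.
move=> fd; pose h t : 'rV[R]_1 := const_mx (f t).
have hd t : is_derive t (1 : R) h 0.
  apply/is_derive_rowP => j; rewrite mxE (_ : (fun _ => _) = f); first exact: fd.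
  by apply/funext => s; rewrite mxE.
by move=> a b; have /rowP/(_ 0) := derive0_cst hd a b; rewrite !mxE.
Qed.

Lemma norm_le_refl (W : normedModType R) (K : R) (x y z : W) : `|x - y| <= K * `|z - z| -> x = y.
Proof. by rewrite subrr normr0 mulr0 normr_le0 subr_eq0 => /eqP. Qed.

End Continuation.

Section LocalFlow.
Context {R : realType} {n : nat} {M : manifold R n} (g : riemannian_metric M).
Local Notation V := 'rV[R]_n.
Local Notation E := 'rV[R]_(n + n).
Implicit Types (p q P : M) (x y u w : V) (c : R -> M) (v : TM M) (z h : E) (xi : TTM R n).

Lemma compact_closed_ball (m : nat) (x : 'rV[R]_m) (r : R) : compact [set y : 'rV[R]_m | `|y - x| <= r].
Proof.
apply: bounded_closed_compact.
  exists (`|x| + r); split; first exact: num_real.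
  move=> e er y /= yr; rewrite -[y](subrK x) (le_trans (ler_normD _ _))//.
  by rewrite addrC (le_trans _ (ltW er))// lerD2l.
have nc : continuous (fun y : 'rV[R]_m => `|y - x|).
  move=> y; apply: (@continuous_comp _ _ _ (fun y : 'rV[R]_m => y - x) (fun y : 'rV[R]_m => `|y|)).
    apply: (@cvgB _ _ _ (nbhs y) _ (fun y : 'rV[R]_m => y) (fun=> x) y x); [exact: cvg_id|exact: cvg_cst].
  exact: norm_continuous.
apply: (@closed_comp _ _ (fun y : 'rV[R]_m => `|y - x|) [set a : R | a <= r]).
  by move=> y _; exact: nc.
exact: closed_le.
Qed.

(* The geodesic cannot leave the domain of the chart through a compact ball. *)
Lemma geodesic_stay q z0 (r L tau sg : R) c : 0 < r -> 0 <= L -> ball z0 r `<=` zdom q ->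
  (forall z, ball z0 r z -> `|gfield g q z| <= L) -> geodesic g c -> dom M q (c 0) ->
  `|sg| = 1 ->
  `|z0 - zc q (velocity_lift c 0)| + L * tau <= r / 2 ->
  forall t, 0 <= t <= tau -> dom M q (c (sg * t)) /\
    `|zc q (velocity_lift c (sg * t)) - zc q (velocity_lift c 0)| <= L * t.
Proof.
move=> r0 L0 Bq FL cg q0 sg1 tauL.
pose z t := zc q (velocity_lift c t).
have near_z (t : R) : 0 <= t <= tau -> `|z (sg * t) - z 0| <= L * t -> `|z (sg * t) - z0| <= r / 2.
  move=> /andP[t0 tt] zt; rewrite distrC (le_trans (ler_distD (z 0) _ _))//.
  rewrite (le_trans _ tauL)// lerD2l distrC (le_trans zt)// ler_wpM2l//.
have ballr (y : E) : `|y - z0| <= r / 2 -> ball z0 r y.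
  rewrite -ball_normE/= distrC => /le_lt_trans; apply; lra.
have zd t : dom M q (c t) -> is_derive t (1 : R) z (gfield g q (z t)).
  exact: geodesic_gfield.
have zc' t : dom M q (c t) -> {for t, continuous z}.
  by move=> /zd[d _]; exact: derivable1_continuous.
have cc t : {for t, continuous c} by have [[]] := cg t.
have sgd (s t : R) : `|sg * s - sg * t| = `|s - t| by rewrite -mulrBr normrM sg1 mul1r.
apply: real_induction.
- by rewrite !mulr0 subrr normr0.
- move=> t /andP[t0 tt] /(_ t); rewrite t0 lexx => /(_ isT)[qt zt].
  have tt' : 0 <= t <= tau by rewrite t0 ltW.
  have Hn : \forall s \near sg * t, dom M q (c s) /\ ball z0 r (z s).
    apply: filterI; first exact: near_dom (cc _) qt.
    apply: (zc' _ qt); apply: open_nbhs_nbhs; split; first exact: ball_open.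
    by apply: ballr; exact: near_z.
  have [e e0 He] := nbhs_dist Hn; exists e => // s /andP[ts se].
  have se' : `|sg * s - sg * t| < e by rewrite sgd ger0_norm; lra.
  have [qs zs] := He _ se'; split=> //.
  have zst : `|z (sg * s) - z (sg * t)| <= L * `|sg * s - sg * t|.
    apply: MVT_norm => u us.
    have [qu zu] := He u (le_lt_trans (between_dist us) se').
    by have [d ->] := zd u qu; split=> //; exact: FL.
  rewrite (le_trans (ler_distD (z (sg * t)) _ _))//.
  have -> : L * s = L * (s - t) + L * t by ring.
  apply: lerD; last exact: zt.
  have e2 : L * `|sg * s - sg * t| = L * (s - t) by rewrite sgd ger0_norm// subr_ge0 ltW.
  by apply: (le_trans zst); rewrite e2.
- move=> t /andP[t0 tt] Hs.
  pose x0 : V := lsubmx z0.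
  (* The chart domain is open and might be left exactly at time [t]. The compact set [K] is closed
     because [M] is Hausdorff, so the limit point [c (sg * t)] still lies in it, hence in the
     domain. *)
  pose K := ichart q @` [set y : V | `|y - x0| <= r / 2].
  have Kc : compact K.
    apply: continuous_compact; last exact: compact_closed_ball.
    apply: continuous_in_subspaceT => y; rewrite inE/= => yr.
    apply: (@ichart_continuous _ _ M).
    have : zdom q (row_mx y (rsubmx z0)).
      apply: Bq; apply: ballr; rewrite -{2}[z0]hsubmxK opp_row_mx add_row_mx subrr.
      by rewrite norm_row_mx normr0 max_l.
    by rewrite /zdom/= row_mxKl.
  have Kcl : closed K by apply: compact_closed => //; exact: points_hausdorff.
  have pick (A : set R) : (\forall s \near sg * t, A s) -> exists2 s : R, 0 <= s < t & A (sg * s).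
    move=> /nbhs_dist[e e0 He]; exists (Num.max 0 (t - e / 2)).
      by rewrite le_max lexx/= gt_max t0/=; lra.
    apply: He; rewrite sgd ltr_distl; apply/andP; split.
      by rewrite lt_max; apply/orP; right; lra.
    by rewrite gt_max; apply/andP; split; lra.
  have Kt : K (c (sg * t)).
    apply: contrapT => nK.
    have nKn : \forall s \near sg * t, ~ K (c s).
      have H : nbhs (c (sg * t)) (~` K) by apply: open_nbhs_nbhs; split; [exact: closed_openC|exact: nK].
      exact: (cc (sg * t) _ H).
    have [s /[dup] s0t /andP[s0 st] ns] := pick (fun u : R => ~ K (c u)) nKn.
    apply: ns; have [qs zs] := Hs s s0t; exists (chart q (c (sg * s))); last exact: chartK.
    have /= := near_z s _ zs; rewrite s0 (le_trans (ltW st) tt) => /(_ isT); apply: le_trans.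
    have -> : chart q (c (sg * s)) - x0 = lsubmx (z (sg * s) - z0).
      by rewrite linearB /= /z zc.unlock row_mxKl.
    exact: norm_lsubmx_le.
  have qt : dom M q (c (sg * t)).
    case: Kt => y yr <-; apply: ichart_dom.
    have : zdom q (row_mx y (rsubmx z0)).
      apply: Bq; apply: ballr; rewrite -{2}[z0]hsubmxK opp_row_mx add_row_mx subrr.
      by rewrite norm_row_mx normr0 max_l.
    by rewrite /zdom/= row_mxKl.
  split=> //; apply/ler_addgt0Pr => e e0.
  have zn : \forall s \near sg * t, `|z (sg * t) - z s| <= e.
    by have /cvgrPdist_le := zc' _ qt; exact.
  have [s /[dup] s0t /andP[s0 st] es] := pick (fun u : R => `|z (sg * t) - z u| <= e) zn.
  have [_ zs] := Hs s s0t.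
  rewrite (le_trans (ler_distD (z (sg * s)) _ _))// addrC lerD//.
  by rewrite (le_trans zs)// ler_wpM2l// ltW.
Qed.

(** Geodesics exist by completeness. A box adds a time [tau], uniform over all initial vectors
    within [d] of [v], during which they stay in one chart and in a ball on which the geodesic field
    is tame. *)
Definition flow_box q v (r L tau d : R) : Prop :=
  [/\ [/\ 0 < r, 0 < L, 0 < tau & 0 < d], L * tau <= 2^-1,
      ball (zc q v) r `<=` zdom q, tame (gfield g q) (ball (zc q v) r) L &
      forall c, geodesic g c -> dom M q (c 0) ->
        `|zc q v - zc q (velocity_lift c 0)| <= d -> forall t : R, `|t| <= tau ->
        [/\ dom M q (c t), ball (zc q v) r (zc q (velocity_lift c t)) &
          is_derive t (1 : R) (fun s => zc q (velocity_lift c s))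
            (gfield g q (zc q (velocity_lift c t)))]].

Lemma flow_box_ex q v : dom M q v.1 -> exists r L tau d : R, flow_box q v r L tau d.
Proof.
move=> qv; have zv := zc_dom qv.
have [r [L [r0 L0 rz tF]]] := tame_near (@open_zdom _ _ M q) zv (gfield_Ck g 2 q).
(* The first bound gives [L * tau <= 1 / 2] for [short_time_bound]; the second gives
   [L * tau <= r / 4], which together with an initial distance [d = r / 4] keeps the geodesic within
   [r / 2]. *)
pose tau := Num.min (2 * L)^-1 (r / (4 * L)).
have L40 : 0 < 4 * L by rewrite mulr_gt0.
have t0 : 0 < tau by rewrite /tau lt_min invr_gt0 mulr_gt0//= divr_gt0.
have Lt1 : L * tau <= 2^-1.
  have : tau <= (2 * L)^-1 by rewrite /tau ge_min lexx.
  by move=> /(ler_wpM2l (ltW L0)) /le_trans; apply; rewrite invfM mulrCA mulfV ?gt_eqF// mulr1.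
have Lt2 : L * tau <= r / 4.
  have : tau <= r / (4 * L) by rewrite /tau ge_min lexx orbT.
  move=> /(ler_wpM2l (ltW L0)) /le_trans; apply.
  have Ln : L != 0 by rewrite gt_eqF.
  by rewrite le_eqVlt; apply/orP; left; apply/eqP; field.
exists r, L, tau, (r / 4); split=> //; first by split=> //; rewrite divr_gt0.
move=> c cg q0 cd t tt.
have FL z : ball (zc q v) r z -> `|gfield g q z| <= L.
  by case: tF => H _ _ _ _ /H-/(_ 0)[].
have sum : `|zc q v - zc q (velocity_lift c 0)| + L * tau <= r / 2.
  have -> : r / 2 = r / 4 + r / 4 by field.
  exact: lerD.
have [sg [sg1 e]] : exists sg : R, `|sg| = 1 /\ t = sg * `|t|.
  have [t1|t1] := leP 0 t; [exists 1|exists (-1)]; rewrite ?normrN normr1; split=> //.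
    by rewrite mul1r ger0_norm.
  by rewrite mulN1r ltr0_norm// opprK.
have tt' : 0 <= `|t| <= tau by rewrite normr_ge0.
have [qt zt] := geodesic_stay r0 (ltW L0) rz FL cg q0 sg1 sum tt'.
rewrite -e in qt zt; split=> //; last exact: geodesic_gfield.
have zt' : `|zc q (velocity_lift c t) - zc q (velocity_lift c 0)| <= L * tau.
  by apply: (le_trans zt); apply: ler_wpM2l => //; exact: ltW.
rewrite -ball_normE/=; apply: le_lt_trans (ler_distD (zc q (velocity_lift c 0)) _ _) _.
rewrite [X in _ + X]distrC; apply: le_lt_trans (lerD (lexx _) zt') _.
apply: le_lt_trans sum _.
by rewrite ltr_pdivrMr// ltr_pMr// ltr1n.
Qed.

(* A box around [c t] into which the flow can be restarted from all nearby times. *)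
Definition flow_window c (t : R) q (r L tau d e : R) : Prop :=
  [/\ flow_box q (velocity_lift c t) r L tau d, 0 < e, 2 * e <= tau &
    forall a : R, `|a - t| < e -> dom M q (c a) /\
      `|zc q (velocity_lift c t) - zc q (velocity_lift c a)| <= d / 2].

Lemma flow_window_ex c t : geodesic g c -> exists q (r L tau d e : R), flow_window c t q r L tau d e.
Proof.
move=> cg; have qt := dom_center (c t).
have [r [L [tau [d B]]]] := @flow_box_ex (c t) (velocity_lift c t) qt.
have [[r0 L0 tau0 d0] _ _ _ _] := B.
exists (c t), r, L, tau, d.
have [[cc _] _ _] := cg t.
have [zd _] := geodesic_gfield cg qt.
have zc' := derivable1_continuous zd.
have Hn : \forall a \near t, dom M (c t) (c a) /\
    `|zc (c t) (velocity_lift c t) - zc (c t) (velocity_lift c a)| <= d / 2.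
  apply: filterI; first exact: near_dom.
  by have /cvgrPdist_le := zc'; apply; rewrite divr_gt0.
have [e e0 He] := nbhs_dist Hn.
exists (Num.min e (tau / 2)); split=> //.
- by rewrite lt_min e0 divr_gt0.
- by rewrite mulrC -ler_pdivlMr// ge_min lexx orbT.
- by move=> a; rewrite lt_min => /andP[/He].
Qed.

Lemma flow_box_from q v r L tau d c a b : flow_box q v r L tau d -> geodesic g c ->
  dom M q (c a) -> `|zc q v - zc q (velocity_lift c a)| <= d -> `|b - a| <= tau ->
  [/\ dom M q (c b), ball (zc q v) r (zc q (velocity_lift c b)) &
      is_derive b (1 : R) (fun s => zc q (velocity_lift c s))
            (gfield g q (zc q (velocity_lift c b)))].
Proof.
move=> [_ _ _ _ S] cg qa za ab.
have [] := S _ (geodesic_shift a cg) _ _ _ ab.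
- by rewrite addr0.
- by rewrite velocity_lift_shift addr0.
- rewrite [a + _]addrC subrK => qb; rewrite velocity_lift_shift [a + _]addrC subrK => zb _.
  by split=> //; exact: geodesic_gfield.
Qed.

Lemma geodesic_compare q v r L tau d c1 c2 a b : flow_box q v r L tau d ->
  geodesic g c1 -> geodesic g c2 -> dom M q (c1 a) -> dom M q (c2 a) ->
  `|zc q v - zc q (velocity_lift c1 a)| <= d -> `|zc q v - zc q (velocity_lift c2 a)| <= d ->
  `|b - a| <= tau ->
  `|zc q (velocity_lift c1 b) - zc q (velocity_lift c2 b)| <=
    2 * `|zc q (velocity_lift c1 a) - zc q (velocity_lift c2 a)|.
Proof.
move=> B g1 g2 q1 q2 d1 d2 ab.
have [[_ L0 tau0 _] Lt _ tF _] := B.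
pose y c s := zc q (velocity_lift c (a + s)).
have Hy c : geodesic g c -> dom M q (c a) -> `|zc q v - zc q (velocity_lift c a)| <= d ->
    forall s, `|s| <= tau -> ball (zc q v) r (y c s) /\ is_derive s (1 : R) (y c) (gfield g q (y c s)).
  move=> cg qa za s st; have sa : `|(a + s) - a| <= tau by rewrite addrAC subrr add0r.
  have [_ H1 H2] := flow_box_from B cg qa za sa; split; first exact: H1.
  exact: (is_derive_shift1 (fun s => zc q (velocity_lift c s)) a s _).1 H2.
have := flow_lipschitz tF tau0 (ltW L0) Lt (Hy c1 g1 q1 d1) (Hy c2 g2 q2 d2) ab.
by rewrite /y [a + (b - a)]addrC subrK addr0.
Qed.

Lemma flow_window_dist c t q r L tau d e a b : flow_window c t q r L tau d e ->
  `|a - t| < e -> `|b - t| < e -> `|b - a| < tau.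
Proof.
move=> [_ _ et _] at_ bt; apply: lt_le_trans et; apply: (le_lt_trans (ler_distD t _ _)).
by rewrite mulr_natl mulr2n; apply: ltrD; [exact: bt|rewrite distrC; exact: at_].
Qed.

Lemma flow_window_start c t q r L tau d e a : flow_window c t q r L tau d e ->
  `|a - t| < e -> dom M q (c a) /\ `|zc q (velocity_lift c t) - zc q (velocity_lift c a)| < d.
Proof.
move=> [[[_ _ _ d0] _ _ _ _] _ _ W] /W[qa za]; split; first exact: qa.
by apply: (le_lt_trans za); rewrite ltr_pdivrMr// ltr_pMr// ltr1n.
Qed.

(** Within a flow window [geodesic_compare] bounds the distance by a multiple of an initial distance
    that is 0; the windows cover the line. *)
Lemma geodesic_uniq c1 c2 a : geodesic g c1 -> geodesic g c2 ->
  velocity_lift c1 a = velocity_lift c2 a -> forall b, velocity_lift c1 b = velocity_lift c2 b.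
Proof.
move=> g1 g2 + b; move: a b.
apply: trans_local_total => [a b c ab bc /ab/bc|t]; first exact.
have [q [r [L [tau [d [e W]]]]]] := flow_window_ex t g1.
have [B e0 _ _] := W.
exists e => [|a b ta tb eab]; first exact: e0.
have [qa /ltW za] := flow_window_start W ta.
have tab := ltW (flow_window_dist W ta tb).
have qa2 : dom M q (c2 a) by move: eab => [<- _].
have za2 : `|zc q (velocity_lift c1 t) - zc q (velocity_lift c2 a)| <= d by rewrite -eab.
have := geodesic_compare B g1 g2 qa qa2 za za2 tab.
rewrite eab => /norm_le_refl.
have [qb _ _] := flow_box_from B g1 qa za tab.
have [qb2 _ _] := flow_box_from B g2 qa2 za2 tab.
exact: zc_inj.
Qed.

End LocalFlow.

Section Flow.
Context {R : realType} {n : nat} {M : manifold R n} (g : riemannian_metric M) (gc : complete_metric g).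
Implicit Types (c : R -> M) (v : TM M) (s t : R).

Lemma geodesic_ofP v : geodesic g (geodesic_of g v) /\ velocity_lift (geodesic_of g v) 0 = v.
Proof.
rewrite /geodesic_of; case: xgetP => [c -> //|H].
by have [c cg c0] := gc v; case: (H c).
Qed.

Lemma geodesic_geodesic_of v : geodesic g (geodesic_of g v).
Proof. by case: (geodesic_ofP v). Qed.

Lemma flow0 v : flow g 0 v = v.
Proof. by case: (geodesic_ofP v). Qed.

Lemma geodesic_flow c t : geodesic g c -> velocity_lift c t = flow g t (velocity_lift c 0).
Proof.
move=> cg; have [vg v0] := geodesic_ofP (velocity_lift c 0).
exact: geodesic_uniq cg vg (esym v0) t.
Qed.

Lemma geodesic_of_lift c : geodesic g c -> geodesic_of g (velocity_lift c 0) = c.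
Proof. by move=> cg; apply/funext => t; have /(congr1 fst) := geodesic_flow t cg. Qed.

Lemma flowD s t v : flow g (s + t) v = flow g s (flow g t v).
Proof.
have [vg v0] := geodesic_ofP v; have vtg := geodesic_shift t vg.
have := geodesic_flow s vtg; rewrite !velocity_lift_shift addr0 addrC.
exact.
Qed.

Lemma geodesic_speed c t : geodesic g c ->
  ip g (c t) (velocity c t) (velocity c t) = ip g (c 0) (velocity c 0) (velocity c 0).
Proof.
move=> cg; apply: (@derive0_cstR _ (fun t => ip g (c t) (velocity c t) (velocity c t))) => {}t.
have [cd fd c0] := cg t; have := is_derive_ip g cd fd fd.
by rewrite c0 ip0l ip0r addr0.
Qed.

Lemma SM_ip v : SM g v <-> ip g v.1 v.2 v.2 = 1.
Proof.
rewrite /SM /= /norm_at ip.unlock; set a := inner _ _ _ _.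
have a0 : 0 <= a by have := ip_ge0 g v.1 v.2; rewrite ip.unlock.
split=> [/(congr1 (fun x => x ^+ 2))|->]; last exact: sqrtr1.
by rewrite sqr_sqrtr// expr1n.
Qed.

Lemma flow_SM t v : SM g v -> SM g (flow g t v).
Proof.
move=> /SM_ip v1; apply/SM_ip; have [vg v0] := geodesic_ofP v.
by rewrite /flow /= geodesic_speed//; move: v1; rewrite -{1 2 3}v0.
Qed.

Lemma unit_geodesic_of v : SM g v -> unit_geodesic g (geodesic_of g v).
Proof. by move=> v1; split=> [|t]; [exact: geodesic_geodesic_of|by have := flow_SM t v1]. Qed.

End Flow.

(** * The tangent flow *)

(* Coordinates on [T_v TM], given by its horizontal and vertical parts, over [chart q]. *)
HB.lock Definition dz (R : realType) (n : nat) (M : manifold R n) (g : riemannian_metric M)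
    (q : M) (v : TM M) (xi : TTM R n) : 'rV[R]_(n + n) :=
  row_mx (tc q v.1 xi.1)
    (tc q v.1 xi.2 - Gam g q (chart q v.1) (tc q v.1 xi.1) (tc q v.1 v.2)).
Arguments dz {R n M} g q v xi.

Section TangentCoordinates.
Context {R : realType} {n : nat} {M : manifold R n} (g : riemannian_metric M).
Local Notation E := 'rV[R]_(n + n).
Implicit Types (p q P : M) (c : R -> M) (v : TM M) (z h : E) (xi eta : TTM R n) (V : R -> TM M).

Lemma dz_lin q v (a : R) xi eta : dom M q v.1 ->
  dz g q v (a *: xi + eta) = a *: dz g q v xi + dz g q v eta.
Proof.
move=> qv; rewrite dz.unlock scale_row_mx add_row_mx /=.
rewrite !(tc_lin _ _ _ qv) Gam_lin scalerBr; congr row_mx.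
by rewrite opprD addrACA.
Qed.

Lemma dz_inj q v xi eta : dom M q v.1 -> dz g q v xi = dz g q v eta -> xi = eta.
Proof.
case: xi eta => [x y] [x' y'] qv; rewrite dz.unlock /= => /eq_row_mx[/(tc_inj qv) -> ].
by move=> /addIr /(tc_inj qv) ->.
Qed.

Lemma lift_derivable_chart V t q : lift_derivable V t -> dom M q (V t).1 ->
  is_derive t (1 : R) (fun s => zc q (V s)) (dz g q (V t) (lift_velocity g V t)).
Proof.
move=> [cd fd] qt; rewrite dz.unlock zc.unlock.
have xd := curve_chart cd qt; have wd := field_chart g cd fd qt.
exact: (is_derive_row_mx xd wd).
Qed.

Lemma lift_derivableP V t q h : dom M q (V t).1 -> {for t, continuous (fst \o V)} ->
  is_derive t (1 : R) (fun s => zc q (V s)) h ->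
  lift_derivable V t /\ dz g q (V t) (lift_velocity g V t) = h.
Proof.
move=> qt cc hd.
have xd : is_derive t (1 : R) (fun s => chart q (V s).1) (lsubmx h).
  have := is_derive_lsubmx hd; rewrite zc.unlock (_ : (fun _ => _) = fun s => chart q (V s).1)//.
  by apply/funext => s; rewrite row_mxKl.
have wd : is_derive t (1 : R) (fun s => tc q (V s).1 (V s).2) (rsubmx h).
  have := is_derive_rsubmx hd; rewrite zc.unlock (_ : (fun _ => _) = fun s => tc q (V s).1 (V s).2)//.
  by apply/funext => s; rewrite row_mxKr.
have [cd ve] := @curve_derivableP _ _ _ q (fst \o V) t _ qt cc xd.
have [fd fe] := @covD_chart _ _ _ g q (fst \o V) (snd \o V) t _ cd qt wd.
split; first by split.
by rewrite dz.unlock /lift_velocity /= fe ve (tc_vec _ qt) addrK hsubmxK.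
Qed.

(** Coordinates determine the foot only inside the chart domain, whence the first assumption:
    outside of it the values of [zc] carry no information. *)
Lemma foot_continuous V t q : (\forall s \near t, dom M q (V s).1) ->
  {for t, continuous (fun s => zc q (V s))} -> {for t, continuous (fst \o V)}.
Proof.
move=> qV zc'; have qt : dom M q (V t).1 by exact: nbhs_singleton qV.
have H : (fun s => ichart q (lsubmx (zc q (V s)))) @ t --> (V t).1.
  have -> : (V t).1 = ichart q (lsubmx (zc q (V t))) by rewrite zc.unlock row_mxKl chartK.
  apply: (@cvg_comp _ _ _ (fun s => lsubmx (zc q (V s))) (ichart q) (nbhs t) (nbhs (lsubmx (zc q (V t))))).
    exact: cvg_lsubmx zc'.
  by apply: ichart_continuous; have := zc_dom qt.
apply: cvg_trans H; apply: near_eq_cvg; apply: filterS qV => s qs.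
by rewrite zc.unlock row_mxKl chartK.
Qed.

(* A curve in [TM] through [v] with velocity [xi], straight in the chart around [v]. *)
Definition line_lift v xi (s : R) : TM M := zinv v.1 (zc v.1 v + s *: dz g v.1 v xi).

Lemma line_lift0 v xi : line_lift v xi 0 = v.
Proof. by rewrite /line_lift scale0r addr0 zcK//; exact: dom_center. Qed.

Lemma is_derive_line0 z h : is_derive (0 : R) (1 : R) (fun s : R => z + s *: h) h.
Proof.
have cd : is_derive (0 : R) (1 : R) (fun=> z) (0 : E) by exact: is_derive_cst.
by have := is_deriveD_pt cd (is_derive_scale (0 : R) h); rewrite add0r.
Qed.

Lemma line_lift_near v xi : \forall s \near (0 : R), zdom v.1 (zc v.1 v + s *: dz g v.1 v xi).
Proof.
have H : (fun s : R => zc v.1 v + s *: dz g v.1 v xi) @ 0 --> zc v.1 v.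
  have [d _] := is_derive_line0 (zc v.1 v) (dz g v.1 v xi).
  by have := derivable1_continuous d; rewrite /prop_for /continuous_at scale0r addr0.
by apply: H; apply: open_nbhs_nbhs; split; [exact: open_zdom|exact: zc_dom (dom_center _)].
Qed.

Lemma line_liftP v xi : lift_derivable (line_lift v xi) 0 /\ lift_velocity g (line_lift v xi) 0 = xi.
Proof.
have qv := dom_center v.1.
have nd := line_lift_near v xi.
have qV : \forall s \near (0 : R), dom M v.1 (line_lift v xi s).1.
  by apply: filterS nd => s; exact: zinv_dom.
have zd : is_derive (0 : R) (1 : R) (fun s => zc v.1 (line_lift v xi s)) (dz g v.1 v xi).
  apply: (@near_eq_derive1 _ _ (fun s => zc v.1 v + s *: dz g v.1 v xi)).
    by apply: filterS nd => s; rewrite /line_lift => /zinvK ->.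
  exact: is_derive_line0.
have cc := foot_continuous qV (derivable1_continuous (@ex_derive _ _ _ _ _ _ _ zd)).
have q0 : dom M v.1 (line_lift v xi 0).1 by rewrite line_lift0.
have [ld e] := lift_derivableP q0 cc zd; split; first exact: ld.
by apply: (dz_inj q0); rewrite e line_lift0.
Qed.

End TangentCoordinates.

Section Differential.
Context {R : realType} {n : nat} {M : manifold R n} (g : riemannian_metric M) (gc : complete_metric g).
Local Notation E := 'rV[R]_(n + n).
Implicit Types (p q P : M) (c : R -> M) (v : TM M) (z h : E) (xi eta : TTM R n) (V : R -> TM M)
  (K : R -> TTM R n).

(** [flow_derivable] applied to the coordinates of [flow g (a + t) (V s)]. Identifying [zeta] with
    the coordinates of the lift velocity makes the equations obtained in different charts concern
    the same vectors. *)
Lemma flow_box_derivable q v r L tau d V a : flow_box g q v r L tau d ->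
  dom M q (flow g a (V 0)).1 -> `|zc q v - zc q (flow g a (V 0))| < d ->
  lift_derivable (flow g a \o V) 0 ->
  exists zeta : R -> E, [/\
    forall b, `|b - a| <= tau -> lift_derivable (flow g b \o V) 0 /\
      zeta b = dz g q (flow g b (V 0)) (lift_velocity g (flow g b \o V) 0) &
    forall b, `|b - a| < tau -> is_derive b (1 : R) zeta
      (dfield (gfield g q) (zc q (flow g b (V 0))) (zeta b))].
Proof.
move=> B qa za Vd; have [[_ L0 tau0 _] Lt _ tF _] := B.
have zd := lift_derivable_chart g Vd qa.
have zc' := derivable1_continuous (@ex_derive _ _ _ _ _ _ _ zd).
have [[cc _] _] := Vd.
have Hn : \forall s \near (0 : R), dom M q (flow g a (V s)).1 /\ `|zc q v - zc q (flow g a (V s))| < d.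
  apply: filterI; first by have := near_dom cc qa; exact.
  have Hb : nbhs (zc q (flow g a (V 0))) (ball (zc q v) d).
    by apply: open_nbhs_nbhs; split; [exact: ball_open|rewrite -ball_normE/=; exact: za].
  have H : \forall s \near (0 : R), ball (zc q v) d (zc q (flow g a (V s))) := zc' _ Hb.
  by rewrite -ball_normE in H; exact: H.
have [s0 s00 Hs] := nbhs_dist Hn.
pose z (s t : R) := zc q (flow g (a + t) (V s)).
have Hz (s t : R) : `|s| < s0 -> `|t| <= tau ->
    [/\ dom M q (flow g (a + t) (V s)).1, ball (zc q v) r (z s t) & is_derive t (1 : R) (z s) (gfield g q (z s t))].
  move=> ss tt; have [qs /ltW zs] := Hs s (ltac:(by rewrite subr0)).
  have sa : `|(a + t) - a| <= tau by rewrite addrAC subrr add0r.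
  have [H0 H1 H2] := flow_box_from B (geodesic_geodesic_of gc (V s)) qs zs sa.
  split; [exact: H0|exact: H1|].
  exact: (is_derive_shift1 (fun s' => zc q (velocity_lift (geodesic_of g (V s)) s')) a t _).1 H2.
have z0d : is_derive (0 : R) (1 : R) (fun s => z s 0) (dz g q (flow g a (V 0)) (lift_velocity g (flow g a \o V) 0)).
  by rewrite /z (_ : (fun _ => _) = fun s => zc q ((flow g a \o V) s)); [exact: zd|apply/funext => s; rewrite addr0].
have Hz' (s t : R) : `|s| < s0 -> `|t| <= tau -> ball (zc q v) r (z s t) /\ is_derive t (1 : R) (z s) (gfield g q (z s t)).
  by move=> ss tt; have [] := Hz s t ss tt.
have [zeta [_ zetad zetao]] := flow_derivable tF tau0 (ltW L0) Lt s00 Hz' z0d.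
exists (fun b => zeta (b - a)); split=> b ba.
  have qV : \forall s \near (0 : R), dom M q (flow g b (V s)).1.
    have : \forall s \near (0 : R), `|s| < s0.
      by apply/nbhs_ballP; exists s0 => // s; rewrite -ball_normE/= sub0r normrN.
    by apply: filterS => s ss; have [+ _ _] := Hz s (b - a) ss ba; rewrite [a + _]addrC subrK.
  have zbd : is_derive (0 : R) (1 : R) (fun s => zc q ((flow g b \o V) s)) (zeta (b - a)).
    by have := zetad (b - a) ba; rewrite /z [a + _]addrC subrK.
  have cb := foot_continuous qV (derivable1_continuous (@ex_derive _ _ _ _ _ _ _ zbd)).
  have qb : dom M q ((flow g b \o V) 0).1 := nbhs_singleton qV.
  by have [ld <-] := @lift_derivableP _ _ _ g (flow g b \o V) 0 q _ qb cb zbd.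
have := zetao (b - a) ba; rewrite /z [a + _]addrC subrK => H.
have e x : b - a = - a + x -> x = b by move=> /eqP; rewrite addrC (inj_eq (addrI _)) => /eqP.
have := (is_derive_shift1 zeta (- a) b (dfield (gfield g q) (zc q (flow g b (V 0))) (zeta (b - a)))).1.
rewrite [- a + b]addrC => /(_ H).
by rewrite (_ : (fun s => zeta (- a + s)) = fun s => zeta (s - a)) //; apply/funext => s; rewrite addrC.
Qed.

Lemma flow_lift_derivable V t : lift_derivable V 0 -> lift_derivable (flow g t \o V) 0.
Proof.
move=> Vd; have V0 : lift_derivable (flow g 0 \o V) 0.
  by rewrite (_ : _ \o _ = V) //; apply/funext => s /=; rewrite flow0.
move: V0; apply: (@trans_local_total _ (fun a b => lift_derivable (flow g a \o V) 0 -> lift_derivable (flow g b \o V) 0)).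
  by move=> a b c ab bc Ha; exact: bc (ab Ha).
move=> {}t; have cg := geodesic_geodesic_of gc (V 0).
have [q [r [L [tau [d [e W]]]]]] := flow_window_ex t cg.
have [B e0 _ _] := W.
exists e => [|a b ta tb ad]; first exact: e0.
have [qa za] := flow_window_start W ta.
have tab := ltW (flow_window_dist W ta tb).
have [zeta [H _]] := flow_box_derivable B qa za ad.
by case: (H b tab).
Qed.

(* In every chart, [K] solves the linearized geodesic equation along the orbit of [v]. *)
Definition lin_along v K := forall (t : R) q, dom M q (flow g t v).1 ->
  is_derive t (1 : R) (fun s => dz g q (flow g s v) (K s))
    (dfield (gfield g q) (zc q (flow g t v)) (dz g q (flow g t v) (K t))).

Lemma lin_along_flow V : lift_derivable V 0 ->
  lin_along (V 0) (fun t => lift_velocity g (flow g t \o V) 0).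
Proof.
move=> Vd t q qt; have [r [L [tau [d B]]]] := flow_box_ex g qt.
have [[_ _ tau0 d0] _ _ _ _] := B.
have za : `|zc q (flow g t (V 0)) - zc q (flow g t (V 0))| < d by rewrite subrr normr0.
have [zeta [H1 H2]] := flow_box_derivable B qt za (flow_lift_derivable t Vd).
have tt : `|t - t| < tau by rewrite subrr normr0.
have [_ <-] := H1 t (ltW tt).
apply: near_eq_derive1 (H2 t tt).
have : \forall s \near t, `|s - t| < tau.
  by apply/nbhs_ballP; exists tau => // s; rewrite -ball_normE/= distrC.
by apply: filterS => s /ltW/H1[_].
Qed.

Lemma lin_along_lin v K1 K2 (a : R) : lin_along v K1 -> lin_along v K2 ->
  lin_along v (fun t => a *: K1 t + K2 t).
Proof.
move=> l1 l2 t q qt; have [r [L [tau [d B]]]] := flow_box_ex g qt.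
have [[r0 _ _ _] _ _ [_ tl _ _ _] _] := B.
rewrite (dz_lin g a _ _ qt) tl; last exact: ballxx.
have H := is_deriveD_pt (is_deriveZ_pt a (l1 t q qt)) (l2 t q qt).
have [cd _ _] := geodesic_geodesic_of gc v t; have [cc _] := cd.
have qn := near_dom cc qt.
apply: near_eq_derive1 H; apply: filterS qn => s qs.
by rewrite dz_lin.
Qed.

(** This makes the tangent map well defined: its linearity and its independence of the representing
    curve follow by comparing two solutions at time 0. *)
Lemma lin_along_uniq v K1 K2 a : lin_along v K1 -> lin_along v K2 ->
  K1 a = K2 a -> forall b, K1 b = K2 b.
Proof.
move=> l1 l2 + b; move: a b.
apply: (@trans_local_total _ (fun a b => K1 a = K2 a -> K1 b = K2 b)) => [a b c ab bc /ab/bc//|t].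
have cg := geodesic_geodesic_of gc v.
have [q [r [L [tau [d [e W]]]]]] := flow_window_ex t cg.
have [B e0 _ _] := W; have [[_ L0 tau0 _] Lt _ tF _] := B.
exists e => [|a b ta tb eab]; first exact: e0.
have [qa /ltW za] := flow_window_start W ta.
have tab := flow_window_dist W ta tb.
pose y s := dz g q (flow g (a + s) v) (K1 (a + s)) - dz g q (flow g (a + s) v) (K2 (a + s)).
have qs (s : R) : `|s| <= tau -> dom M q (flow g (a + s) v).1 /\ ball (zc q (flow g t v)) r (zc q (flow g (a + s) v)).
  move=> st; have sa : `|(a + s) - a| <= tau by rewrite addrAC subrr add0r.
  by have [? ?] := flow_box_from B cg qa za sa.
have yd (s : R) : `|s| <= tau -> derivable y s 1 /\ `|'D_1 y s| <= L * `|y s| + 0.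
  move=> st; have [qs' Bs] := qs s st.
  have H K (l : lin_along v K) := (is_derive_shift1 (fun s => dz g q (flow g s v) (K s)) a s _).1 (l _ _ qs').
  have [yd ->] := is_deriveB_pt (H _ l1) (H _ l2); split; first exact: yd.
  rewrite -(dfield_tameB _ _ tF Bs) addr0.
  by have [tb' _ _ _ _] := tF; have [_] := tb' _ (dz g q (flow g (a + s) v) (K1 (a + s)) - dz g q (flow g (a + s) v) (K2 (a + s))) Bs.
have := short_time_bound tau0 (ltW L0) Lt yd (ltW tab).
have -> : y 0 = 0 by rewrite /y addr0 eab subrr.
rewrite normr0 mulr0 addr0 mulr0 normr_le0 /y [a + _]addrC subrK subr_eq0 => /eqP.
have [qb _] := qs (b - a) (ltW tab); rewrite [a + _]addrC subrK in qb.
exact: dz_inj.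
Qed.

(** The tangent map of the flow on all of [T_v TM], computed on one fixed curve; unlike [Dflow] it
    involves no choice and no constraint to [SM]. *)
Definition dphi t v xi : TTM R n := lift_velocity g (flow g t \o line_lift g v xi) 0.

Lemma lin_along_dphi v xi : lin_along v (fun t => dphi t v xi).
Proof.
by have [ld _] := line_liftP g v xi; have := lin_along_flow ld; rewrite line_lift0.
Qed.

Lemma dphi0 v xi : dphi 0 v xi = xi.
Proof.
rewrite /dphi (_ : _ \o _ = line_lift g v xi); first by case: (line_liftP g v xi).
by apply/funext => s /=; rewrite flow0.
Qed.

Lemma dphi_lift V t : lift_derivable V 0 ->
  lift_velocity g (flow g t \o V) 0 = dphi t (V 0) (lift_velocity g V 0).
Proof.
move=> Vd; apply: (lin_along_uniq (lin_along_flow Vd) (@lin_along_dphi _ _) (a := 0)).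
rewrite dphi0 (_ : _ \o _ = V) //; by apply/funext => s /=; rewrite flow0.
Qed.

Lemma dphi_lin t v (a : R) xi eta : dphi t v (a *: xi + eta) = a *: dphi t v xi + dphi t v eta.
Proof.
apply: (lin_along_uniq (@lin_along_dphi _ _) (lin_along_lin a (@lin_along_dphi v xi) (@lin_along_dphi v eta)) (a := 0)).
by rewrite !dphi0.
Qed.

Lemma dphiD s t v xi : dphi (s + t) v xi = dphi s (flow g t v) (dphi t v xi).
Proof.
have [ld _] := line_liftP g v xi.
have := dphi_lift s (flow_lift_derivable t ld); rewrite /= line_lift0 => <-.
have e : flow g (s + t) \o line_lift g v xi = flow g s \o (flow g t \o line_lift g v xi).
  by apply/funext => r; exact: flowD.
by rewrite /dphi e.
Qed.

Lemma dphi_eq0 t v xi : dphi t v xi = 0 -> xi = 0.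
Proof.
move=> H; have := dphiD (- t) t v xi; rewrite addNr dphi0 H => ->.
have := dphi_lin (- t) (flow g t v) 1 0 0; rewrite !scale1r addr0 => /eqP.
by rewrite -subr_eq0 opprD addNKr oppr_eq0 => /eqP.
Qed.

(** The linearized geodesic equation turns into the Jacobi equation: the Christoffel term subtracted
    in [dz] is differentiated along the geodesic, and the result combines with the derivative of the
    geodesic field to [Riem]. *)
Lemma lin_along_jacobi v K t : lin_along v K -> let c := geodesic_of g v in
  [/\ field_derivable c (fun s => (K s).1) t, covD g c (fun s => (K s).1) t = (K t).2,
      field_derivable c (fun s => (K s).2) t &
      covD g c (fun s => (K s).2) t = - curvature g (c t) (K t).1 (velocity c t) (velocity c t)].
Proof.
move=> lK c; have cg : geodesic g c := geodesic_geodesic_of gc v.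
pose P := c t; have PP : dom M P (c t) := dom_center _.
have [cd fd c0] := cg t; have [cc _] := cd.
pose X s := tc P (c s) (K s).1; pose Y s := tc P (c s) (K s).2.
pose x s := chart P (c s); pose w s := tc P (c s) (velocity c s).
have Px : cdom P (x t) := cdom_chart PP.
have xd : is_derive t (1 : R) x (w t) := curve_chart cd PP.
have wd : is_derive t (1 : R) w (- Gam g P (x t) (w t) (w t)).
  by have := field_chart g cd fd PP; rewrite c0 tr0 sub0r.
have zd : is_derive t (1 : R) (fun s => row_mx (X s) (Y s - Gam g P (x s) (X s) (w s)))
   (row_mx (Y t - Gam g P (x t) (X t) (w t))
    (- ('D_(X t) (fun y => Gam g P y (w t) (w t)) (x t) +
      (Gam g P (x t) (Y t - Gam g P (x t) (X t) (w t)) (w t) + Gam g P (x t) (w t) (Y t - Gam g P (x t) (X t) (w t)))))).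
  have := lK t P PP; rewrite dfield_gfield; last exact: zc_dom.
  by rewrite dz.unlock zc.unlock !row_mxKl !row_mxKr.
have Xd : is_derive t (1 : R) X (Y t - Gam g P (x t) (X t) (w t)).
  have := is_derive_lsubmx zd; rewrite row_mxKl (_ : (fun _ => _) = X)//.
  by apply/funext => s; rewrite row_mxKl.
have Zd : is_derive t (1 : R) (fun s => Y s - Gam g P (x s) (X s) (w s))
    (- ('D_(X t) (fun y => Gam g P y (w t) (w t)) (x t) +
      (Gam g P (x t) (Y t - Gam g P (x t) (X t) (w t)) (w t) + Gam g P (x t) (w t) (Y t - Gam g P (x t) (X t) (w t))))).
  have := is_derive_rsubmx zd; rewrite row_mxKr (_ : (fun _ => _) = fun s => Y s - Gam g P (x s) (X s) (w s))//.
  by apply/funext => s; rewrite row_mxKr.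
have Gd := is_derive_Gam3 g Px xd Xd wd.
have Yd := is_deriveD_pt Zd Gd.
have eY : (fun s => Y s - Gam g P (x s) (X s) (w s) + Gam g P (x s) (X s) (w s)) = Y.
  by apply/funext => s; rewrite subrK.
rewrite eY in Yd.
have [fX eX] := covD_chart g cd PP Xd.
have [fY eY'] := covD_chart g cd PP Yd.
split=> //.
  by move: eX; rewrite tc_id => ->; rewrite [X in _ + X]Gam_sym// subrK /Y tc_id.
move: eY'; rewrite tc_id => ->; rewrite curvatureE /Riem -/P.
have -> : (K t).1 = X t by rewrite /X tc_id.
have -> : velocity c t = w t by rewrite /w tc_id.
have -> : chart P P = x t by [].
have -> : tc P (c t) (w t) = w t by rewrite tc_id.
have -> : tc P (c t) (K t).2 = (Y t - Gam g P (x t) (X t) (w t)) + Gam g P (x t) (X t) (w t) by rewrite subrK.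
have := GamDr g P (x t) (Y t - Gam g P (x t) (X t) (w t)) (Gam g P (x t) (X t) (w t)) (w t).
move=> ->; rewrite GamNr.
rewrite [Gam g P (x t) (w t) (Y t - _)]Gam_sym//.
move: (Gam g P (x t) (Y t - _) (w t)) (Gam g P (x t) (w t) (Gam g P (x t) (X t) (w t))) => a b.
move: ('D_(X t) _ _) ('D_(w t) _ _) (Gam g P (x t) (X t) (Gam _ _ _ _ _)) => a1 a2 a3.
by apply/rowP => i; rewrite !mxE; ring.
Qed.

End Differential.

(** * Convergence in the tangent bundle *)

Section VectorConvergence.
Context {R : realType} {n : nat} {M : manifold R n} (g : riemannian_metric M).
Context {I : Type} {F : set_system I} {FF : Filter F}.
Local Notation E := 'rV[R]_n.
Implicit Types (q r p : M) (P : I -> M) (X Y : I -> E) (x y : E).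

Lemma near_dom_cvg P p q : P @ F --> p -> dom M q p -> \forall i \near F, dom M q (P i).
Proof.
move=> Pp qp; have H : nbhs p (dom M q) by apply: open_nbhs_nbhs; split; [exact: dom_open|exact: qp].
exact: Pp H.
Qed.

Lemma chart_cvg P p q : P @ F --> p -> dom M q p -> (fun i => chart q (P i)) @ F --> chart q p.
Proof. by move=> Pp qp; apply: (@cvg_comp _ _ _ P (chart q) F (nbhs p)) => //; exact: chart_continuous. Qed.

Lemma tr_sum q r p x : dom M q p -> dom M r p ->
  tr q r p x = \sum_j x 0 j *: tr q r p (delta_mx 0 j).
Proof.
move=> qp rp; rewrite {1}(row_sum_delta x).
elim/big_ind2 : _ => [|u a w b <- <-|i _]; first exact: tr0.
  exact: trD.
exact: trZ.
Qed.

Lemma tr_cvg q r P p X x : P @ F --> p -> dom M q p -> dom M r p -> X @ F --> x ->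
  (fun i => tr q r (P i) (X i)) @ F --> tr q r p x.
Proof.
move=> Pp qp rp Xx; rewrite (tr_sum x qp rp).
have H : (fun i => \sum_j X i 0 j *: tr q r (P i) (delta_mx 0 j)) @ F --> \sum_j x 0 j *: tr q r p (delta_mx 0 j).
  apply: cvg_sum_pt => j; apply: cvgZ; first exact: cvg_coord.
  rewrite tr.unlock; apply: (@cvg_comp _ _ _ (fun i => chart q (P i)) (fun y => 'D_(delta_mx 0 j) (tau q r) y) F (nbhs (chart q p))).
    exact: chart_cvg.
  exact: (Ck_continuous (CkS_derive (delta_mx 0 j) (@tau_Ck _ _ _ 1 q r)) (overlap_chart qp rp)).
apply: near_cvg H; have := near_dom_cvg Pp qp; have := near_dom_cvg Pp rp.
by apply: filterS2 => i ri qi; rewrite -tr_sum.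
Qed.

(** Tested in charts around the limit point: the coordinates of [X i] refer to the chart attached to
    [P i], and as mere rows they need not converge. *)
Definition xcvg P X p x := forall q, dom M q p -> (fun i => tc q (P i) (X i)) @ F --> tc q p x.

Lemma xcvgP q P X p x : P @ F --> p -> dom M q p ->
  (fun i => tc q (P i) (X i)) @ F --> tc q p x -> xcvg P X p x.
Proof.
move=> Pp qp H r rp; rewrite -(tr_tc x qp rp).
apply: (near_cvg _ (tr_cvg Pp qp rp H)).
have := near_dom_cvg Pp qp; have := near_dom_cvg Pp rp.
by apply: filterS2 => i ri qi; rewrite tr_tc.
Qed.

Lemma Gam_cvg q (z : I -> E) z0 X Y x y : cdom q z0 -> z @ F --> z0 -> X @ F --> x -> Y @ F --> y ->
  (fun i => Gam g q (z i) (X i) (Y i)) @ F --> Gam g q z0 x y.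
Proof.
move=> qz zz Xx Yy; apply: cvg_rowP => l; rewrite Gam_coordE.
under eq_fun do rewrite Gam_coordE.
apply: cvg_sum_pt => a; apply: cvg_sum_pt => b.
apply: cvgM; last exact: cvg_coord.
apply: cvgM; last exact: cvg_coord.
apply: (@cvg_comp _ _ _ z (fun y => christoffel g q y l a b) F (nbhs z0)); first exact: zz.
exact: (Ck_continuous (christoffel_Ck g q l a b 0) qz).
Qed.

Lemma ip_cvg P X Y p x y : P @ F --> p -> xcvg P X p x -> xcvg P Y p y ->
  (fun i => ip g (P i) (X i) (Y i)) @ F --> ip g p x y.
Proof.
move=> Pp Xx Yy; have pp := dom_center p; have np := near_dom_cvg Pp pp.
rewrite (ipE g _ _ pp) (ginner_coef _ _ _ (cdom_chart pp)).
have H : (fun i => \sum_a \sum_b (tc p (P i) (X i)) 0 a * (tc p (P i) (Y i)) 0 b * mcoef g p a b (chart p (P i))) @ F -->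
   \sum_a \sum_b (tc p p x) 0 a * (tc p p y) 0 b * mcoef g p a b (chart p p).
  apply: cvg_sum_pt => a; apply: cvg_sum_pt => b; apply: cvgM.
    by apply: cvgM; apply: cvg_coord; [exact: Xx|exact: Yy].
  apply: (@cvg_comp _ _ _ (fun i => chart p (P i)) (mcoef g p a b) F (nbhs (chart p p))); first exact: chart_cvg.
  exact: (Ck_continuous (mcoef_Ck g p a b 0) (cdom_chart pp)).
apply: near_cvg H; apply: filterS np => i pi.
by rewrite (ipE g _ _ pi) (ginner_coef _ _ _ (cdom_chart pi)).
Qed.

Definition vcvg (v_ : I -> TM M) (v : TM M) :=
  (fun i => (v_ i).1) @ F --> v.1 /\ xcvg (fun i => (v_ i).1) (fun i => (v_ i).2) v.1 v.2.

Definition dcvg (v_ : I -> TM M) (xi_ : I -> TTM R n) (v : TM M) (xi : TTM R n) :=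
  xcvg (fun i => (v_ i).1) (fun i => (xi_ i).1) v.1 xi.1 /\
  xcvg (fun i => (v_ i).1) (fun i => (xi_ i).2) v.1 xi.2.

Implicit Types (v : TM M) (xi : TTM R n).

Lemma row_mx_cvg (m m' : nat) (f : I -> 'rV[R]_m) (f' : I -> 'rV[R]_m') (l : 'rV[R]_m) (l' : 'rV[R]_m') :
  (fun i => row_mx (f i) (f' i)) @ F --> row_mx l l' -> f @ F --> l /\ f' @ F --> l'.
Proof.
move=> H.
have Hl : (fun i => lsubmx (row_mx (f i) (f' i))) @ F --> lsubmx (row_mx l l') by exact: cvg_lsubmx.
have Hr : (fun i => rsubmx (row_mx (f i) (f' i))) @ F --> rsubmx (row_mx l l') by exact: cvg_rsubmx.
have el : (fun i => lsubmx (row_mx (f i) (f' i))) = f by apply/funext => i; exact: row_mxKl.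
have er : (fun i => rsubmx (row_mx (f i) (f' i))) = f' by apply/funext => i; exact: row_mxKr.
by rewrite el row_mxKl in Hl; rewrite er row_mxKr in Hr.
Qed.

Lemma vcvg_chart q (v_ : I -> TM M) v : vcvg v_ v -> dom M q v.1 ->
  (\forall i \near F, dom M q (v_ i).1) /\ (fun i => zc q (v_ i)) @ F --> zc q v.
Proof.
move=> [Pp Xx] qv; split; first exact: near_dom_cvg Pp qv.
by rewrite zc.unlock; apply: cvg_row_mx; [exact: chart_cvg Pp qv|exact: Xx].
Qed.

Lemma vcvgP q (v_ : I -> TM M) v : dom M q v.1 -> (\forall i \near F, dom M q (v_ i).1) ->
  (fun i => zc q (v_ i)) @ F --> zc q v -> vcvg v_ v.
Proof.
move=> qv qi; rewrite zc.unlock => H.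
have [Hl Hr] := row_mx_cvg H.
have Pp : (fun i => (v_ i).1) @ F --> v.1.
  have Hi : (fun i => ichart q (chart q (v_ i).1)) @ F --> v.1.
    rewrite -[X in _ --> X](chartK qv).
    apply: (@cvg_comp _ _ _ (fun i => chart q (v_ i).1) (ichart q) F (nbhs (chart q v.1))); first exact: Hl.
    exact: ichart_continuous (cdom_chart qv).
  apply: cvg_trans Hi; apply: near_eq_cvg; apply: filterS qi => i qi.
  by rewrite chartK.
by split; [exact: Pp|exact: xcvgP Pp qv Hr].
Qed.

Lemma dcvg_chart q (v_ : I -> TM M) (xi_ : I -> TTM R n) v xi : vcvg v_ v -> dcvg v_ xi_ v xi -> dom M q v.1 ->
  (fun i => dz g q (v_ i) (xi_ i)) @ F --> dz g q v xi.
Proof.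
move=> [Pp Xx] [Hx Hy] qv; rewrite dz.unlock; apply: cvg_row_mx; first exact: Hx.
apply: cvgB; first exact: Hy.
apply: Gam_cvg; [exact: cdom_chart qv|exact: chart_cvg Pp qv|exact: Hx|exact: Xx].
Qed.

Lemma dcvgP q (v_ : I -> TM M) (xi_ : I -> TTM R n) v xi : vcvg v_ v -> dom M q v.1 ->
  (fun i => dz g q (v_ i) (xi_ i)) @ F --> dz g q v xi -> dcvg v_ xi_ v xi.
Proof.
move=> [Pp Xx] qv; rewrite dz.unlock => H.
have [Hl Hr] := row_mx_cvg H.
have HG : (fun i => Gam g q (chart q (v_ i).1) (tc q (v_ i).1 (xi_ i).1) (tc q (v_ i).1 (v_ i).2)) @ F --> Gam g q (chart q v.1) (tc q v.1 xi.1) (tc q v.1 v.2).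
  by apply: Gam_cvg; [exact: cdom_chart qv|exact: chart_cvg Pp qv|exact: Hl|exact: Xx].
split; first exact: xcvgP Pp qv Hl.
apply: (xcvgP Pp qv).
rewrite -[X in _ --> X](subrK (Gam g q (chart q v.1) (tc q v.1 xi.1) (tc q v.1 v.2))).
apply: near_cvg (cvgD Hr HG); apply: nearW => i.
exact: subrK.
Qed.

End VectorConvergence.
Arguments vcvg {R n M I} F v_ v.
Arguments dcvg {R n M I} F v_ xi_ v xi.
Arguments xcvg {R n M I} F P X p x.

Section FlowContinuity.
Context {R : realType} {n : nat} {M : manifold R n} (g : riemannian_metric M) (gc : complete_metric g).
Context {I : Type} {F : set_system I} {FF : Filter F}.
Local Notation E := 'rV[R]_(n + n).
Implicit Types (q p : M) (v : TM M) (xi : TTM R n).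

Lemma cvg_norm_le (W : normedModType R) (f : I -> W) (l : W) (b : I -> R) :
  (\forall i \near F, `|l - f i| <= b i) -> b @ F --> (0 : R) -> f @ F --> l.
Proof.
move=> H b0; apply/cvgrPdist_lt => e e0.
have Hb : \forall i \near F, b i < e.
  move/cvgrPdist_lt : b0 => /(_ e e0); apply: filterS => i; rewrite sub0r normrN.
  exact: le_lt_trans (ler_norm _).
by move: H Hb; apply: filterS2 => i; exact: le_lt_trans.
Qed.

Lemma cvg_dist_le (W : normedModType R) (f : I -> W) (x l : W) (d : R) :
  f @ F --> l -> `|x - l| < d -> \forall i \near F, `|x - f i| <= d.
Proof.
move=> fl xl; have H : 0 < d - `|x - l| by rewrite subr_gt0.
move/cvgrPdist_le : fl => /(_ _ H); apply: filterS => i zz.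
by apply: le_trans (ler_distD l _ _) _; rewrite -lerBrDl.
Qed.

Lemma cvg_dist0 (W : normedModType R) (f : I -> W) (l : W) :
  f @ F --> l -> (fun i => `|l - f i|) @ F --> (0 : R).
Proof.
move=> fl; have H : (fun i => l - f i) @ F --> l - l by apply: cvgB; [exact: cvg_cst|exact: fl].
by rewrite -(normr0 W) -(subrr l); exact: (cvg_norm H).
Qed.

Lemma cvg_dist0r (W : normedModType R) (f : I -> W) (l : W) :
  f @ F --> l -> (fun i => `|f i - l|) @ F --> (0 : R).
Proof.
move=> fl; have e : (fun i => `|f i - l|) = (fun i => `|l - f i|) by apply/funext => i; exact: distrC.
by rewrite e; exact: cvg_dist0.
Qed.

Lemma flow_cvg (v_ : I -> TM M) v t : vcvg F v_ v -> vcvg F (fun i => flow g t (v_ i)) (flow g t v).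
Proof.
move=> vv; have V0 : vcvg F (fun i => flow g 0 (v_ i)) (flow g 0 v).
  have e1 : (fun i => flow g 0 (v_ i)) = v_ by apply/funext => i; exact: flow0.
  by rewrite e1 (flow0 gc); exact: vv.
move: V0; apply: (@trans_local_total _ (fun a b => vcvg F (fun i => flow g a (v_ i)) (flow g a v) -> vcvg F (fun i => flow g b (v_ i)) (flow g b v))).
  by move=> a b c ab bc Ha; exact: bc (ab Ha).
move=> {}t; have cg := geodesic_geodesic_of gc v.
have [q [r [L [tau [d [e W]]]]]] := flow_window_ex t cg.
have [B e0 _ _] := W.
exists e => [|a b ta tb ad]; first exact: e0.
have [qa za] := flow_window_start W ta.
have tab := ltW (flow_window_dist W ta tb).
have [qi zi] := vcvg_chart ad qa.
have zd : \forall i \near F, `|zc q (flow g t v) - zc q (flow g a (v_ i))| <= d.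
  exact: cvg_dist_le zi za.
have [qb zb _] := flow_box_from B cg qa (ltW za) tab.
apply: (@vcvgP R n M I F FF q (fun i => flow g b (v_ i)) (flow g b v) qb).
  move: qi zd; apply: filterS2 => i qi zi'.
  by have [] := flow_box_from B (geodesic_geodesic_of gc (v_ i)) qi zi' tab.
apply: (@cvg_norm_le _ _ _ (fun i => 2 * `|zc q (flow g a v) - zc q (flow g a (v_ i))|)).
  move: qi zd; apply: filterS2 => i qi zi'.
  exact: geodesic_compare B cg (geodesic_geodesic_of gc (v_ i)) qa qi (ltW za) zi' tab.
rewrite -(mulr0 2); apply: cvgM; first exact: cvg_cst.
exact: cvg_dist0 zi.
Qed.

(** The two solutions obey linear equations with different coefficients. The discrepancy is at most
    the Lipschitz constant of [dfield] times the distance of the orbits times the size of the second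
    solution, and enters [short_time_bound] as its error [e]. *)
Lemma lin_box_compare q v r L tau d v1 v2 K1 K2 a b : flow_box g q v r L tau d ->
  lin_along g v1 K1 -> lin_along g v2 K2 ->
  dom M q (flow g a v1).1 -> `|zc q v - zc q (flow g a v1)| <= d ->
  dom M q (flow g a v2).1 -> `|zc q v - zc q (flow g a v2)| <= d -> `|b - a| <= tau ->
  `|dz g q (flow g b v1) (K1 b) - dz g q (flow g b v2) (K2 b)| <=
   2 * (`|dz g q (flow g a v1) (K1 a) - dz g q (flow g a v2) (K2 a)| +
     tau * (L * (2 * `|zc q (flow g a v1) - zc q (flow g a v2)|) * (2 * `|dz g q (flow g a v2) (K2 a)|))).
Proof.
move=> B l1 l2 qa1 za1 qa2 za2 ab; have [[_ L0 tau0 _] Lt _ tF _] := B.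
have cg := geodesic_geodesic_of gc.
pose y v K (s : R) := dz g q (flow g (a + s) v) (K (a + s)).
pose z v s := zc q (flow g (a + s) v).
have st (s : R) : `|s| <= tau -> `|(a + s) - a| <= tau by rewrite addrAC subrr add0r.
have yd v' K s : lin_along g v' K -> dom M q (flow g a v').1 -> `|zc q v - zc q (flow g a v')| <= d ->
   `|s| <= tau -> ball (zc q v) r (z v' s) /\ is_derive s (1 : R) (y v' K) (dfield (gfield g q) (z v' s) (y v' K s)).
  move=> l qa za ss; have [qs Bs _] := flow_box_from B (cg v') qa za (st s ss).
  split; first exact: Bs.
  exact: (is_derive_shift1 (fun s => dz g q (flow g s v') (K s)) a s _).1 (l _ _ qs).
have y2 s : `|s| <= tau -> `|y v2 K2 s| <= 2 * `|y v2 K2 0|.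
  have H u : `|u| <= tau -> derivable (y v2 K2) u 1 /\ `|'D_1 (y v2 K2) u| <= L * `|y v2 K2 u| + 0.
    move=> us; have [Bs [d1 ->]] := yd _ _ _ l2 qa2 za2 us; split; first exact: d1.
    by rewrite addr0; have [tb _ _ _ _] := tF; have [_] := tb _ (y v2 K2 u) Bs.
  move=> ss; have := short_time_bound tau0 (ltW L0) Lt H ss.
  by rewrite mulr0 addr0.
have := @short_time_bound _ _ (fun s => y v1 K1 s - y v2 K2 s) tau L
  (L * (2 * `|z v1 0 - z v2 0|) * (2 * `|y v2 K2 0|)) tau0 (ltW L0) Lt _ _ ab.
rewrite /y /z !addr0 [a + _]addrC subrK; apply => s ss.
have [B1 y1d] := yd _ _ _ l1 qa1 za1 ss; have [B2 y2d] := yd _ _ _ l2 qa2 za2 ss.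
have [dd ->] := is_deriveB_pt y1d y2d; split; first exact: dd.
have [tb _ _ tl _] := tF.
apply: le_trans (ler_distD (dfield (gfield g q) (z v1 s) (y v2 K2 s)) _ _) _.
apply: lerD.
  have [_ H] := tb _ (y v1 K1 s - y v2 K2 s) B1.
  by rewrite (dfield_tameB _ _ tF B1) in H; exact: H.
apply: le_trans (tl _ _ (y v2 K2 s) B2 B1) _.
have zz : `|z v1 s - z v2 s| <= 2 * `|zc q (flow g a v1) - zc q (flow g a v2)|.
  by have := geodesic_compare B (cg v1) (cg v2) qa1 qa2 za1 za2 (st s ss).
apply: ler_pM; [by rewrite mulr_ge0// ltW|exact: normr_ge0| |].
  by apply: ler_wpM2l zz; exact: ltW.
by have := y2 s ss; rewrite /y addr0.
Qed.

Lemma dphi_cvg (v_ : I -> TM M) (xi_ : I -> TTM R n) v xi t : vcvg F v_ v -> dcvg F v_ xi_ v xi ->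
  dcvg F (fun i => flow g t (v_ i)) (fun i => dphi g t (v_ i) (xi_ i)) (flow g t v) (dphi g t v xi).
Proof.
move=> vv xx.
have V0 : dcvg F (fun i => flow g 0 (v_ i)) (fun i => dphi g 0 (v_ i) (xi_ i)) (flow g 0 v) (dphi g 0 v xi).
  have e1 : (fun i => flow g 0 (v_ i)) = v_ by apply/funext => i; exact: flow0.
  have e2 : (fun i => dphi g 0 (v_ i) (xi_ i)) = xi_ by apply/funext => i; exact: dphi0.
  by rewrite e1 e2 (flow0 gc) (dphi0 gc); exact: xx.
move: V0; apply: (@trans_local_total _ (fun a b => dcvg F (fun i => flow g a (v_ i)) (fun i => dphi g a (v_ i) (xi_ i)) (flow g a v) (dphi g a v xi) ->
   dcvg F (fun i => flow g b (v_ i)) (fun i => dphi g b (v_ i) (xi_ i)) (flow g b v) (dphi g b v xi))).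
  by move=> a b c ab bc Ha; exact: bc (ab Ha).
move=> {}t; have cg := geodesic_geodesic_of gc v.
have [q [r [L [tau [d [e W]]]]]] := flow_window_ex t cg.
have [B e0 _ _] := W.
exists e => [|a b ta tb ad]; first exact: e0.
have [qa za] := flow_window_start W ta.
have tab := ltW (flow_window_dist W ta tb).
have va := flow_cvg a vv.
have [qi zi] := vcvg_chart va qa.
have zd : \forall i \near F, `|zc q (flow g t v) - zc q (flow g a (v_ i))| <= d.
  exact: cvg_dist_le zi za.
have [qb zb _] := flow_box_from B cg qa (ltW za) tab.
apply: (dcvgP (g := g) (flow_cvg b vv) qb).
have di : (fun i => dz g q (flow g a (v_ i)) (dphi g a (v_ i) (xi_ i))) @ F --> dz g q (flow g a v) (dphi g a v xi).
  exact: (dcvg_chart va ad qa).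
pose bnd i := 2 * (`|dz g q (flow g a (v_ i)) (dphi g a (v_ i) (xi_ i)) - dz g q (flow g a v) (dphi g a v xi)| +
     tau * (L * (2 * `|zc q (flow g a (v_ i)) - zc q (flow g a v)|) * (2 * `|dz g q (flow g a v) (dphi g a v xi)|))).
apply: (@cvg_norm_le _ _ _ bnd).
  move: qi zd; apply: filterS2 => i qi zi'; rewrite distrC.
  have H := lin_box_compare B (@lin_along_dphi _ _ _ g gc (v_ i) (xi_ i)) (@lin_along_dphi _ _ _ g gc v xi) qi zi' qa (ltW za) tab.
  exact: H.
have c0 : (fun=> 0 : R) @ F --> (0 : R) by exact: cvg_cst.
have e1 : 0 = 2 * (0 + tau * (L * (2 * 0) * (2 * `|dz g q (flow g a v) (dphi g a v xi)|))) :> R by ring.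
rewrite [X in _ --> X]e1; apply: cvgM; first exact: cvg_cst.
apply: (cvgD (cvg_dist0r di)).
apply: cvgM; first exact: cvg_cst.
apply: cvgM; last exact: cvg_cst.
apply: cvgM; first exact: cvg_cst.
apply: cvgM; first exact: cvg_cst.
exact: cvg_dist0r.
Qed.

End FlowContinuity.

(** * The symplectic form and Jacobi fields *)

Section Isotropic.
Context {R : realType} {n : nat} {M : manifold R n} (g : riemannian_metric M).
Implicit Types (p : M) (xi eta : TTM R n) (S : {vspace TTM R n}).

(* The pull-back of the canonical symplectic form of the cotangent bundle. *)
Definition om p xi eta : R := ip g p xi.2 eta.1 - ip g p xi.1 eta.2.

Definition sn2 p xi : R := ip g p xi.1 xi.1 + ip g p xi.2 xi.2.

Lemma ip_sqr_lin p (a : R) (x y : 'rV[R]_n) :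
  ip g p (a *: x + y) (a *: x + y) = a ^+ 2 * ip g p x x + 2 * a * ip g p x y + ip g p y y.
Proof. by rewrite !ipDl !ipDr !ipZl !ipZr (ip_sym g p y x); ring. Qed.

Lemma ip_unit_le p (x y : 'rV[R]_n) : ip g p y y = 1 -> ip g p x y ^+ 2 <= ip g p x x.
Proof.
move=> y1; have := ip_ge0 g p (- ip g p x y *: y + x).
rewrite ip_sqr_lin y1 (ip_sym g p y x); move: (ip g p x y) (ip g p x x) => a b h.
by rewrite -subr_ge0; have -> : b - a ^+ 2 = (- a) ^+ 2 * 1 + 2 * - a * a + b by ring.
Qed.

Lemma om_linr p (a : R) xi eta zeta : om p xi (a *: eta + zeta) = a * om p xi eta + om p xi zeta.
Proof. by rewrite /om !ipDr !ipZr; ring. Qed.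

Lemma om_anti p xi eta : om p xi eta = - om p eta xi.
Proof. by rewrite /om (ip_sym g p xi.2) (ip_sym g p xi.1); ring. Qed.

Lemma om_linl p (a : R) xi eta zeta : om p (a *: eta + zeta) xi = a * om p eta xi + om p zeta xi.
Proof. by rewrite om_anti om_linr (om_anti p eta) (om_anti p zeta); ring. Qed.

Lemma om_id p xi : om p xi xi = 0.
Proof. by rewrite /om ip_sym subrr. Qed.

Lemma sn2_ge0 p xi : 0 <= sn2 p xi.
Proof. by rewrite addr_ge0 ?ip_ge0. Qed.

Lemma sn2_eq0 p xi : sn2 p xi = 0 -> xi = 0.
Proof.
case: xi => x y /eqP; rewrite /sn2 paddr_eq0 ?ip_ge0//= => /andP[/eqP x0 /eqP y0].
by rewrite (ip_eq0 x0) (ip_eq0 y0).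
Qed.

Lemma om_le p xi eta : `|om p xi eta| <= sn2 p xi + sn2 p eta.
Proof.
have H u w : `|ip g p u w| <= (ip g p u u + ip g p w w) / 2.
  rewrite ler_norml ip_le andbT lerNl -ipNl.
  by apply: le_trans (ip_le g p _ _) _; rewrite ipNl ipNr opprK.
apply: le_trans (ler_normB _ _) _; have := H xi.2 eta.1; have := H xi.1 eta.2.
rewrite /sn2; move: (ip g p xi.1 xi.1) (ip g p xi.2 xi.2) (ip g p eta.1 eta.1) (ip g p eta.2 eta.2) (ip_ge0 g p xi.1) (ip_ge0 g p xi.2) (ip_ge0 g p eta.1) (ip_ge0 g p eta.2) => a b c d *.
by lra.
Qed.

Lemma dim_TTM : \dim (fullv : {vspace TTM R n}) = (n + n)%N.
Proof.
rewrite dimvf; have -> : dim (TTM R n) = (dim 'rV[R]_n + dim 'rV[R]_n)%N by [].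
by congr (_ + _)%N; rewrite -[RHS]mul1n; exact: dim_matrix.
Qed.

(* With [J (x, y) = (y, - x)] one has [om xi (J xi) = sn2 xi], so an isotropic
   space meets its image under [J] trivially. *)
Lemma isotropic_dim p S : {in S &, forall xi eta, om p xi eta = 0} -> (\dim S <= n)%N.
Proof.
move=> iso; pose J xi : TTM R n := (xi.2, - xi.1).
have Jl : linear J by move=> a [x y] [x' y']; rewrite /J /= opprD -scalerN.
pose Jm := GRing.isLinear.Build R (TTM R n) (TTM R n) _ J Jl.
pose JL : {linear TTM R n -> TTM R n} := HB.pack J Jm.
pose f := linfun JL.
have fE xi : f xi = (xi.2, - xi.1) by rewrite lfunE.
have ker0 : (S :&: lker f)%VS = 0%VS.
  apply/eqP; rewrite -subv0; apply/subvP => xi; rewrite memv_cap memv_ker fE memv0 => /andP[_].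
  by case: xi => x y /eqP[/= -> /eqP]; rewrite oppr_eq0 => /eqP ->.
have dis : (S :&: f @: S)%VS = 0%VS.
  apply/eqP; rewrite -subv0; apply/subvP => xi; rewrite memv_cap memv0 => /andP[xiS /memv_imgP[eta etaS e]].
  have := iso _ _ etaS xiS; rewrite e fE /om /= ipNr opprK => H.
  suff -> : eta = 0 by rewrite /= oppr0.
  by apply: (@sn2_eq0 p); rewrite /sn2 addrC.
have := limg_dim_eq ker0; have := dimv_disjoint_sum dis => e1 e2.
have := dimvS (subvf (S + f @: S)); rewrite e1 e2 dim_TTM.
by rewrite !addnn leq_double.
Qed.

Lemma TSM_dim p (w : 'rV[R]_n) S : (forall xi : TTM R n, ip g p xi.2 w = 0 -> xi \in S) ->
  (n + n <= (\dim S).+1)%N.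
Proof.
move=> HS; pose l (xi : TTM R n) : R^o := ip g p xi.2 w.
have ll : linear l by move=> a xi eta; rewrite /l ipDl ipZl.
pose lm := GRing.isLinear.Build R (TTM R n) R^o _ l ll.
pose lL : {linear TTM R n -> R^o} := HB.pack l lm.
pose f := linfun lL.
have kS : (lker f <= S)%VS.
  by apply/subvP => xi; rewrite memv_ker lfunE => /eqP; exact: HS.
have := limg_ker_dim f fullv; rewrite capfv dim_TTM => <-.
have H1 := dimvS kS; have H2 : (\dim (limg f) <= 1)%N by apply: leq_trans (dimvS (subvf _)) _; rewrite dimvf.
by apply: leq_trans (leq_add H1 H2) _; rewrite addn1.
Qed.

End Isotropic.

Section JacobiPairs.
Context {R : realType} {n : nat} {M : manifold R n} (g : riemannian_metric M).
Implicit Types (c : R -> M) (t : R) (K : R -> TTM R n).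

(* [K] is a Jacobi field together with its covariant derivative. *)
Definition jpair c K := forall t,
  [/\ field_derivable c (fun s => (K s).1) t, covD g c (fun s => (K s).1) t = (K t).2,
      field_derivable c (fun s => (K s).2) t &
      covD g c (fun s => (K s).2) t = - curvature g (c t) (K t).1 (velocity c t) (velocity c t)].

Lemma jacobi_jpair c J : jacobi_field g c J -> jpair c (fun t => (J t, covD g c J t)).
Proof.
move=> Jj t; have [fJ fJ' e] := Jj t; split; [exact: fJ|reflexivity|exact: fJ'|].
by apply/eqP; rewrite -addr_eq0; apply/eqP; exact: e.
Qed.

(** In the derivative the products of two first derivatives cancel by symmetry of the inner product,
    and the curvature terms cancel because the Jacobi operator is self-adjoint. *)
Lemma om_jpair c K1 K2 s t : geodesic g c -> jpair c K1 -> jpair c K2 ->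
  om g (c s) (K1 s) (K2 s) = om g (c t) (K1 t) (K2 t).
Proof.
move=> cg j1 j2; apply: (@derive0_cstR _ (fun t => om g (c t) (K1 t) (K2 t))) => {}t.
have [cd _ _] := cg t; have [f1 e1 f1' e1'] := j1 t; have [f2 e2 f2' e2'] := j2 t.
have H1 := is_derive_ip g cd f1' f2; have H2 := is_derive_ip g cd f1 f2'.
have := is_deriveB_pt H1 H2; rewrite e1 e2 e1' e2' ipNl ipNr curvature_jacobi_sym.
by rewrite [X in is_derive _ _ _ X](_ : _ = 0); [exact|ring].
Qed.

Lemma curvature_self_ip p (u w : 'rV[R]_n) : ip g p (curvature g p u w w) w = 0.
Proof.
rewrite curvature_jacobi_sym curvatureE.
have e : Riem g p (chart p p) w w w = 0 by rewrite /Riem !subrr addr0.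
by rewrite e ip0r.
Qed.

Lemma jpair_vel2 c K s t : geodesic g c -> jpair c K ->
  ip g (c s) (K s).2 (velocity c s) = ip g (c t) (K t).2 (velocity c t).
Proof.
move=> cg j1; apply: (@derive0_cstR _ (fun t => ip g (c t) (K t).2 (velocity c t))) => {}t.
have [cd fd c0] := cg t; have [f1 e1 f1' e1'] := j1 t.
have := is_derive_ip g cd f1' fd; rewrite e1' c0 ip0r addr0 ipNl curvature_self_ip oppr0.
exact.
Qed.

Lemma jpair_vel1 c K t : geodesic g c -> jpair c K ->
  is_derive t (1 : R) (fun t => ip g (c t) (K t).1 (velocity c t)) (ip g (c t) (K t).2 (velocity c t)).
Proof.
move=> cg j1; have [cd fd c0] := cg t; have [f1 e1 f1' e1'] := j1 t.
have := is_derive_ip g cd f1 fd; rewrite e1 c0 ip0r addr0.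
exact.
Qed.

Lemma jpair_vel1_cst c K s t : geodesic g c -> jpair c K -> ip g (c 0) (K 0).2 (velocity c 0) = 0 ->
  ip g (c s) (K s).1 (velocity c s) = ip g (c t) (K t).1 (velocity c t).
Proof.
move=> cg j1 k0; apply: (@derive0_cstR _ (fun t => ip g (c t) (K t).1 (velocity c t))) => {}t.
by have := jpair_vel1 t cg j1; rewrite (jpair_vel2 t 0 cg j1) k0.
Qed.

Lemma dphi_jpair (gc : complete_metric g) v xi : jpair (geodesic_of g v) (fun t => dphi g t v xi).
Proof. by move=> t; exact: (lin_along_jacobi gc t (@lin_along_dphi _ _ _ g gc v xi)). Qed.

End JacobiPairs.

Section TangentMap.
Context {R : realType} {n : nat} {M : manifold R n} (g : riemannian_metric M) (gc : complete_metric g).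
Implicit Types (q p : M) (v : TM M) (xi eta : TTM R n) (t : R).

Lemma sqrt_is_derive (f : R -> R) t d : 0 < f t -> is_derive t (1 : R) f d ->
  is_derive t (1 : R) (fun s => (Num.sqrt (f s))^-1) (- (Num.sqrt (f t)) ^- 2 * ((2 * Num.sqrt (f t))^-1 * d)).
Proof.
move=> f0 fd.
have H := @is_derive1_comp _ (fun x => Num.sqrt x) f t _ _ (is_derive1_sqrt f0) fd.
have s0 : Num.sqrt (f t) != 0 by rewrite gt_eqF// sqrtr_gt0.
by have := @realfun.is_deriveV _ (Num.sqrt \o f) t _ (1 : R) s0 H.
Qed.

(* Rescaling to unit length makes the straight curve stay in the unit tangent bundle. *)
Lemma TSM_curve v xi : SM g v -> ip g v.1 xi.2 v.2 = 0 ->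
  exists V : R -> TM M, [/\ V 0 = v, forall s, SM g (V s), lift_derivable V 0 & lift_velocity g V 0 = xi].
Proof.
move=> v1 xiv; pose L := line_lift g v xi.
have [[cd fd] Lv] := line_liftP g v xi.
pose f s := ip g (L s).1 (L s).2 (L s).2.
have L0 : L 0 = v by exact: line_lift0.
have f0 : f 0 = 1 by rewrite /f L0; exact/SM_ip.
have fd0 : is_derive (0 : R) (1 : R) f 0.
  have := @is_derive_ip _ _ _ g (fst \o L) (snd \o L) (snd \o L) 0 cd fd fd.
  have -> : covD g (fst \o L) (snd \o L) 0 = xi.2 by rewrite -Lv.
  rewrite (_ : (fst \o L) 0 = v.1); last exact: (congr1 fst L0).
  rewrite (_ : (snd \o L) 0 = v.2); last exact: (congr1 snd L0).
  by rewrite [ip g v.1 v.2 xi.2]ip_sym xiv addr0.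
(* Where rescaling is impossible the value [v] keeps the curve in [SM]; close to 0 this case does
   not occur. *)
pose V s := if 0 < f s then ((L s).1, (Num.sqrt (f s))^-1 *: (L s).2) else v.
have V0 : V 0 = v.
  by rewrite /V f0 ltr01 sqrtr1 invr1 scale1r L0; case: (v).
have VS s : SM g (V s).
  rewrite /V; case: ifPn => [fs|_]; last exact: v1.
  apply/SM_ip => /=; rewrite ipZl ipZr -/(f s) mulrA -invfM -expr2 sqr_sqrtr ?ltW//.
  by rewrite mulVf// gt_eqF.
pose q := v.1; have qL : dom M q (L 0).1 by rewrite L0; exact: dom_center.
have xd : is_derive (0 : R) (1 : R) (fun s => chart q (L s).1) (tc q (L 0).1 (lift_velocity g L 0).1).
  exact: (@curve_chart _ _ _ q (fst \o L) 0 cd qL).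
have wd := @field_chart _ _ _ g q (fst \o L) (snd \o L) 0 cd fd qL.
pose a s := (Num.sqrt (f s))^-1.
have ad : is_derive (0 : R) (1 : R) a 0.
  have H := sqrt_is_derive (ltac:(by rewrite f0) : 0 < f 0) fd0.
  by rewrite !mulr0 in H; exact: H.
have awd : is_derive (0 : R) (1 : R) (fun s => a s *: tc q (L s).1 (L s).2)
   (tc q (L 0).1 (covD g (fst \o L) (snd \o L) 0) -
     Gam g q (chart q (L 0).1) (tc q (L 0).1 (velocity (fst \o L) 0)) (tc q (L 0).1 (L 0).2)).
  apply/is_derive_rowP => j; move/is_derive_rowP : wd => /(_ j) wd.
  have := is_deriveM_pt ad wd; rewrite {2}/a f0 sqrtr1 invr1 mul0r mul1r add0r.
  by rewrite (_ : (fun t => _) = fun y => (a y *: tc q (L y).1 (L y).2) 0 j)//; apply/funext => s; rewrite mxE.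
have nf : \forall s \near (0 : R), 0 < f s.
  have fc : {for (0 : R), continuous f} by apply: derivable1_continuous; exact: ex_derive.
  by have /cvgr_gt := fc; apply; rewrite f0 ltr01.
have nd : \forall s \near (0 : R), dom M q (L s).1 by have [cc _] := cd; exact: (near_dom cc qL).
have zd : is_derive (0 : R) (1 : R) (fun s => zc q (V s)) (dz g q (L 0) (lift_velocity g L 0)).
  rewrite dz.unlock; apply: near_eq_derive1 (is_derive_row_mx xd awd).
  move: nf nd; apply: filterS2 => s fs qs.
  by rewrite zc.unlock /V fs /= tcZ.
have Vc : {for (0 : R), continuous (fst \o V)}.
  apply: (@foot_continuous _ _ _ V 0 q).
    by move: nf nd; apply: filterS2 => s fs qs; rewrite /V fs.
  by apply: derivable1_continuous; exact: ex_derive.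
have qV : dom M q (V 0).1 by rewrite V0; exact: dom_center.
have [ld e] := lift_derivableP g qV Vc zd.
exists V; split; [exact: V0|exact: VS|exact: ld|].
by apply: (dz_inj (g := g) qV); rewrite e Lv L0 V0.
Qed.

(** The default value of [xget] is never taken, because [TSM_curve] supplies a curve, and the choice
    of the curve is immaterial by [dphi_lift]. *)
Lemma Dflow_dphi t v xi : SM g v -> ip g v.1 xi.2 v.2 = 0 -> Dflow g t v xi = dphi g t v xi.
Proof.
move=> v1 xiv; rewrite /Dflow; case: xgetP => [eta -> [V [[V0 _] ld e _ <-]]|H].
  by rewrite (dphi_lift gc t ld) V0 e.
have [V [V0 VS ld e]] := TSM_curve v1 xiv.
case: (H (lift_velocity g (flow g t \o V) 0)); exists V.
split; [by split|exact: ld|exact: e|exact: flow_lift_derivable|reflexivity].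
Qed.

Lemma om_flow t v xi eta : om g (flow g t v).1 (dphi g t v xi) (dphi g t v eta) = om g v.1 xi eta.
Proof.
have [cg c0] := geodesic_ofP gc v.
have := om_jpair t 0 cg (dphi_jpair gc v xi) (dphi_jpair gc v eta).
by rewrite !(dphi0 gc) (_ : geodesic_of g v 0 = v.1)//; rewrite -[in RHS]c0.
Qed.

Lemma TSM_flow t v xi : ip g v.1 xi.2 v.2 = 0 ->
  ip g (flow g t v).1 (dphi g t v xi).2 (flow g t v).2 = 0.
Proof.
move=> xiv; have [cg c0] := geodesic_ofP gc v.
have := jpair_vel2 t 0 cg (dphi_jpair gc v xi); rewrite (dphi0 gc).
rewrite (_ : geodesic_of g v 0 = v.1); last by rewrite -[in RHS]c0.
rewrite (_ : velocity (geodesic_of g v) 0 = v.2); last by rewrite -[in RHS]c0.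
by rewrite xiv.
Qed.

Lemma vel1_flow t v xi : ip g v.1 xi.2 v.2 = 0 ->
  ip g (flow g t v).1 (dphi g t v xi).1 (flow g t v).2 = ip g v.1 xi.1 v.2.
Proof.
move=> xiv; have [cg c0] := geodesic_ofP gc v.
have e1 : geodesic_of g v 0 = v.1 by rewrite -[in RHS]c0.
have e2 : velocity (geodesic_of g v) 0 = v.2 by rewrite -[in RHS]c0.
have := jpair_vel1_cst t 0 cg (dphi_jpair gc v xi); rewrite (dphi0 gc) e1 e2 => /(_ xiv).
exact.
Qed.

End TangentMap.

(** * Stable and unstable spaces *)

#[local] Opaque flow dphi lift_velocity.

Section FilterLimits.
Context {R : realType} {I : Type}.

Lemma le_cvg (F : set_system I) {FF : ProperFilter F} (f f' : I -> R) (l l' : R) :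
  f @ F --> l -> f' @ F --> l' -> (\forall i \near F, f i <= f' i) -> l <= l'.
Proof.
move=> fl fl' H; rewrite leNgt; apply/negP => ll.
have h1 : \forall i \near F, (l + l') / 2 < f i by have /cvgr_gt := fl; apply; lra.
have h2 : \forall i \near F, f' i < (l + l') / 2 by have /cvgr_lt := fl'; apply; lra.
have [i [a [b c]]] := filter_ex (filterI H (filterI h1 h2)).
by have := lt_le_trans b a; have := c; lra.
Qed.

(** A cluster point of the image of an ultrafilter is a limit. Hence compactness gives convergence
    of the given family itself, and no subsequences have to be extracted. *)
Lemma ultra_compact_cvg (T : topologicalType) (U : set_system I) {UF : UltraFilter U} (A : set T) (f : I -> T) :
  compact A -> (\forall i \near U, A (f i)) -> exists2 p, A p & f @ U --> p.
Proof.
move=> Ac UA; have PF : ProperFilter U := @ultra_proper _ _ UF.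
have [p [Ap cp]] := Ac (f @ U) (fmap_proper_filter f PF) UA.
exists p => // B pB; have [//|UB] := in_ultra_setVsetC (f @^-1` B) UF.
have [x []] := cp (~` B) B UB pB.
by [].
Qed.

End FilterLimits.

Section Decay.
Context {R : realType} {n : nat} {M : manifold R n} (g : riemannian_metric M) (gc : complete_metric g).
Implicit Types (q p : M) (v : TM M) (xi eta : TTM R n) (t sg : R) (S : {vspace TTM R n}).

(** Decay without a rate, forward for [sg = 1] and backward for [sg = -1]. It mentions no splitting,
    which is what allows [Es] to be recovered from the flow alone. *)
Definition decays sg v xi := forall e : R, 0 < e -> exists T : R, forall t, T <= t ->
  sn2 g (flow g (sg * t) v).1 (dphi g (sg * t) v xi) <= e.

Lemma sn2_lin p (a : R) xi eta : sn2 g p (a *: xi + eta) <= 2 * (a ^+ 2 * sn2 g p xi + sn2 g p eta).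
Proof.
have H (x y : 'rV[R]_n) : ip g p (a *: x + y) (a *: x + y) <= 2 * (a ^+ 2 * ip g p x x + ip g p y y).
  have := ip_ge0 g p (- a *: x + y); rewrite !ip_sqr_lin.
  by move: (ip g p x x) (ip g p x y) (ip g p y y) => b d e; lra.
rewrite /sn2 /=; apply: le_trans (lerD (H xi.1 eta.1) (H xi.2 eta.2)) _.
by rewrite le_eqVlt; apply/orP; left; apply/eqP; ring.
Qed.

Lemma decays_lin sg v (a : R) xi eta : decays sg v xi -> decays sg v eta -> decays sg v (a *: xi + eta).
Proof.
move=> dx dy e e0; have a0 : 0 < a ^+ 2 + 1 by rewrite ltr_wpDl ?sqr_ge0.
have [T1 H1] := dx (e / 4 / (a ^+ 2 + 1)) (ltac:(by rewrite !divr_gt0)).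
have [T2 H2] := dy (e / 4) (ltac:(by rewrite divr_gt0)).
exists (Num.max T1 T2) => t; rewrite ge_max => /andP[/H1 h1 /H2 h2].
rewrite (dphi_lin gc); apply: le_trans (sn2_lin _ _ _ _) _.
have h3 : a ^+ 2 * sn2 g (flow g (sg * t) v).1 (dphi g (sg * t) v xi) <= e / 4.
  apply: (@le_trans _ _ ((a ^+ 2 + 1) * (e / 4 / (a ^+ 2 + 1)))).
    by apply: ler_pM; rewrite ?sqr_ge0 ?sn2_ge0// lerDl.
  by rewrite mulrC divfK// gt_eqF.
have := lerD h3 h2 => h4.
apply: le_trans (ler_wpM2l _ h4) _ => //.
by rewrite le_eqVlt; apply/orP; left; apply/eqP; field.
Qed.

(** [om] is constant along the orbit and bounded by the sum of the squared norms, both of which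
    become arbitrarily small. *)
Lemma decays_om sg v xi eta : decays sg v xi -> decays sg v eta -> om g v.1 xi eta = 0.
Proof.
move=> dx dy; apply/eqP; rewrite -normr_le0; apply/ler_addgt0Pr => e e0; rewrite add0r.
have [T1 H1] := dx (e / 2) (ltac:(by rewrite divr_gt0)).
have [T2 H2] := dy (e / 2) (ltac:(by rewrite divr_gt0)).
pose t := Num.max T1 T2.
have h1 := H1 t (ltac:(by rewrite le_max lexx)); have h2 := H2 t (ltac:(by rewrite le_max lexx orbT)).
rewrite -(om_flow gc (sg * t)); apply: le_trans (om_le _ _ _ _) _; rewrite [e]splitr.
exact: (lerD h1 h2).
Qed.

(** For [xi] tangent to [SM] the product of its horizontal part with the velocity is constant along
    the orbit, and its square is at most [sn2]; a nonzero value [m] would contradict decay below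
    [m ^+ 2 / 4]. *)
Lemma decays_vel sg v xi : SM g v -> ip g v.1 xi.2 v.2 = 0 -> decays sg v xi -> ip g v.1 xi.1 v.2 = 0.
Proof.
move=> v1 xiv dx; apply/eqP/negPn/negP => m0.
set m := ip g v.1 xi.1 v.2 in m0.
have e0 : 0 < m ^+ 2 / 4 by rewrite divr_gt0// exprn_even_gt0.
have [T /(_ T (lexx _))] := dx _ e0.
have /SM_ip w1 := flow_SM gc (sg * T) v1.
have := ip_unit_le (dphi g (sg * T) v xi).1 w1; rewrite (vel1_flow gc (sg * T) xiv) -/m /sn2.
have := ip_ge0 g (flow g (sg * T) v).1 (dphi g (sg * T) v xi).2.
have m2 : 0 < m ^+ 2 by rewrite exprn_even_gt0.
move: (ip g _ _ _) (ip g _ _ _) (m ^+ 2) m2 => y x d *; lra.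
Qed.

Lemma vel_neq0 v : SM g v -> v.2 != 0.
Proof. by move=> /SM_ip v1; apply/eqP => v0; move: v1; rewrite v0 ip0l => /eqP; rewrite eq_sym oner_eq0. Qed.

(** The strict inequality comes from the flow direction [f]: it lies outside [S] by [decays_vel],
    and adding it keeps the space isotropic because [S] is tangent to [SM]. *)
Lemma decays_dim sg v S : SM g v ->
  (forall xi, xi \in S -> ip g v.1 xi.2 v.2 = 0 /\ decays sg v xi) -> (\dim S < n)%N.
Proof.
move=> v1 HS; pose f : TTM R n := (v.2, 0).
have f0 : f != 0 by apply: contra (vel_neq0 v1) => /eqP[->].
have fS : (S :&: <[f]>)%VS = 0%VS.
  apply/eqP; rewrite -subv0; apply/subvP => xi; rewrite memv_cap memv0 => /andP[/HS[xv dx] /vlineP[a e]].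
  have := decays_vel v1 xv dx; rewrite e /= ipZl (SM_ip g v).1// mulr1 => ->.
  by rewrite scale0r.
suff : (\dim (S + <[f]>) <= n)%N by rewrite (dimv_disjoint_sum fS) dim_vline f0 addn1.
apply: (@isotropic_dim _ _ _ g v.1) => _ _ /memv_addP[xi xiS [_ /vlineP[a ->] ->]] /memv_addP[eta etaS [_ /vlineP[b ->] ->]].
have [xv dx] := HS _ xiS; have [yv dy] := HS _ etaS.
have omf z : ip g v.1 z.2 v.2 = 0 -> om g v.1 z f = 0 by move=> zv; rewrite /om /f /= zv ip0r subr0.
rewrite [xi + _]addrC [eta + _]addrC om_linl !om_linr om_id (omf _ xv) (decays_om dx dy).
by rewrite (om_anti g v.1 f) (omf _ yv) oppr0; ring.
Qed.

End Decay.

Section Anosov.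
Context {R : realType} {n : nat} {M : manifold R n} (g : riemannian_metric M) (gc : complete_metric g).
Context (k C : R) (k_gt0 : 0 < k) (C_gt0 : 0 < C) (Es Eu : TM M -> {vspace TTM R n})
  (HA : anosov_splitting g k C Es Eu).
Implicit Types (q p : M) (v : TM M) (xi eta : TTM R n) (t : R).

Lemma in_TSM_ip v xi : in_TSM g v xi <-> ip g v.1 xi.2 v.2 = 0.
Proof. by rewrite ip.unlock. Qed.

Lemma Es_TSM v xi : SM g v -> xi \in Es v -> ip g v.1 xi.2 v.2 = 0.
Proof.
move=> v1 xiE; have [_ H _ _] := HA v1; apply/in_TSM_ip/H.
by rewrite -addvA; apply: (subvP (addvSl _ _)).
Qed.

Lemma Eu_TSM v xi : SM g v -> xi \in Eu v -> ip g v.1 xi.2 v.2 = 0.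
Proof.
move=> v1 xiE; have [_ H _ _] := HA v1; apply/in_TSM_ip/H.
by apply: (subvP (addvSl _ _)); apply: (subvP (addvSr _ _)).
Qed.

Lemma sasaki_sn2 v xi : sasaki_norm g v xi = Num.sqrt (sn2 g v.1 xi).
Proof. by rewrite /sn2 ip.unlock. Qed.

Lemma sqrt_bound (a b c : R) : 0 <= a -> 0 <= b -> 0 <= c -> Num.sqrt a <= c * Num.sqrt b -> a <= c ^+ 2 * b.
Proof.
move=> a0 b0 c0 H; rewrite -(sqr_sqrtr a0) -[in leRHS](sqr_sqrtr b0) -exprMn.
by rewrite ler_sqr ?nnegrE ?mulr_ge0// sqrtr_ge0.
Qed.

(** Squared, since [sn2] is the square of the Sasaki norm. *)
Definition rate t : R := (C * expR (- k * t)) ^+ 2.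

Lemma Es_bound v t xi : SM g v -> xi \in Es v -> 0 <= t ->
  sn2 g (flow g t v).1 (dphi g t v xi) <= rate t * sn2 g v.1 xi.
Proof.
move=> v1 xiE t0; have [_ _ H _] := HA v1; have := H t xi t0 xiE.
rewrite (Dflow_dphi gc _ v1 (Es_TSM v1 xiE)) !sasaki_sn2.
by apply: sqrt_bound; rewrite ?sn2_ge0// mulr_ge0 ?expR_ge0// ltW.
Qed.

Lemma Eu_bound v t xi : SM g v -> xi \in Eu v -> 0 <= t ->
  sn2 g (flow g (- t) v).1 (dphi g (- t) v xi) <= rate t * sn2 g v.1 xi.
Proof.
move=> v1 xiE t0; have [_ _ _ H] := HA v1; have := H t xi t0 xiE.
rewrite (Dflow_dphi gc _ v1 (Eu_TSM v1 xiE)) !sasaki_sn2.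
by apply: sqrt_bound; rewrite ?sn2_ge0// mulr_ge0 ?expR_ge0// ltW.
Qed.

Lemma rate_small (e b : R) : 0 < e -> 0 <= b -> exists T : R, 0 <= T /\ forall t, T <= t -> rate t * b <= e.
Proof.
move=> e0 b0; pose D := C ^+ 2 * (b + 1); have D0 : 0 < D by rewrite mulr_gt0// ?exprn_gt0// ltr_wpDl.
(* By [1 + x <= expR x] this makes [expR (2 * k * t)] at least [D / e]; the summand 1 in [D] keeps
   [D] positive when [b] is 0. *)
exists (D / e / (2 * k)); split; first by apply/ltW; rewrite !divr_gt0// mulr_gt0.
move=> t Tt; have kt : D / e <= 2 * k * t.
  by rewrite -ler_pdivrMl ?mulr_gt0// mulrC.
have E : D / e <= expR (2 * k * t).
  apply: le_trans (expR_ge1Dx _); apply: le_trans kt _; by rewrite lerDr.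
have E0 : 0 < expR (2 * k * t) := expR_gt0 _.
have -> : rate t = C ^+ 2 * (expR (2 * k * t))^-1.
  by rewrite /rate exprMn [expR _ ^+ 2]expr2 -expRN -expRD; congr (_ * expR _); ring.
rewrite mulrAC ler_pdivrMr//; apply: (@le_trans _ _ D); first by rewrite ler_wpM2l ?exprn_ge0 ?lerDl// ltW.
by rewrite mulrC -ler_pdivrMr.
Qed.

Lemma Es_decays v xi : SM g v -> xi \in Es v -> decays g 1 v xi.
Proof.
move=> v1 xiE e e0; have [T [T0 HT]] := rate_small e0 (sn2_ge0 g v.1 xi).
exists T => t Tt; rewrite mul1r; apply: le_trans (HT t Tt).
by apply: Es_bound => //; exact: le_trans Tt.
Qed.

Lemma Eu_decays v xi : SM g v -> xi \in Eu v -> decays g (-1) v xi.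
Proof.
move=> v1 xiE e e0; have [T [T0 HT]] := rate_small e0 (sn2_ge0 g v.1 xi).
exists T => t Tt; rewrite mulN1r; apply: le_trans (HT t Tt).
by apply: Eu_bound => //; exact: le_trans Tt.
Qed.

(** The tangent space of [SM] has dimension at least [2n - 1], and the three summands contribute at
    most [n - 1], [n - 1] and 1; hence equality for [Es]. *)
Lemma Es_dim v : SM g v -> (\dim (Es v)).+1 = n.
Proof.
move=> v1; have [_ H _ _] := HA v1.
have HTSM (xi : TTM R n) : ip g v.1 xi.2 v.2 = 0 -> xi \in (Es v + Eu v + <[flow_field g v]>)%VS.
  by move=> h; apply/H/in_TSM_ip.
have := TSM_dim HTSM.
have hs : (\dim (Es v) < n)%N.
  by apply: (@decays_dim _ _ _ g gc 1 v) => // xi xiE; split; [exact: Es_TSM|exact: Es_decays].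
have hu : (\dim (Eu v) < n)%N.
  by apply: (@decays_dim _ _ _ g gc (-1) v) => // xi xiE; split; [exact: Eu_TSM|exact: Eu_decays].
have h1 := (dimv_add_leqif (Es v + Eu v) <[flow_field g v]>).1.
have h2 := (dimv_add_leqif (Es v) (Eu v)).1.
have h3 : (\dim <[flow_field g v]> <= 1)%N by rewrite dim_vline leq_b1.
move: hs hu h1 h2 h3; set a := \dim (Es v); set b := \dim (Eu v); set c := \dim <[_]>; set d := \dim (_ + _ + _); set f := \dim (_ + _).
move=> hs hu h1 h2 h3 h4; apply/eqP; rewrite eqn_leq hs /=.
have : (n + n <= (a + b + 1).+1)%N.
  apply: (leq_trans h4); rewrite ltnS; apply: (leq_trans h1); exact: leq_add.
have : (n + n <= a.+1 + n)%N -> (n <= a.+1)%N by rewrite leq_add2r.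
move=> h h5; apply: h; apply: (leq_trans h5); rewrite addn1 -addnS -[X in (X <= _)%N]addnS -addSnnS.
by rewrite leq_add2l.
Qed.

(** Maximality: [Es v] enlarged by [xi] still consists of decaying vectors, so [decays_dim] forbids
    a larger dimension. *)
Lemma decays_Es v xi : SM g v -> ip g v.1 xi.2 v.2 = 0 -> decays g 1 v xi -> xi \in Es v.
Proof.
move=> v1 xv dx; have h : (\dim (Es v + <[xi]>) < n)%N.
  apply: (@decays_dim _ _ _ g gc 1 v _ v1) => _ /memv_addP[eta etaE [_ /vlineP[a ->] ->]].
  rewrite addrC ipDl ipZl xv (Es_TSM v1 etaE) mulr0 addr0; split; first by [].
  exact: (decays_lin gc a dx (Es_decays v1 etaE)).
have : (Es v == Es v + <[xi]>)%VS.
  by rewrite eqEdim addvSl /= -ltnS (Es_dim v1).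
by move=> /eqP ->; apply: (subvP (addvSr _ _)); exact: memv_line.
Qed.

Lemma Es_om v xi eta : SM g v -> xi \in Es v -> eta \in Es v -> om g v.1 xi eta = 0.
Proof. by move=> v1 xE yE; apply: (@decays_om _ _ _ g gc 1); exact: Es_decays. Qed.

Lemma Es_vel v xi : SM g v -> xi \in Es v -> ip g v.1 xi.1 v.2 = 0.
Proof. by move=> v1 xE; apply: (@decays_vel _ _ _ g gc 1) => //; [exact: Es_TSM|exact: Es_decays]. Qed.

(** Decay is insensitive to a shift of time, so invariance is a consequence of [decays_Es]. *)
Lemma Es_flow t v xi : SM g v -> xi \in Es v -> dphi g t v xi \in Es (flow g t v).
Proof.
move=> v1 xE; apply: decays_Es; [exact: flow_SM|exact: (TSM_flow gc t (Es_TSM v1 xE))|].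
move=> e e0; have [T HT] := Es_decays v1 xE e0; exists (T - t) => s; rewrite lerBlDr mul1r => /HT.
by rewrite mul1r (dphiD gc) (flowD gc).
Qed.

Section Limits.
Context {I : Type} {F : set_system I} {FF : ProperFilter F}.
Implicit Types (V : I -> TM M).

Lemma SM_cvg V v : vcvg F V v -> (\forall i \near F, SM g (V i)) -> SM g v.
Proof.
move=> [Pp Xx] V1; apply/SM_ip.
have H1 : (fun i => ip g (V i).1 (V i).2 (V i).2) @ F --> ip g v.1 v.2 v.2 by exact: ip_cvg.
have H2 : (fun i => ip g (V i).1 (V i).2 (V i).2) @ F --> (1 : R).
  apply: (near_cvg _ (cvg_cst (1 : R))); apply: filterS V1 => i /SM_ip ->.
  by [].
exact: (cvg_unique _ H1 H2).
Qed.

Lemma sn2_cvg V (s : I -> TTM R n) v xi : vcvg F V v -> dcvg F V s v xi ->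
  (fun i => sn2 g (V i).1 (s i)) @ F --> sn2 g v.1 xi.
Proof. by move=> [Pp _] [Hx Hy]; apply: cvgD; exact: ip_cvg. Qed.

(** The bound with [rate t] has the same constants at every vector. It passes to the limit for each
    fixed [t], and so the limit vector decays. *)
Lemma Es_cvg V (s : I -> TTM R n) v xi : vcvg F V v -> dcvg F V s v xi ->
  (\forall i \near F, SM g (V i) /\ s i \in Es (V i)) -> xi \in Es v.
Proof.
move=> Vv sx H; have V1 : \forall i \near F, SM g (V i) by apply: filterS H => i [].
have v1 := SM_cvg Vv V1.
have [Pp Xx] := Vv; have [Hx Hy] := sx.
apply: decays_Es => //.
  have H1 : (fun i => ip g (V i).1 (s i).2 (V i).2) @ F --> ip g v.1 xi.2 v.2 by exact: ip_cvg.
  have H2 : (fun i => ip g (V i).1 (s i).2 (V i).2) @ F --> (0 : R).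
    by apply: (near_cvg _ (cvg_cst (0 : R))); apply: filterS H => i [Vi si]; rewrite (Es_TSM Vi si).
  exact: (cvg_unique _ H1 H2).
have Hb (t : R) : 0 <= t -> sn2 g (flow g t v).1 (dphi g t v xi) <= rate t * sn2 g v.1 xi.
  move=> t0; have L1 : (fun i => sn2 g (flow g t (V i)).1 (dphi g t (V i) (s i))) @ F --> sn2 g (flow g t v).1 (dphi g t v xi).
    by apply: sn2_cvg; [exact: flow_cvg|exact: dphi_cvg].
  have L2 : (fun i => rate t * sn2 g (V i).1 (s i)) @ F --> rate t * sn2 g v.1 xi.
    by apply: cvgM; [exact: cvg_cst|exact: sn2_cvg].
  have L3 : \forall i \near F, sn2 g (flow g t (V i)).1 (dphi g t (V i) (s i)) <= rate t * sn2 g (V i).1 (s i).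
    by apply: filterS H => i [Vi si]; exact: Es_bound.
  exact: (le_cvg L1 L2 L3).
move=> e e0; have [T [T0 HT]] := rate_small e0 (sn2_ge0 g v.1 xi).
exists T => t Tt; rewrite mul1r; apply: le_trans (HT t Tt).
by apply: Hb; exact: le_trans Tt.
Qed.

End Limits.

End Anosov.

(** * The matrix Riccati argument *)

Lemma det_continuous (R : realType) (n : nat) : continuous (fun X : 'M[R]_n => \det X).
Proof.
move=> B; apply: (@Ck_continuous R 'M[R]_n R 0 setT) => //; apply: Ck_det; first exact: openT.
by move=> i j; split=> // x _; exact: coord_continuous.
Qed.

Lemma open_unitmx (R : realType) (n : nat) : open [set X : 'M[R]_n | X \in unitmx].
Proof.
have -> : [set X : 'M[R]_n | X \in unitmx] = (fun X => \det X) @^-1` [set d : R | d != 0].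
  by apply/seteqP; split=> X /=; rewrite unitmxE unitfE.
by apply: open_comp; [move=> X _; exact: det_continuous|exact: open_neq].
Qed.

Section MatrixLimits.
Context {R : realType} {n : nat} {I : Type} {F : set_system I} {FF : Filter F}.
Implicit Types (A : I -> 'M[R]_n) (B : 'M[R]_n).

Lemma mx_cvgP (p q : nat) (f : I -> 'M[R]_(p, q)) (l : 'M[R]_(p, q)) :
  (forall i j, (fun s => f s i j : R) @ F --> (l i j : R)) -> f @ F --> l.
Proof.
move=> fl; apply/cvgrPdist_le => e e0.
have H : \forall s \near F, forall i j, `|l i j - f s i j| <= e.
  by apply: filter_forall => i; apply: filter_forall => j; move/cvgrPdist_le : (fl i j); exact.
apply: filterS H => s fs; rewrite [leLHS]/Num.Def.normr/= mx_normrE.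
by apply: bigmax_le; [exact: ltW|move=> [i j] _ /=; rewrite !mxE].
Qed.

Lemma unit_cvg A B : A @ F --> B -> B \in unitmx -> \forall i \near F, A i \in unitmx.
Proof.
move=> AB Bu; have H : nbhs B [set X : 'M[R]_n | X \in unitmx].
  by apply: open_nbhs_nbhs; split; [exact: open_unitmx|exact: Bu].
exact: AB H.
Qed.

Lemma invmx_cvg A B : A @ F --> B -> B \in unitmx -> (fun i => invmx (A i)) @ F --> invmx B.
Proof.
move=> AB Bu; apply: mx_cvgP => i j.
apply: (@cvg_comp _ _ _ A (fun X : 'M[R]_n => invmx X i j) F (nbhs B)); first exact: AB.
have oU := @open_unitmx R n.
apply: (@Ck_continuous R 'M[R]_n R 0 [set X : 'M[R]_n | X \in unitmx]) => //.
apply: (@Ck_invmx _ _ n 0 _ id) => //.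
by move=> a b; split=> // x _; exact: coord_continuous.
Qed.

End MatrixLimits.

Lemma row_subE (R : realType) (n : nat) (x y : 'rV[R]_n) j : (x - y) 0 j = x 0 j - y 0 j.
Proof. by rewrite !mxE. Qed.

Section PointwiseLimits.
Context {R : realType}.

(** Since [f] vanishes at [t], the second factor need only be continuous there. In the Riccati
    argument that factor is the inverse Gram matrix, whose derivative is thereby avoided. *)
Lemma is_derive_mul0 (f f' : R -> R) t d : is_derive t (1 : R) f d -> f t = 0 -> {for t, continuous f'} ->
  is_derive t (1 : R) (fun s => f s * f' s) (d * f' t).
Proof.
move=> /is_derive1P fd f0 fc; apply/is_derive1P.
have sc : (fun h : R => f' (t + h)) @ 0^' --> f' t.
  have H : (fun h : R => t + h) @ 0^' --> t.
    rewrite -[X in _ --> X]addr0; apply: cvgD; first exact: cvg_cst.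
    by move=> A A0; exact: (nbhs_dnbhs A0).
  exact: (cvg_comp _ _ H fc).
apply: (near_cvg _ (cvgM fd sc)); apply: nearW => h /=.
by rewrite f0 mul0r !subr0 -mulrA.
Qed.

Lemma nonneg_increment (f f' : R -> R) (a b : R) : a < b -> (forall t, is_derive t (1 : R) f (f' t)) ->
  exists2 t, a < t < b & f b - f a = f' t * (b - a).
Proof.
move=> ab fd; have fc : {within `[a, b], continuous f}.
  by apply: continuous_in_subspaceT => t _; apply: derivable1_continuous; have [] := fd t.
have [t + e] := MVT ab (fun t _ => fd t) fc.
by rewrite in_itv/= => tab; exists t.
Qed.

End PointwiseLimits.

Section JacobiFrame.
Context {R : realType} {n : nat} {M : manifold R n} (g : riemannian_metric M).
Context (c : R -> M) (K : 'I_n -> R -> TTM R n) (J : R -> TTM R n).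
Context (cg : geodesic g c) (Kj : forall i, jpair g c (K i)) (Jj : jpair g c J).
Implicit Types (t : R) (a : 'rV[R]_n).

Definition frame t : 'M[R]_n := \matrix_(i < n) (K i t).1.

Context (Kiso : forall i j, om g (c 0) (K i 0) (K j 0) = 0)
  (Kfree : forall t a, a *m frame t = 0 -> a = 0).

(** [f] holds the coefficients of [J] in the frame. It is expressed by inner products, which are
    differentiable in [t], instead of the inverse of [frame t], whose rows are coordinates in the
    varying charts [chart (c t)]. *)
Let w : 'rV[R]_n := \row_i om g (c 0) (J 0) (K i 0).
Let Gm t : 'M[R]_n := \matrix_(i, j) ip g (c t) (K i t).1 (K j t).1.
Let b t : 'rV[R]_n := \row_j ip g (c t) (J t).1 (K j t).1.
Let f t : 'rV[R]_n := b t *m invmx (Gm t).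

Lemma frame_ip t a (x : 'rV[R]_n) : ip g (c t) (a *m frame t) x = \sum_i a 0 i * ip g (c t) (K i t).1 x.
Proof.
rewrite mulmx_sum_row; elim/big_ind2 : _ => [|u y v z <- <-|i _]; first exact: ip0l.
  exact: ipDl.
by rewrite ipZl rowK.
Qed.

Lemma frame_gram t a (j : 'I_n) : (a *m Gm t) 0 j = ip g (c t) (a *m frame t) (K j t).1.
Proof. by rewrite frame_ip mxE; apply: eq_bigr => i _; rewrite mxE. Qed.

Lemma gram_sum t a a' : \sum_j (a *m Gm t) 0 j * a' 0 j = ip g (c t) (a *m frame t) (a' *m frame t).
Proof.
rewrite ip_sym frame_ip; apply: eq_bigr => j _.
by rewrite frame_gram ip_sym mulrC.
Qed.

Lemma gram_unit t : Gm t \in unitmx.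
Proof.
rewrite -row_free_unit; apply: inj_row_free => a a0; apply: (Kfree (t := t)).
apply: (ip_eq0 (g := g) (P := c t)); rewrite -gram_sum a0.
by apply: big1 => j _; rewrite mxE mul0r.
Qed.

Lemma frame_unit t : frame t \in unitmx.
Proof. by rewrite -row_free_unit; apply: inj_row_free => a; exact: Kfree. Qed.

Lemma frame_coord t : (J t).1 = f t *m frame t.
Proof.
pose a := (J t).1 *m invmx (frame t).
have e : (J t).1 = a *m frame t by rewrite /a mulmxKV// frame_unit.
suff -> : f t = a by [].
rewrite /f -[RHS](mulmxK (gram_unit t)); congr (_ *m _).
by apply/rowP => j; rewrite frame_gram -e mxE.
Qed.

Lemma om_J t i : om g (c t) (J t) (K i t) = w 0 i.
Proof. by rewrite mxE; exact: om_jpair. Qed.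

Lemma om_K t i j : om g (c t) (K i t) (K j t) = 0.
Proof. by rewrite (om_jpair t 0 cg (Kj i) (Kj j)). Qed.

(** Splitting off [om] leaves a term that is linear in the undifferentiated first field. For two
    frame fields the [om] term vanishes, and for [J] with a frame field it is a constant entry of
    [w]. *)
Lemma is_derive_ip1 (K1 K2 : R -> TTM R n) t : jpair g c K1 -> jpair g c K2 ->
  is_derive t (1 : R) (fun s => ip g (c s) (K1 s).1 (K2 s).1) (om g (c t) (K1 t) (K2 t) + 2 * ip g (c t) (K1 t).1 (K2 t).2).
Proof.
move=> j1 j2; have [cd _ _] := cg t; have [f1 e1 _ _] := j1 t; have [f2 e2 _ _] := j2 t.
have := is_derive_ip g cd f1 f2; rewrite e1 e2 /om.
by rewrite [X in is_derive _ _ _ X -> _](_ : _ = ip g (c t) (K1 t).2 (K2 t).1 - ip g (c t) (K1 t).1 (K2 t).2 + 2 * ip g (c t) (K1 t).1 (K2 t).2); [exact|ring].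
Qed.

Lemma is_derive_gram t i j : is_derive t (1 : R) (fun s => Gm s i j) (2 * ip g (c t) (K i t).1 (K j t).2).
Proof.
have := is_derive_ip1 t (Kj i) (Kj j); rewrite om_K add0r.
by rewrite (_ : (fun s => ip g (c s) _ _) = fun s => Gm s i j)//; apply/funext => s; rewrite mxE.
Qed.

Lemma is_derive_b t j : is_derive t (1 : R) (fun s => b s 0 j) (w 0 j + 2 * ip g (c t) (J t).1 (K j t).2).
Proof.
have := is_derive_ip1 t Jj (Kj j); rewrite om_J.
by rewrite (_ : (fun s => ip g (c s) _ _) = fun s => b s 0 j)//; apply/funext => s; rewrite mxE.
Qed.

Lemma gram_continuous t : {for t, continuous Gm}.
Proof.
apply: mx_cvgP => i j; have [d _] := is_derive_gram t i j.
exact: (derivable1_continuous d).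
Qed.

(* The matrix Riccati argument: [f (t + h) - f t = r (t + h) *m invmx (Gm (t + h))] with
   [r s := b s - f t *m Gm s], which vanishes at [t] and has derivative [w] there. *)
Lemma is_derive_f t j : is_derive t (1 : R) (fun s => f s 0 j) ((w *m invmx (Gm t)) 0 j).
Proof.
pose r s i : R := b s 0 i - \sum_l f t 0 l * Gm s l i.
have rd i : is_derive t (1 : R) (r^~ i) (w 0 i).
  have sd : is_derive t (1 : R) (fun s => \sum_l f t 0 l * Gm s l i) (\sum_l f t 0 l * (2 * ip g (c t) (K l t).1 (K i t).2)).
    by apply: is_derive_sum_pt => l; exact: (is_deriveZ_pt _ (is_derive_gram t l i)).
  have := is_deriveB_pt (is_derive_b t i) sd.
  have -> : \sum_l f t 0 l * (2 * ip g (c t) (K l t).1 (K i t).2) = 2 * ip g (c t) (J t).1 (K i t).2.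
    rewrite frame_coord frame_ip mulr_sumr; apply: eq_bigr => l _; ring.
  by rewrite addrK.
have r0 i : r t i = 0.
  rewrite /r (_ : \sum_l _ = (f t *m Gm t) 0 i); last by rewrite mxE.
  by rewrite /f mulmxKV ?gram_unit// subrr.
have ic i : {for t, continuous (fun s => invmx (Gm s) i j)}.
  have H : (fun s => invmx (Gm s)) @ t --> invmx (Gm t) by apply: invmx_cvg; [exact: gram_continuous|exact: gram_unit].
  apply: (@continuous_comp _ _ _ (fun s => invmx (Gm s)) (fun X : 'M[R]_n => X i j)); [exact: H|exact: coord_continuous].
have H : is_derive t (1 : R) (fun s => \sum_i r s i * invmx (Gm s) i j + f t 0 j) (\sum_i w 0 i * invmx (Gm t) i j + 0).
  have cd : is_derive t (1 : R) (fun=> f t 0 j) (0 : R) by exact: (is_derive_cst (f t 0 j : R^o)).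
  apply: is_deriveD_pt cd.
  by apply: is_derive_sum_pt => i; exact: is_derive_mul0 (rd i) (r0 i) (ic i).
rewrite addr0 in H; rewrite mxE.
rewrite (_ : (fun s => f s 0 j) = fun s => \sum_i r s i * invmx (Gm s) i j + f t 0 j); first exact: H.
apply/funext => s; have -> : \sum_i r s i * invmx (Gm s) i j = ((b s - f t *m Gm s) *m invmx (Gm s)) 0 j.
  rewrite [RHS]mxE; apply: eq_bigr => i _; congr (_ * _).
  by rewrite row_subE [X in _ - X]mxE.
by rewrite mulmxBl (mulmxK (gram_unit s)) row_subE subrK.
Qed.

(** The monotone quantity of the argument: its derivative is the squared length of the combination
    of the frame with coefficients [w *m invmx (Gm t)], and it vanishes wherever [J] does. *)
Let h t : R := \sum_j f t 0 j * w 0 j.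

Lemma is_derive_h t : is_derive t (1 : R) h
  (ip g (c t) (w *m invmx (Gm t) *m frame t) (w *m invmx (Gm t) *m frame t)).
Proof.
rewrite -gram_sum mulmxKV ?gram_unit//.
have : is_derive t (1 : R) h (\sum_j (w *m invmx (Gm t)) 0 j * w 0 j).
  apply: is_derive_sum_pt => j.
  have := is_deriveZ_pt (w 0 j) (is_derive_f t j); rewrite [_ *: _]mulrC.
  by rewrite (_ : (fun t => _ *: _) = fun t => f t 0 j * w 0 j)//; apply/funext => s; rewrite [RHS]mulrC.
by under eq_bigr do rewrite mulrC.
Qed.

Lemma h_mono s t : s < t -> h s <= h t.
Proof.
move=> st; have [u _ e] := nonneg_increment st is_derive_h.
by rewrite -subr_ge0 e mulr_ge0 ?ip_ge0// subr_ge0 ltW.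
Qed.

Lemma h_strict s t : s < t -> h s = h t -> w = 0.
Proof.
move=> st hst; have [u _ e] := nonneg_increment st is_derive_h.
move: e; rewrite hst subrr => /esym/eqP; rewrite mulf_eq0 subr_eq0 (gt_eqF st) orbF => /eqP /ip_eq0 /Kfree w0.
by rewrite -[w](mulmxKV (gram_unit u)) w0 mul0mx.
Qed.

(* Here [om (J 0) xi], for [xi] the combination of the [K i 0] with the same foot as [J 0], is [h 0]. *)
Lemma frame_h t a : (J t).1 = a *m frame t -> \sum_i a 0 i * om g (c t) (J t) (K i t) = h t.
Proof.
move=> e; have -> : a = f t.
  by apply/eqP; rewrite -subr_eq0; apply/eqP; apply: (Kfree (t := t)); rewrite mulmxBl -e -frame_coord subrr.
by apply: eq_bigr => i _; rewrite om_J.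
Qed.

Lemma h_zero t : (J t).1 = 0 -> h t = 0.
Proof.
move=> J0; have := @frame_h t 0; rewrite mul0mx => /(_ J0) <-.
by apply: big1 => i _; rewrite mxE mul0r.
Qed.

(** [h] is 0 at the zero of [J], so monotonicity decides its sign at [s] according to whether that
    zero lies ahead or behind. *)
Lemma frame_compare s t a : (J s).1 = a *m frame s -> (J t).1 = 0 ->
  (s < t -> \sum_i a 0 i * om g (c s) (J s) (K i s) <= 0) /\
  (t < s -> 0 <= \sum_i a 0 i * om g (c s) (J s) (K i s)).
Proof.
move=> Js Jt; rewrite (frame_h Js) -(h_zero Jt).
by split=> st; exact: h_mono.
Qed.

(** Two zeros of [J] are two zeros of [h], which forces [w = 0]; then the coefficients [f] are
    constant, and they vanish at [s]. *)
Lemma frame_no_conjugate s t : s < t -> (J s).1 = 0 -> (J t).1 = 0 -> forall u, (J u).1 = 0.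
Proof.
move=> st Js Jt u; have w0 : w = 0 by apply: (h_strict st); rewrite !h_zero.
have fd r : is_derive r (1 : R) f 0.
  apply/is_derive_rowP => j; have := is_derive_f r j.
  by rewrite w0 mul0mx.
have f0 : f u = 0.
  by rewrite (derive0_cst fd u s); apply: (Kfree (t := s)); rewrite -frame_coord.
by rewrite frame_coord f0 mul0mx.
Qed.

End JacobiFrame.

Section StableFrame.
Context {R : realType} {n : nat} {M : manifold R n} (g : riemannian_metric M) (gc : complete_metric g).
Context (k C : R) (k_gt0 : 0 < k) (C_gt0 : 0 < C) (Es Eu : TM M -> {vspace TTM R n})
  (HA : anosov_splitting g k C Es Eu).
Implicit Types (q p : M) (v : TM M) (xi eta : TTM R n) (t : R).

Definition bad v := exists xi, [/\ xi \in Es v, vertical g v xi & xi != 0].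

Definition good v := forall t, ~ bad (flow g t v).

(** The geodesic vector field at [v], which is horizontal. *)
Definition flowdir v : TTM R n := (v.2, 0).

Definition Ls v : {vspace TTM R n} := (Es v + <[flowdir v]>)%VS.

Lemma LsP v xi : xi \in Ls v -> exists2 zeta, zeta \in Es v & exists a : R, xi = zeta + a *: flowdir v.
Proof. by move=> /memv_addP[z zE [_ /vlineP[a ->] ->]]; exists z => //; exists a. Qed.

Lemma not_bad v xi : SM g v -> ~ bad v -> xi \in Es v -> xi.1 = 0 -> xi = 0.
Proof.
move=> v1 nb xE x0; apply/eqP/negPn/negP => xn; apply: nb; exists xi; split=> //.
by split=> //; apply/in_TSM_ip; exact: (Es_TSM HA v1 xE).
Qed.

Lemma Ls_om v xi eta : SM g v -> xi \in Ls v -> eta \in Ls v -> om g v.1 xi eta = 0.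
Proof.
move=> v1 /LsP[z zE [a ->]] /LsP[y yE [b ->]]; set f := flowdir v.
have omf x : x \in Es v -> om g v.1 x f = 0.
  by move=> xE; rewrite /om /f /= (Es_TSM HA v1 xE) ip0r subr0.
rewrite [z + _]addrC [y + _]addrC om_linl !om_linr om_id (omf _ zE) (Es_om gc k_gt0 C_gt0 HA v1 zE yE).
by rewrite (om_anti g v.1 f) (omf _ yE) oppr0; ring.
Qed.

Lemma dphi_sum t v (I : Type) (r : seq I) (a : I -> R) (x : I -> TTM R n) :
  dphi g t v (\sum_(i <- r) a i *: x i) = \sum_(i <- r) a i *: dphi g t v (x i).
Proof.
elim: r => [|i r IH]; last by rewrite !big_cons dphi_lin// IH.
rewrite !big_nil; have := dphi_lin gc t v 1 0 0; rewrite !scale1r addr0 => /eqP.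
by rewrite -subr_eq0 opprD addNKr oppr_eq0 => /eqP.
Qed.

(** The inner product of the foot with the velocity isolates the flow component [a], because vectors
    of [Es] have feet orthogonal to the velocity. With [a = 0] the image is a vertical vector of
    [Es (flow g t v)], which is 0 as this vector is not bad. *)
Lemma Ls_flow_eq0 t v xi : SM g v -> ~ bad (flow g t v) -> xi \in Ls v ->
  (dphi g t v xi).1 = 0 -> xi = 0.
Proof.
move=> v1 nb /LsP[z zE [a ->]]; set f := flowdir v; rewrite addrC dphi_lin// => e0.
have v1' := (SM_ip g v).1 v1.
have fT : ip g v.1 f.2 v.2 = 0 by rewrite ip0l.
have a0 : a = 0.
  have e1 : a *: (dphi g t v f).1 + (dphi g t v z).1 = 0 := e0.
  have h1 := vel1_flow gc t fT.
  have h2 := vel1_flow gc t (Es_TSM HA v1 zE).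
  have h3 := Es_vel gc k_gt0 C_gt0 HA v1 zE.
  have : a * ip g v.1 f.1 v.2 + ip g v.1 z.1 v.2 = 0 by rewrite -h1 -h2 -ipZl -ipDl e1 ip0l.
  by rewrite h3 addr0 v1' mulr1.
rewrite a0 scale0r add0r in e0 *; rewrite scale0r add0r.
apply: (dphi_eq0 gc (t := t) (v := v)); apply: not_bad nb _ e0; first exact: flow_SM.
exact: (Es_flow gc k_gt0 C_gt0 HA).
Qed.

(** The projection to the horizontal part is injective on [Ls v], whose dimension is [n]; hence it
    is onto. *)
Lemma Ls_frame v : SM g v -> ~ bad v -> exists eta : 'I_n -> TTM R n,
  forall i, eta i \in Ls v /\ (eta i).1 = delta_mx 0 i.
Proof.
move=> v1 nb; have nb0 : ~ bad (flow g 0 v) by rewrite flow0.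
pose l (xi : TTM R n) : 'rV[R]_n := xi.1.
have ll : linear l by [].
pose lm := GRing.isLinear.Build R (TTM R n) 'rV[R]_n _ l ll.
pose lL : {linear TTM R n -> 'rV[R]_n} := HB.pack l lm.
pose f := linfun lL.
have ker0 : (Ls v :&: lker f)%VS = 0%VS.
  apply/eqP; rewrite -subv0; apply/subvP => xi; rewrite memv_cap memv_ker lfunE memv0 => /andP[xL /eqP x0].
  by apply/eqP; apply: (Ls_flow_eq0 v1 nb0 xL); rewrite dphi0.
have dL : \dim (Ls v) = n.
  have dis : (Es v :&: <[flowdir v]>)%VS = 0%VS.
    apply/eqP; rewrite -subv0; apply/subvP => xi; rewrite memv_cap memv0 => /andP[xE /vlineP[a e]].
    have := Es_vel gc k_gt0 C_gt0 HA v1 xE; rewrite e /= ipZl (SM_ip g v).1// mulr1 => ->.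
    by rewrite scale0r.
  rewrite /Ls (dimv_disjoint_sum dis) dim_vline.
  have -> : flowdir v != 0 by apply: contra (vel_neq0 v1) => /eqP[->].
  by rewrite addn1 (Es_dim gc k_gt0 C_gt0 HA v1).
have full : (f @: Ls v)%VS = fullv.
  apply/eqP; rewrite eqEdim subvf /= (limg_dim_eq ker0) dL dimvf.
  by rewrite (_ : dim _ = n)//; rewrite -[RHS]mul1n; exact: dim_matrix.
have H (i : 'I_n) : exists eta, eta \in Ls v /\ eta.1 = delta_mx 0 i.
  have : (delta_mx 0 i : 'rV[R]_n) \in (f @: Ls v)%VS by rewrite full memvf.
  by move=> /memv_imgP[eta eL ->]; exists eta; rewrite lfunE.
exists (fun i => sval (cid (H i))) => i; exact: (svalP (cid (H i))).
Qed.

Lemma fst_sum (I : Type) (r : seq I) (x : I -> TTM R n) :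
  (\sum_(i <- r) x i).1 = \sum_(i <- r) (x i).1.
Proof. by elim: r => [|i r IH]; rewrite ?big_nil// !big_cons -IH. Qed.

Lemma row_delta_sum (a : 'rV[R]_n) (eta : 'I_n -> TTM R n) : (forall i, (eta i).1 = delta_mx 0 i) ->
  (\sum_i a 0 i *: eta i).1 = a.
Proof.
move=> e; rewrite [RHS]row_sum_delta fst_sum; apply: eq_bigr => i _.
by rewrite /= e.
Qed.

Section Good.
Context (v : TM M) (v1 : SM g v) (vg : good v) (eta : 'I_n -> TTM R n)
  (etaP : forall i, eta i \in Ls v /\ (eta i).1 = delta_mx 0 i).

Let K (i : 'I_n) t := dphi g t v (eta i).

Let cg : geodesic g (geodesic_of g v) := geodesic_geodesic_of gc v.

Let c0 : geodesic_of g v 0 = v.1.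
Proof. by have [_ e] := geodesic_ofP gc v; rewrite -[in RHS]e. Qed.

Let Kj i : jpair g (geodesic_of g v) (K i).
Proof. exact: dphi_jpair. Qed.

Lemma good_iso i j : om g (geodesic_of g v 0) (K i 0) (K j 0) = 0.
Proof. by rewrite /K !dphi0// c0; apply: Ls_om => //; [case: (etaP i)|case: (etaP j)]. Qed.

Lemma Ls_sum (a : 'rV[R]_n) : \sum_i a 0 i *: eta i \in Ls v.
Proof. by apply: memv_suml => i _; apply: memvZ; case: (etaP i). Qed.

Lemma good_free t (a : 'rV[R]_n) : a *m frame K t = 0 -> a = 0.
Proof.
move=> e; have ee i : (eta i).1 = delta_mx 0 i by case: (etaP i).
rewrite -(row_delta_sum a ee) (_ : \sum_i _ = 0)//.
apply: (Ls_flow_eq0 v1 (vg (t := t)) (Ls_sum a)).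
rewrite dphi_sum -[RHS]e mulmx_sum_row fst_sum; apply: eq_bigr => i _.
by rewrite rowK.
Qed.

Lemma good_no_conj' (J : R -> TTM R n) s t : jpair g (geodesic_of g v) J -> s < t ->
  (J s).1 = 0 -> (J t).1 = 0 -> forall u, (J u).1 = 0.
Proof. by move=> Jj; exact: (frame_no_conjugate cg Kj Jj good_iso good_free). Qed.

(** As [chi] and [xi] have the same horizontal part, [om] of the two is the difference of their
    slopes, and [frame_compare] gives its sign. With one positive and one negative [T] the quadratic
    form of [Ls v] is enclosed. *)
Lemma riccati_bound xi chi T : xi \in Ls v -> chi.1 = xi.1 -> (dphi g T v chi).1 = 0 ->
  (0 < T -> ip g v.1 chi.2 chi.1 <= ip g v.1 xi.1 xi.2) /\
  (T < 0 -> ip g v.1 xi.1 xi.2 <= ip g v.1 chi.2 chi.1).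
Proof.
move=> xL ce c0'; pose J t := dphi g t v chi.
have Jj : jpair g (geodesic_of g v) J by exact: dphi_jpair.
have ee i : (eta i).1 = delta_mx 0 i by case: (etaP i).
have nb0 : ~ bad (flow g 0 v) := vg (t := 0).
have xE : xi = \sum_i xi.1 0 i *: eta i.
  apply/eqP; rewrite -subr_eq0; apply/eqP; apply: (Ls_flow_eq0 v1 nb0).
    by apply: memvB => //; exact: Ls_sum.
  rewrite dphi0//; have -> : (xi - \sum_i xi.1 0 i *: eta i).1 = xi.1 - (\sum_i xi.1 0 i *: eta i).1 by [].
  by rewrite row_delta_sum// subrr.
have J0 : (J 0).1 = xi.1 *m frame K 0.
  rewrite /J dphi0// ce {1}xE mulmx_sum_row fst_sum; apply: eq_bigr => i _.
  by rewrite rowK /K dphi0.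
have [h1 h2] := frame_compare cg Kj Jj good_iso good_free J0 c0'.
have e : \sum_i xi.1 0 i * om g (geodesic_of g v 0) (J 0) (K i 0) = ip g v.1 chi.2 chi.1 - ip g v.1 xi.1 xi.2.
  have -> : ip g v.1 chi.2 chi.1 - ip g v.1 xi.1 xi.2 = om g v.1 chi xi by rewrite /om ce.
  have xE2 : om g v.1 chi xi = om g v.1 chi (\sum_i xi.1 0 i *: eta i) by rewrite -xE.
  rewrite xE2 c0 /J dphi0//.
  have sumE (I : Type) (r : seq I) (a : I -> R) (x : I -> TTM R n) :
      om g v.1 chi (\sum_(i <- r) a i *: x i) = \sum_(i <- r) a i * om g v.1 chi (x i).
    elim: r => [|i r IH]; last by rewrite !big_cons om_linr IH.
    by rewrite !big_nil /om /= !ip0r subrr.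
  by rewrite sumE; apply: eq_bigr => i _; rewrite /K dphi0.
by split=> T0; [have := h1 T0|have := h2 T0]; rewrite e ?subr_le0 ?subr_ge0.
Qed.

End Good.

Lemma good_no_conj v : SM g v -> good v -> ~ conjugate_points_on g (geodesic_of g v) setT.
Proof.
move=> v1 vg [a [b [J [_ _ ab Jj [J0 Ja Jb]]]]].
have nb0 : ~ bad v by have := vg 0; rewrite flow0.
have [eta etaP] := Ls_frame v1 nb0.
apply: J0; apply/funext => u.
exact: (good_no_conj' v1 vg etaP (jacobi_jpair Jj) ab Ja Jb u).
Qed.

End StableFrame.

(** * Closedness of good and bad vectors *)

Lemma cvg_row_mul (R : realType) (n : nat) (I : Type) (F : set_system I) {FF : Filter F}
    (f : I -> 'rV[R]_n) (l : 'rV[R]_n) (A : I -> 'M[R]_n) (B : 'M[R]_n) :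
  f @ F --> l -> A @ F --> B -> (fun i => f i *m A i) @ F --> l *m B.
Proof.
move=> fl AB; apply: mx_cvgP => i j; rewrite mxE.
have H : (fun s => \sum_a f s i a * A s a j) @ F --> \sum_a l i a * B a j.
  by apply: cvg_sum_pt => a; apply: cvgM; exact: cvg_coord.
by apply: near_cvg H; apply: nearW => s; rewrite mxE.
Qed.

Lemma cvg_rows (R : realType) (n : nat) (I : Type) (F : set_system I) {FF : Filter F}
    (f : 'I_n -> I -> 'rV[R]_n) (l : 'I_n -> 'rV[R]_n) :
  (forall i, f i @ F --> l i) -> (fun s => (\matrix_(i < n) f i s : 'M[R]_n)) @ F --> (\matrix_(i < n) l i : 'M[R]_n).
Proof.
move=> fl; apply: mx_cvgP => i j; rewrite mxE.
have H : (fun s => f i s 0 j) @ F --> l i 0 j by exact: cvg_coord.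
by apply: near_cvg H; apply: nearW => s; rewrite mxE.
Qed.

(** * Two-point boundary problems for Jacobi fields *)

Section TwoPoint.
Context {R : realType} {n : nat} {M : manifold R n} (g : riemannian_metric M) (gc : complete_metric g).
Implicit Types (q p : M) (v w : TM M) (xi chi : TTM R n) (t T : R).

(* The map [y |-> J T] on Jacobi fields with [J 0 = 0], [J' 0 = y]. *)
Definition jacobi_mx q w t : 'M[R]_n :=
  \matrix_(j < n) tc q (flow g t w).1 (dphi g t w (0, vec q w.1 (delta_mx 0 j))).1.

(** Divided by [t], the matrix tends to the identity as [t] tends to 0, and invertibility is an open
    condition. *)
Lemma jacobi_mx_unit v : exists2 d : R, 0 < d &
  forall t, 0 < `|t| < d -> dom M v.1 (flow g t v).1 /\ jacobi_mx v.1 v t \in unitmx.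
Proof.
pose q := v.1; have qv : dom M q v.1 := dom_center _.
pose xi (j : 'I_n) : TTM R n := (0, vec q v.1 (delta_mx 0 j)).
pose a (j : 'I_n) t : 'rV[R]_n := tc q (flow g t v).1 (dphi g t v (xi j)).1.
have a0 j : a j 0 = 0 by rewrite /a dphi0// flow0//= tr0.
have qv0 : dom M q (flow g 0 v).1 by rewrite flow0.
have ad j : is_derive (0 : R) (1 : R) (a j) (delta_mx 0 j : 'rV[R]_n).
  have := is_derive_lsubmx (lin_along_dphi gc (v := v) (xi j) qv0).
  rewrite dfield_gfield; last exact: zc_dom.
  rewrite row_mxKl dphi0// flow0// dz.unlock row_mxKr /= tr0 Gam0l subr0 tc_vec//.
  rewrite (_ : (fun s => _) = a j)//; apply/funext => s; by rewrite row_mxKl.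
have ac j : (fun h : R => h^-1 *: a j h) @ 0^' --> (delta_mx 0 j : 'rV[R]_n).
  apply: (near_cvg _ ((is_derive1P _ _ _).1 (ad j))); apply: nearW => h.
  by rewrite a0 subr0 add0r.
have Ac : (fun h : R => h^-1 *: jacobi_mx q v h) @ 0^' --> (1%:M : 'M[R]_n).
  apply: mx_cvgP => i j.
  have : (fun h : R => (h^-1 *: a i h) 0 j) @ 0^' --> (delta_mx 0 i : 'rV[R]_n) 0 j by exact: cvg_coord (ac i).
  have -> : (1%:M : 'M[R]_n) i j = (delta_mx 0 i : 'rV[R]_n) 0 j by rewrite !mxE eqxx eq_sym.
  by apply: near_cvg; apply: nearW => h; rewrite !mxE.
have Au := unit_cvg Ac (unitmx1 _ _).
have [[cc _] _ _] := geodesic_geodesic_of gc v 0.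
have nd : \forall t \near (0 : R), dom M q (flow g t v).1 := near_dom cc qv0.
have : \forall t \near 0^', dom M q (flow g t v).1 /\ jacobi_mx q v t \in unitmx.
  have nz : \forall s \near (0:R)^', s != 0 by exact: nbhs_dnbhs_neq.
  have nd' : \forall t \near 0^', dom M q (flow g t v).1 := nbhs_dnbhs nd.
  move: nz; apply: filterS3 nd' Au => t qt tu t0; split=> //.
  by move: tu; rewrite unitmxZ// unitfE invr_eq0.
move=> /nbhs_ballP[d d0 H]; exists d => // t /andP[t0 td].
by apply: H; [rewrite -ball_normE/= sub0r normrN|rewrite -normr_gt0].
Qed.

Section Limit.
Context {I : Type} {F : set_system I} {FF : Filter F}.
Context (V : I -> TM M) (v : TM M) (Vv : vcvg F V v).
Let q := v.1.
Let qv : dom M q v.1 := dom_center _.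

Lemma vec_cvg (y : I -> 'rV[R]_n) (l : 'rV[R]_n) : y @ F --> l ->
  xcvg F (fun i => (V i).1) (fun i => vec q (V i).1 (y i)) v.1 (vec q v.1 l).
Proof.
move=> yl; have [Pp _] := Vv; apply: (xcvgP Pp qv); rewrite tc_vec//.
apply: (near_cvg _ yl); apply: filterS (near_dom_cvg Pp qv) => i qi.
by rewrite tc_vec.
Qed.

Lemma dphi_tc_cvg (xi : I -> TTM R n) xi0 T : dcvg F V xi v xi0 -> dom M q (flow g T v).1 ->
  (fun i => tc q (flow g T (V i)).1 (dphi g T (V i) (xi i)).1) @ F --> tc q (flow g T v).1 (dphi g T v xi0).1.
Proof. by move=> xx qT; have [H _] := dphi_cvg gc T Vv xx; exact: H. Qed.

(** The Jacobi field with foot [u] at time 0 that vanishes at [T] has initial derivative [- p i]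
    times the inverse of [jacobi_mx]. Invertibility along the orbit of [v] extends to nearby orbits,
    and the solutions converge with the data. *)
Lemma two_point u T : dom M q (flow g T v).1 -> jacobi_mx q v T \in unitmx ->
  exists (y : I -> 'rV[R]_n) (l : 'rV[R]_n), y @ F --> l /\
    \forall i \near F, (dphi g T (V i) (vec q (V i).1 u, vec q (V i).1 (y i))).1 = 0.
Proof.
move=> qT uT.
pose p i : 'rV[R]_n := tc q (flow g T (V i)).1 (dphi g T (V i) (vec q (V i).1 u, 0)).1.
pose y i := - p i *m invmx (jacobi_mx q (V i) T).
have [Pp Xx] := Vv.
have z0 : (fun=> 0 : 'rV[R]_n) @ F --> (0 : 'rV[R]_n) by exact: cvg_cst.
have x0 : xcvg F (fun i => (V i).1) (fun=> 0) v.1 0.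
  by apply: (xcvgP Pp qv); rewrite tr0; apply: near_cvg z0; apply: nearW => i; rewrite tr0.
have cu (w : 'rV[R]_n) : (fun _ : I => w) @ F --> w by exact: cvg_cst.
have pc : p @ F --> tc q (flow g T v).1 (dphi g T v (vec q v.1 u, 0)).1.
  by apply: dphi_tc_cvg qT; split=> /=; [exact: vec_cvg|exact: x0].
have Ac : (fun i => jacobi_mx q (V i) T) @ F --> jacobi_mx q v T.
  apply: (cvg_rows (f := fun j i => tc q (flow g T (V i)).1 (dphi g T (V i) (0, vec q (V i).1 (delta_mx 0 j))).1)) => j.
  by apply: dphi_tc_cvg qT; split=> /=; [exact: x0|exact: vec_cvg].
have Ai : (fun i => invmx (jacobi_mx q (V i) T)) @ F --> invmx (jacobi_mx q v T) by exact: invmx_cvg.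
have Au := unit_cvg Ac uT.
exists y, (- tc q (flow g T v).1 (dphi g T v (vec q v.1 u, 0)).1 *m invmx (jacobi_mx q v T)); split.
  by apply: cvg_row_mul Ai; apply: cvgN; exact: pc.
have [Pt _] := flow_cvg gc T Vv.
have nq := near_dom_cvg Pp qv; have nT := near_dom_cvg Pt qT.
move: Au; apply: filterS3 nq nT => i qi qTi ui.
apply: (tc_inj qTi); rewrite tr0.
have split_xi : (vec q (V i).1 u, vec q (V i).1 (y i)) =
    1 *: (vec q (V i).1 u, 0) + \sum_j (y i) 0 j *: ((0, vec q (V i).1 (delta_mx 0 j)) : TTM R n) :> TTM R n.
  rewrite scale1r; apply/pair_equal_spec; split.
    rewrite [RHS]/= fst_sum big1 ?addr0// => j _; exact: scaler0.
  rewrite [RHS]/= add0r {1}(tr_sum (y i) qi (dom_center (V i).1)).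
  by elim: (index_enum _) => [|j r IH]; rewrite ?big_nil// !big_cons IH.
rewrite split_xi dphi_lin// dphi_sum// scale1r.
set S := \sum_j _.
have -> : (dphi g T (V i) (vec q (V i).1 u, 0) + S).1 = (dphi g T (V i) (vec q (V i).1 u, 0)).1 + S.1 by [].
rewrite tcD// -/(p i) fst_sum.
have -> : tc q (flow g T (V i)).1 (\sum_j (y i 0 j *: dphi g T (V i) (0, vec q (V i).1 (delta_mx 0 j))).1) = y i *m jacobi_mx q (V i) T.
  rewrite mulmx_sum_row; elim: (index_enum _) => [|j r IH]; first by rewrite !big_nil tr0.
  by rewrite !big_cons tcD// IH rowK -tcZ.
by rewrite /y mulmxKV// subrr.
Qed.

End Limit.
End TwoPoint.

Section GoodClosed.
Context {R : realType} {n : nat} {M : manifold R n} (g : riemannian_metric M) (gc : complete_metric g).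
Context (k C : R) (k_gt0 : 0 < k) (C_gt0 : 0 < C) (Es Eu : TM M -> {vspace TTM R n})
  (HA : anosov_splitting g k C Es Eu).
Implicit Types (q p : M) (v : TM M) (xi eta : TTM R n) (t : R).
Context {I : Type} {U : set_system I} {UF : UltraFilter U}.
Local Notation E := 'rV[R]_n.

Let PF : ProperFilter U := @ultra_proper _ _ UF.

Lemma ultra_squeeze (f lo hi : I -> R) (a b : R) : lo @ U --> a -> hi @ U --> b ->
  (\forall i \near U, lo i <= f i <= hi i) -> exists l : R, f @ U --> l.
Proof.
move=> loa hib H.
have h1 : \forall i \near U, a - 1 < lo i by have /cvgr_gt := loa; apply; lra.
have h2 : \forall i \near U, hi i < b + 1 by have /cvgr_lt := hib; apply; lra.
have h3 : \forall i \near U, [set x : R | `|x| <= `|a - 1| + `|b + 1|] (f i).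
  move: h1 h2; apply: filterS3 H => i /andP[l1 l2] l3 l4 /=.
  rewrite ler_norml; have := ler_norm (b + 1); have := ler_norm (- (a - 1)); rewrite normrN.
  have := normr_ge0 (a - 1); have := normr_ge0 (b + 1).
  move: (`|a - 1|) (`|b + 1|) => x y *; apply/andP; split; lra.
have kc : compact [set x : R | `|x| <= `|a - 1| + `|b + 1|].
  have -> : [set x : R | `|x| <= `|a - 1| + `|b + 1|] = `[- (`|a - 1| + `|b + 1|), `|a - 1| + `|b + 1|]%classic.
    by apply/seteqP; split=> x /=; rewrite in_itv/= ler_norml.
  exact: segment_compact.
by have [l _ fl] := @ultra_compact_cvg _ _ U UF _ f kc h3; exists l.
Qed.

Context (V : I -> TM M) (v : TM M) (Vv : vcvg U V v).
Let q := v.1.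
Let qv : dom M q v.1 := dom_center _.
Let Pp : (fun i => (V i).1) @ U --> v.1 := proj1 Vv.
Let nq : \forall i \near U, dom M q (V i).1 := near_dom_cvg Pp qv.

Lemma vec_sum p (x : E) : dom M q p -> vec q p x = \sum_a x 0 a *: vec q p (delta_mx 0 a).
Proof. by move=> qp; exact: tr_sum qp (dom_center p). Qed.

Lemma ip_vec_sum p (x y : E) : dom M q p ->
  ip g p (vec q p x) y = \sum_a x 0 a * ip g p (vec q p (delta_mx 0 a)) y.
Proof.
move=> qp; rewrite vec_sum//; elim: (index_enum _) => [|j r IH]; first by rewrite !big_nil ip0l.
by rewrite !big_cons ipDl ipZl IH.
Qed.

(** The inner products with a chart frame determine a vector through the inverse of the Gram matrix
    of that frame, which converges too. *)
Lemma xcvg_dual (Y : I -> E) (l : E) :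
  (forall j, (fun i => ip g (V i).1 (Y i) (vec q (V i).1 (delta_mx 0 j))) @ U --> l 0 j) ->
  exists z : E, xcvg U (fun i => (V i).1) Y v.1 (vec q v.1 z).
Proof.
move=> Yl.
pose Gr p : 'M[R]_n := \matrix_(a, b) ip g p (vec q p (delta_mx 0 a)) (vec q p (delta_mx 0 b)).
have cst (w : E) : (fun _ : I => w) @ U --> w by exact: cvg_cst.
have Gc : (fun i => Gr (V i).1) @ U --> Gr v.1.
  apply: mx_cvgP => a b; rewrite mxE.
  have H : (fun i => ip g (V i).1 (vec q (V i).1 (delta_mx 0 a)) (vec q (V i).1 (delta_mx 0 b))) @ U -->
     ip g v.1 (vec q v.1 (delta_mx 0 a)) (vec q v.1 (delta_mx 0 b)).
    by apply: ip_cvg => //; exact: (vec_cvg Vv).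
  by apply: near_cvg H; apply: nearW => s; rewrite mxE.
have GrE p (x : E) j : dom M q p -> (x *m Gr p) 0 j = ip g p (vec q p x) (vec q p (delta_mx 0 j)).
  by move=> qp; rewrite ip_vec_sum// mxE; apply: eq_bigr => a _; rewrite mxE.
have Gu p : dom M q p -> Gr p \in unitmx.
  move=> qp; rewrite -row_free_unit; apply: inj_row_free => x x0.
  have : ip g p (vec q p x) (vec q p x) = 0.
    by rewrite ip_vec_sum// big1// => j _; rewrite ip_sym -GrE// x0 mxE mulr0.
  move=> /ip_eq0 e; rewrite -(tc_vec x qp) e tr0.
  by [].
pose b i : E := \row_j ip g (V i).1 (Y i) (vec q (V i).1 (delta_mx 0 j)).
have bl : b @ U --> l by apply: cvg_rowP => j; apply: near_cvg (Yl j); apply: nearW => i; rewrite mxE.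
exists (l *m invmx (Gr v.1)); apply: (xcvgP Pp qv); rewrite tc_vec//.
have Gi : (fun i => invmx (Gr (V i).1)) @ U --> invmx (Gr v.1) by apply: invmx_cvg Gc _; exact: Gu.
have H := cvg_row_mul bl Gi.
apply: near_cvg (H _); apply: filterS nq => i qi.
rewrite -[RHS](mulmxK (Gu _ qi)); congr (_ *m _); apply/rowP => j.
by rewrite GrE// vec_tc// mxE.
Qed.

(** Suppose [xi0] is a vertical vector of [Es v]. The spaces [Ls] along [V] are graphs over the
    feet; the element over the foot [xi0.2] is followed to the limit, where it gives a vector of
    [Es v] with horizontal part [xi0.2]. Its product [om] with [xi0] is [- |xi0.2|^2], so isotropy
    gives [xi0 = 0]. *)
Lemma not_bad_cvg : (\forall i \near U, SM g (V i) /\ good g Es (V i)) -> ~ bad g Es v.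
Proof.
move=> H [xi0 [xi0E [x00 xi0v] xi0n]].
have V1 : \forall i \near U, SM g (V i) by apply: filterS H => i [].
have v1 : SM g v by exact: SM_cvg Vv V1.
have [eta etaP] : exists eta : I -> 'I_n -> TTM R n, forall i, SM g (V i) /\ good g Es (V i) ->
    forall j, eta i j \in Ls Es (V i) /\ (eta i j).1 = delta_mx 0 j.
  suff /choice[e eP] : forall i, exists e : 'I_n -> TTM R n, SM g (V i) /\ good g Es (V i) ->
    forall j, e j \in Ls Es (V i) /\ (e j).1 = delta_mx 0 j by exists e.
  move=> i.
  have [[Vi Gi]|nG] := pselect (SM g (V i) /\ good g Es (V i)); last by exists (fun=> 0).
  have nb : ~ bad g Es (V i) by have := Gi 0; rewrite flow0.
  by have [e eP] := Ls_frame gc k_gt0 C_gt0 HA Vi nb; exists e.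
(* The element of the graph [Ls Es (V i)] whose foot has coordinates [u] in [chart q]. *)
pose xi i (u : E) : TTM R n := \sum_j (vec q (V i).1 u) 0 j *: eta i j.
have xi1 i u : SM g (V i) /\ good g Es (V i) -> (xi i u).1 = vec q (V i).1 u.
  by move=> Hi; apply: row_delta_sum => j; have [] := etaP i Hi j.
have xiL i u : SM g (V i) /\ good g Es (V i) -> xi i u \in Ls Es (V i).
  by move=> Hi; apply: memv_suml => j _; apply: memvZ; have [] := etaP i Hi j.
have xi_lin i (a : R) u u' : dom M q (V i).1 -> xi i (a *: u + u') = a *: xi i u + xi i u'.
  move=> qi; rewrite /xi scaler_sumr -big_split; apply: eq_bigr => j _ /=.
  by rewrite (tr_lin _ _ _ qi (dom_center _)) !mxE scalerDl scalerA.
pose Q u i := ip g (V i).1 (xi i u).1 (xi i u).2.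
(* The fields with the same foot that vanish at [d / 2] and at [- (d / 2)] bound the form from below
   and above. Their slopes converge by [two_point], and along an ultrafilter an enclosed function
   converges. *)
have Qc u : exists l : R, Q u @ U --> l.
  have [d d0 Hd] := jacobi_mx_unit gc v.
  have dp : 0 < `|d / 2| < d by rewrite ger0_norm ?divr_ge0 ?ltW//; lra.
  have dn : 0 < `|- (d / 2)| < d by rewrite normrN.
  have [q1 u1] := Hd _ dp; have [q2 u2] := Hd _ dn.
  have [y1 [l1 [yl1 J1]]] := two_point gc Vv u q1 u1.
  have [y2 [l2 [yl2 J2]]] := two_point gc Vv u q2 u2.
  have cu : (fun _ : I => u) @ U --> u by exact: cvg_cst.
  have L1 : (fun i => ip g (V i).1 (vec q (V i).1 (y1 i)) (vec q (V i).1 u)) @ U --> ip g v.1 (vec q v.1 l1) (vec q v.1 u).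
    by apply: ip_cvg => //; exact: (vec_cvg Vv).
  have L2 : (fun i => ip g (V i).1 (vec q (V i).1 (y2 i)) (vec q (V i).1 u)) @ U --> ip g v.1 (vec q v.1 l2) (vec q v.1 u).
    by apply: ip_cvg => //; exact: (vec_cvg Vv).
  apply: (ultra_squeeze L1 L2).
  move: J1 J2; apply: filterS3 H => i Hi j1 j2; have [Vi Gi] := Hi.
  have [B1 _] := riccati_bound gc k_gt0 C_gt0 HA Vi Gi (etaP i Hi) (xiL i u Hi) (esym (xi1 i u Hi) : (vec q (V i).1 u, vec q (V i).1 (y1 i)).1 = _) j1.
  have [_ B2] := riccati_bound gc k_gt0 C_gt0 HA Vi Gi (etaP i Hi) (xiL i u Hi) (esym (xi1 i u Hi) : (vec q (V i).1 u, vec q (V i).1 (y2 i)).1 = _) j2.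
  apply/andP; split; [apply: B1; lra|apply: B2; lra].
(* Polarization: isotropy of [Ls] makes the bilinear form symmetric, so its diagonal determines
   it. *)
have Bc u (j : 'I_n) : exists l : R, (fun i => ip g (V i).1 (xi i u).2 (vec q (V i).1 (delta_mx 0 j))) @ U --> l.
  pose e : E := delta_mx 0 j.
  have [a Qa] := Qc (1 *: u + e); have [b Qb] := Qc (-1 *: e + u).
  exists ((a - b) / 4).
  have L : (fun i => (Q (1 *: u + e) i - Q (-1 *: e + u) i) / 4) @ U --> (a - b) / 4.
    by apply: cvgM; [apply: cvgB|exact: cvg_cst].
  apply: near_cvg L; move: nq; apply: filterS2 H => i Hi qi.
  have om0 := Ls_om gc k_gt0 C_gt0 HA (proj1 Hi) (xiL i u Hi) (xiL i e Hi).
  rewrite /Q !xi_lin// -(xi1 i e Hi) /=.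
  move: om0; rewrite /om; move: (xi i u) (xi i e) => [x1 x2] [w1 w2] /= om0.
  rewrite !ipDl !ipDr !ipZl !ipZr.
  rewrite (ip_sym g (V i).1 w1 x2); move: om0.
  move: (ip g (V i).1 x1 x2) (ip g (V i).1 x1 w2) (ip g (V i).1 x2 w1) (ip g (V i).1 w1 w2) => r1 r2 r3 r4 om0.
  have -> : r2 = r3 by lra.
  by field.
pose u := tc q v.1 xi0.2.
have [z zc] : exists z : E, xcvg U (fun i => (V i).1) (fun i => (xi i u).2) v.1 (vec q v.1 z).
  have [l lP] := choice (Bc u).
  by apply: (@xcvg_dual _ (\row_j l j)) => j; rewrite mxE.
have xc : xcvg U (fun i => (V i).1) (fun i => vec q (V i).1 u) v.1 xi0.2.
  have cu : (fun _ : I => u) @ U --> u by exact: cvg_cst.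
  have e : xi0.2 = vec q v.1 u by rewrite /u vec_tc.
  by rewrite e; exact: (vec_cvg Vv).
pose b i := ip g (V i).1 (vec q (V i).1 u) (V i).2.
have xv0 : ip g v.1 xi0.2 v.2 = 0 := Es_TSM HA v1 xi0E.
have bc : b @ U --> (0 : R) by rewrite -xv0; exact: (ip_cvg Pp xc (proj2 Vv)).
(* The component of [xi i u] along the flow is [b i]; without it the vector lies in [Es (V i)].
   Since [b i] tends to 0, the limit keeps the foot [xi0.2]. *)
pose zeta i : TTM R n := (vec q (V i).1 u - b i *: (V i).2, (xi i u).2).
have zE : \forall i \near U, SM g (V i) /\ zeta i \in Es (V i).
  apply: filterS H => i Hi; have [Vi _] := Hi; split=> //.
  have [s sE [a e]] := LsP (xiL i u Hi).
  have ea : b i = a.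
    rewrite /b -(xi1 i u Hi) e /= ipDl ipZl (Es_vel gc k_gt0 C_gt0 HA Vi sE) (SM_ip g (V i)).1// mulr1 add0r.
    by [].
  suff -> : zeta i = s by [].
  rewrite /zeta -(xi1 i u Hi) e ea; case: (s) => s1 s2 /=.
  by rewrite addrK scaler0 addr0.
have zc' : dcvg U V zeta v (xi0.2, vec q v.1 z).
  split=> //=; apply: (xcvgP Pp qv).
  have L : (fun i => tc q (V i).1 (vec q (V i).1 u) - b i *: tc q (V i).1 (V i).2) @ U -->
      tc q v.1 xi0.2 - (0 : R) *: tc q v.1 v.2.
    by apply: cvgB; [exact: xc qv|apply: cvgZ => //; exact: (proj2 Vv) qv].
  rewrite scale0r subr0 in L; apply: near_cvg L; apply: filterS nq => i qi.
  by rewrite -[- (b i *: (V i).2)]scaleNr tcD// tcZ// scaleNr.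
have zEs : (xi0.2, vec q v.1 z) \in Es v by exact: (Es_cvg gc k_gt0 C_gt0 HA Vv zc' zE).
have := Es_om gc k_gt0 C_gt0 HA v1 zEs xi0E.
rewrite /om /= x00 ip0r sub0r => /eqP; rewrite oppr_eq0 => /eqP /ip_eq0 y0.
by move/eqP: xi0n; apply; rewrite [xi0]surjective_pairing x00 y0.
Qed.

(** Vertical vectors normalized in the coordinates of [chart q] lie in a compact ball, and their
    limit still has coordinate norm 1, hence is not 0. *)
Lemma bad_cvg : (\forall i \near U, SM g (V i) /\ bad g Es (V i)) -> bad g Es v.
Proof.
move=> H.
have V1 : \forall i \near U, SM g (V i) by apply: filterS H => i [].
have v1 : SM g v by exact: SM_cvg Vv V1.
have [u uP] : exists u : I -> E, forall i, dom M q (V i).1 -> SM g (V i) /\ bad g Es (V i) ->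
    `|u i| = 1 /\ (0, vec q (V i).1 (u i)) \in Es (V i).
  suff /choice[u uP] : forall i, exists u : E, dom M q (V i).1 -> SM g (V i) /\ bad g Es (V i) ->
    `|u| = 1 /\ (0, vec q (V i).1 u) \in Es (V i) by exists u.
  move=> i.
  have [qi|nqi] := pselect (dom M q (V i).1); last by exists 0.
  have [[Vi [xi [xiE [x0 _] xin]]]|nB] := pselect (SM g (V i) /\ bad g Es (V i)); last by exists 0.
  pose w := tc q (V i).1 xi.2.
  have w0 : 0 < `|w|.
    rewrite normr_gt0; apply: contra xin => /eqP w0; apply/eqP.
    rewrite [xi]surjective_pairing x0 -(vec_tc xi.2 qi) -/w w0 tr0.
    by [].
  exists (`|w|^-1 *: w) => _ _; split.
    by rewrite normrZ normfV normr_id mulVf// gt_eqF.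
  have -> : (0, vec q (V i).1 (`|w|^-1 *: w)) = `|w|^-1 *: xi :> TTM R n.
    rewrite vecZ// vec_tc//; case: (xi) x0 => a b /= ->.
    by apply/pair_equal_spec; split=> //=; rewrite scaler0.
  exact: memvZ.
have ub : \forall i \near U, [set y : E | `|y - 0| <= 1] (u i).
  by move: nq; apply: filterS2 H => i Hi qi /=; have [e _] := uP i qi Hi; rewrite subr0 e.
have [l _ ul] := @ultra_compact_cvg _ _ U UF _ u (@compact_closed_ball _ _ 0 1) ub.
have l1 : `|l| = 1.
  have L1 : (fun i => `|u i|) @ U --> `|l| by exact: cvg_norm.
  have L2 : (fun i => `|u i|) @ U --> (1 : R).
    apply: (near_cvg _ (cvg_cst (1 : R))); move: nq; apply: filterS2 H => i Hi qi.
    by have [-> _] := uP i qi Hi.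
  exact: (cvg_unique _ L1 L2).
pose z i : TTM R n := (0, vec q (V i).1 (u i)).
have zc' : dcvg U V z v (0, vec q v.1 l).
  split=> /=; last exact: (vec_cvg Vv).
  apply: (xcvgP Pp qv); rewrite tr0.
  have z0 : (fun=> 0 : E) @ U --> (0 : E) by exact: cvg_cst.
  by apply: near_cvg z0; apply: nearW => i; rewrite tr0.
have zE : \forall i \near U, SM g (V i) /\ z i \in Es (V i).
  move: nq; apply: filterS2 H => i Hi qi; split; first by case: Hi.
  by have [] := uP i qi Hi.
have zEs : (0, vec q v.1 l) \in Es v by exact: (Es_cvg gc k_gt0 C_gt0 HA Vv zc' zE).
exists (0, vec q v.1 l); split=> //.
  by split=> //; apply/in_TSM_ip; exact: (Es_TSM HA v1 zEs).
apply/eqP => /(congr1 snd) /= e; move: l1; rewrite -(tc_vec l qv) e tr0 normr0 => /eqP.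
by rewrite eq_sym oner_eq0.
Qed.

End GoodClosed.

(** * Bounded paths *)

(** Paths consist of curves that are C^1 on the whole line. Run with the parameter [step t], which
    never leaves [[0, 1]], a segment in a chart stays in the chart at all times. *)
HB.lock Definition step (R : realType) (t : R) : R := sin (pi / 2 * t) ^+ 2.
Arguments step {R} t.

Section SmoothStep.
Context {R : realType}.

Definition dstep (t : R) : R := pi * (sin (pi / 2 * t) * cos (pi / 2 * t)).

Lemma step0 : step 0 = 0 :> R.
Proof. by rewrite step.unlock mulr0 sin0 expr0n. Qed.

Lemma step1 : step 1 = 1 :> R.
Proof. by rewrite step.unlock mulr1 sin_pihalf expr1n. Qed.

Lemma step_itv (t : R) : 0 <= step t <= 1.
Proof. by rewrite step.unlock sqr_ge0 sin2cos2 /= gerBl sqr_ge0. Qed.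

Lemma is_derive_step t : is_derive t (1 : R) step (dstep t).
Proof.
have ld : is_derive t (1 : R) (fun t : R => pi / 2 * t) (pi / 2).
  have := is_deriveZ_pt (pi / 2 : R) (is_derive_id t (1 : R)); rewrite [_ *: 1]mulr1.
  exact.
have sd : is_derive t (1 : R) (fun t : R => sin (pi / 2 * t)) (cos (pi / 2 * t) * (pi / 2)).
  exact: (@is_derive1_comp _ sin (fun t : R => pi / 2 * t) t _ _ (is_derive_sin _) ld).
have := is_deriveM_pt sd sd; rewrite [X in is_derive _ _ _ X -> _](_ : _ = dstep t); last first.
  by rewrite /dstep; field.
by rewrite (_ : (fun t => _ * _) = step)//; apply/funext => s; rewrite step.unlock expr2.
Qed.

Lemma dstep_continuous : continuous dstep.
Proof.
move=> t; apply: cvgM; first exact: cvg_cst.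
have lc : {for t, continuous (fun t : R => pi / 2 * t)}.
  by apply: cvgM; [exact: cvg_cst|exact: cvg_id].
apply: cvgM.
  by apply: (@continuous_comp _ _ _ (fun t : R => pi / 2 * t) sin) => //; exact: continuous_sin.
by apply: (@continuous_comp _ _ _ (fun t : R => pi / 2 * t) cos) => //; exact: continuous_cos.
Qed.

Lemma dstep_le t : `|dstep t| <= pi.
Proof.
rewrite normrM ger0_norm ?pi_ge0//; rewrite ler_piMr ?pi_ge0// normrM mulr_ile1//.
  by rewrite ler_norml sin_geN1 sin_le1.
by rewrite ler_norml cos_geN1 cos_le1.
Qed.

Lemma ball_convex (n : nat) (z X Y : 'rV[R]_n) (r s : R) : ball z r X -> ball z r Y -> 0 <= s <= 1 ->
  ball z r (X + s *: (Y - X)).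
Proof.
rewrite -ball_normE /= => xr yr /andP[s0 s1].
have -> : z - (X + s *: (Y - X)) = (1 - s) *: (z - X) + s *: (z - Y).
  by apply/rowP => i; rewrite !mxE; ring.
apply: le_lt_trans (ler_normD _ _) _; rewrite !normrZ.
rewrite (ger0_norm s0) ger0_norm ?subr_ge0//.
have [->|sn] := eqVneq s 0; first by rewrite subr0 mul1r mul0r addr0.
have sp : 0 < s by rewrite lt_neqAle eq_sym sn.
have h1 : (1 - s) * `|z - X| <= (1 - s) * r by rewrite ler_wpM2l ?subr_ge0// ltW.
have h2 : s * `|z - Y| < s * r by rewrite ltr_pM2l.
have -> : r = (1 - s) * r + s * r by ring.
exact: ler_ltD.
Qed.

End SmoothStep.

Section Reach.
Context {R : realType} {n : nat} {M : manifold R n} (g : riemannian_metric M).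
Local Notation E := 'rV[R]_n.
Implicit Types (p q x y : M).

Definition reach x y (D : R) := exists2 s, path_from_to x s y & path_length g s <= D.

Lemma path_length_ge0 s : 0 <= path_length g s.
Proof. by apply: sumr_ge0 => c _; apply: Rintegral_ge0 => t _; exact: sqrtr_ge0. Qed.

Lemma path_from_to_cat x s1 y s2 z : path_from_to x s1 y -> path_from_to y s2 z ->
  path_from_to x (s1 ++ s2) z.
Proof.
elim: s1 x => [|c s1 IH] x /=; first by move->.
by move=> [cc c0 p1] p2; split=> //; exact: IH.
Qed.

Lemma reach_trans x y z D1 D2 : reach x y D1 -> reach y z D2 -> reach x z (D1 + D2).
Proof.
move=> [s1 p1 l1] [s2 p2 l2]; exists (s1 ++ s2); first exact: path_from_to_cat p1 p2.
by rewrite /path_length big_cat /=; exact: lerD.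
Qed.

Lemma reach_dist x y D : reach x y D -> dist g x y <= D.
Proof.
move=> [s ps ls]; apply: le_trans ls; apply: ge_inf; last by exists s.
by exists 0 => _ [s' _ ->]; exact: path_length_ge0.
Qed.

Definition chart_line q (X Y : E) (t : R) : M := ichart q (X + step t *: (Y - X)).

Lemma reach_local q : exists2 D : R, 0 <= D & exists2 r : R, 0 < r & ball (chart q q) r `<=` cdom q /\
  forall x y, dom M q x -> dom M q y -> ball (chart q q) r (chart q x) -> ball (chart q q) r (chart q y) ->
  reach x y D.
Proof.
have qq := dom_center q; have cq := cdom_chart qq.
pose z0 := chart q q.
have [B B0 nB] : exists2 B : R, 0 < B & \forall z \near z0, forall ij : 'I_n * 'I_n, `|mcoef g q ij.1 ij.2 z| <= B.
  by apply: finite_near_bounded => ij; exact: (Ck_continuous (mcoef_Ck g q ij.1 ij.2 0) cq).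
have : \forall z \near z0, cdom q z /\ forall ij : 'I_n * 'I_n, `|mcoef g q ij.1 ij.2 z| <= B.
  by apply: filterI => //; exact: near_cdom.
move=> /nbhs_ballP[r /= r0 Hr].
(* A bound for the squared speed: [dstep] is at most [pi], the coordinates of [Y - X] at most
   [2 * r], and there are [n] times [n] metric coefficients of size at most [B]. *)
pose S2 := n%:R * (n%:R * ((pi * (2 * r)) * (pi * (2 * r)) * B)).
have S20 : 0 <= S2 by rewrite !mulr_ge0// ?pi_ge0// ltW.
exists (Num.sqrt S2); first exact: sqrtr_ge0.
exists r => //; split=> [z /Hr[]//|x y qx qy xr yr].
pose X := chart q x; pose Y := chart q y.
pose z t := X + step t *: (Y - X).
have zr t : ball z0 r (z t) by
  exact: ball_convex xr yr (step_itv t).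
have zd t : is_derive t (1 : R) z (dstep t *: (Y - X)).
  have cd : is_derive t (1 : R) (fun=> X) (0 : E) by exact: is_derive_cst.
  by have := is_deriveD_pt cd (is_deriveZl_pt (Y - X) (is_derive_step t)); rewrite add0r.
have zcont t : {for t, continuous z} by apply: derivable1_continuous; have [] := zd t.
pose c := chart_line q X Y.
have cz t : cdom q (z t) by have [] := Hr _ (zr t).
have qc t : dom M q (c t) := ichart_dom (cz t).
have cE t : chart q (c t) = z t := ichartK (cz t).
have cc t : {for t, continuous c}.
  apply: (@continuous_comp _ _ _ z (ichart q)); first exact: zcont.
  exact: ichart_continuous (cz t).
have xd t : is_derive t (1 : R) (fun s => chart q (c s)) (dstep t *: (Y - X)).
  by rewrite (_ : (fun s => _) = z)//; apply/funext => s; exact: cE.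
have cdv t := curve_derivableP (qc t) (cc t) (xd t).
have ve t : velocity c t = vec q (c t) (dstep t *: (Y - X)) by have [] := cdv t.
have vc t : xcvg (nbhs t) c (velocity c) (c t) (velocity c t).
  apply: (xcvgP (cc t) (qc t)); rewrite ve (tc_vec _ (qc t)).
  have L : (fun s => dstep s *: (Y - X)) @ t --> dstep t *: (Y - X).
    by apply: cvgZ; [exact: dstep_continuous|exact: cvg_cst].
  by apply: near_cvg L; apply: nearW => s; rewrite ve tc_vec.
have C1 : C1_curve c.
  move=> t; split; first by case: (cdv t).
  rewrite /field_continuous; have := vc t (c t) (dom_center _).
  rewrite -[X in _ --> X -> _]tcoordE.
  by under eq_fun do rewrite -tcoordE.
have nle t : norm_at g (c t) (velocity c t) <= Num.sqrt S2.
  have -> : norm_at g (c t) (velocity c t) = Num.sqrt (ip g (c t) (velocity c t) (velocity c t)) by rewrite ip.unlock.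
  rewrite ler_sqrt//.
  have [_ mB] := Hr _ (zr t).
  rewrite (ipE g _ _ (qc t)) cE ve (tc_vec _ (qc t)) (ginner_coef _ _ _ (cz t)).
  have d i : `|(dstep t *: (Y - X)) 0 i| <= pi * (2 * r).
    apply: le_trans (coord_norm_le _ _) _; rewrite normrZ; apply: ler_pM => //; first exact: dstep_le.
    move: xr yr; rewrite -ball_normE /= -/z0 -/X -/Y => xr yr.
    apply: le_trans (ler_distD z0 _ _) _; rewrite distrC.
    by rewrite mulr_natl mulr2n; apply: lerD; apply: ltW.
  apply: le_trans (ler_norm _) _; apply: sum_norm_le => i; apply: sum_norm_le => j.
  rewrite !normrM; apply: ler_pM; rewrite ?mulr_ge0//; last exact: (mB (i, j)).
  by apply: ler_pM.
exists [:: c]; first by split=> //=; [rewrite /c /chart_line step0 scale0r addr0 chartK|rewrite /c /chart_line step1 scale1r addrC subrK chartK].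
rewrite /path_length big_seq1.
have nc t : {for t, continuous (fun t => norm_at g (c t) (velocity c t))}.
  have e : (fun t => norm_at g (c t) (velocity c t)) = (fun t => Num.sqrt (ip g (c t) (velocity c t) (velocity c t))).
    by apply/funext => s; rewrite ip.unlock.
  rewrite e; apply: (@continuous_comp _ _ _ (fun t => ip g (c t) (velocity c t) (velocity c t)) Num.sqrt); last exact: sqrt_continuous.
  exact: (ip_cvg (cc t) (vc t) (vc t)).
have If : (lebesgue_measure).-integrable `[0, 1] (EFin \o (fun t => norm_at g (c t) (velocity c t))).
  apply: continuous_compact_integrable; first exact: segment_compact.
  by apply: continuous_in_subspaceT => t _; exact: nc.
have Ic : (lebesgue_measure).-integrable `[0, 1] (EFin \o (fun _ : R => Num.sqrt S2)).
  apply: continuous_compact_integrable; first exact: segment_compact.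
  by apply: continuous_in_subspaceT => t _; exact: cvg_cst.
have mI : measurable (`[0, 1]%classic : set (measurableTypeR R)) by exact: measurable_itv.
have H := le_Rintegral mI If Ic (fun t _ => nle t).
apply: (le_trans H).
rewrite Rintegral_cst; last exact: mI.
rewrite [X in fine X](_ : _ = 1%E) /=; first by rewrite mulr1.
by have := @lebesgue_measure_itv R `[0,1]; rewrite /= lte_fin ltr01 oppr0 adde0.
Qed.

Lemma reach_near q : exists2 D : R, 0 <= D & \forall x \near q, \forall y \near q, reach x y D.
Proof.
have [D D0 [r r0 [_ H]]] := reach_local q; exists D => //.
have N : \forall x \near q, dom M q x /\ ball (chart q q) r (chart q x).
  apply: filterI; first by apply: open_nbhs_nbhs; split; [exact: dom_open|exact: dom_center].
  have cc := @chart_continuous _ _ M q q (dom_center q).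
  by apply: cc; apply: open_nbhs_nbhs; split; [exact: ball_open|exact: ballxx].
by apply: filterS (N) => x [qx xr]; apply: filterS N => y [qy yr]; exact: H.
Qed.

(** The points with this property form an open and closed set. One bound serves a whole
    neighbourhood of [q], so that it applies to families converging to [q]. *)
Lemma reach_bounded (M_connected : connected [set: M]) p q :
  exists D : R, \forall y \near q, reach p y D.
Proof.
pose A : set M := [set y : M | exists D : R, \forall z \near y, reach p z D].
suff AT : A = setT by have : A q by rewrite AT.
have loc y : exists2 D : R, 0 <= D & \forall x \near y, \forall z \near y, reach x z D := reach_near y.
apply: M_connected.
- have [D _ ND] := reach_near p; exists p, D; exact: nbhs_singleton ND.
- exists A; last by rewrite setTI.
  rewrite openE => y [D HD]; rewrite /interior; have := nbhs_interior HD.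
  by apply: filterS => z Hz; exists D.
- exists A; last by rewrite setTI.
  move=> y cy; have [D _ ND] := loc y.
  have [z [[D' HD'] nz]] := cy _ ND.
  exists (D' + D); apply: filterS nz => x zx.
  exact: reach_trans (nbhs_singleton HD') zx.
Qed.

End Reach.

(** * Openness of good vectors *)

Section JointFlow.
Context {R : realType} {n : nat} {M : manifold R n} (g : riemannian_metric M) (gc : complete_metric g).
Context {I : Type} {F : set_system I} {FF : Filter F}.
Implicit Types (q p : M) (v : TM M).

Lemma flow_box_speed q v r L tau d c (b : R) : flow_box g q v r L tau d -> geodesic g c ->
  dom M q (c 0) -> `|zc q v - zc q (velocity_lift c 0)| <= d -> `|b| <= tau ->
  `|zc q (velocity_lift c b) - zc q (velocity_lift c 0)| <= L * `|b|.
Proof.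
move=> B cg q0 z0 bt; have [_ _ _ tF H] := B.
have := @MVT_norm _ _ (fun s => zc q (velocity_lift c s)) 0 b L; rewrite subr0; apply => t tb.
have t0 : `|0 : R| <= tau by rewrite normr0; exact: le_trans (normr_ge0 b) bt.
have [_ zb [d1 ->]] := H c cg q0 z0 t (norm_le_itv t0 bt tb).
split; first exact: d1.
by have [F1 _ _ _ _] := tF; have [] := F1 _ 0 zb.
Qed.

Lemma joint_flow_cvg0 (W : I -> TM M) w (s : I -> R) : vcvg F W w -> s @ F --> (0 : R) ->
  vcvg F (fun i => flow g (s i) (W i)) w.
Proof.
move=> Ww s0; have qw : dom M w.1 w.1 := dom_center _.
have [r [L [tau [d B]]]] := flow_box_ex g qw.
have [[_ L0 tau0 d0] _ _ _ H] := B.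
have [qi zi] := vcvg_chart Ww qw.
have zd : \forall i \near F, `|zc w.1 w - zc w.1 (W i)| <= d by apply: cvg_dist_le zi _; rewrite subrr normr0.
have st : \forall i \near F, `|s i| <= tau.
  have h : `|0 - 0 : R| < tau by rewrite subrr normr0.
  by apply: filterS (cvg_dist_le s0 h) => i; rewrite sub0r normrN.
have Wg i := geodesic_geodesic_of gc (W i).
have W0 i : velocity_lift (geodesic_of g (W i)) 0 = W i by case: (geodesic_ofP gc (W i)).
have W01 i : geodesic_of g (W i) 0 = (W i).1 by rewrite -[in RHS]W0.
have near3 : \forall i \near F, dom M w.1 (flow g (s i) (W i)).1 /\
    `|zc w.1 (flow g (s i) (W i)) - zc w.1 (W i)| <= L * `|s i|.
  move: qi zd st; apply: filterS3 => i qi zdi sti.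
  have q0 : dom M w.1 (geodesic_of g (W i) 0) by rewrite W01.
  have z0 : `|zc w.1 w - zc w.1 (velocity_lift (geodesic_of g (W i)) 0)| <= d by rewrite W0.
  split; first by have [] := H _ (Wg i) q0 z0 _ sti.
  by have := flow_box_speed B (Wg i) q0 z0 sti; rewrite W0.
apply: (@vcvgP R n M I F FF w.1 _ w qw); first by apply: filterS near3 => i [].
apply: (@cvg_norm_le _ _ _ _ _ _ _ (fun i => `|zc w.1 w - zc w.1 (W i)| + L * `|s i|)).
  apply: filterS near3 => i [_ h]; apply: le_trans (ler_distD (zc w.1 (W i)) _ _) _.
  by apply: lerD; [exact: lexx|rewrite distrC; exact: h].
have e1 : 0 = 0 + L * 0 :> R by rewrite mulr0 addr0.
rewrite [X in _ --> X]e1; apply: cvgD; first exact: cvg_dist0.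
apply: cvgM; first exact: cvg_cst.
by rewrite -[X in _ --> X](normr0 R); exact: (cvg_norm s0).
Qed.

(** Flowing first for the fixed time [t] reduces the claim to times [s i - t] tending to 0, during
    which the coordinates move by at most [L * |s i - t|]. *)
Lemma joint_flow_cvg (V : I -> TM M) v (s : I -> R) t : vcvg F V v -> s @ F --> t ->
  vcvg F (fun i => flow g (s i) (V i)) (flow g t v).
Proof.
move=> Vv st; have H : (fun i => s i - t) @ F --> (0 : R).
  by rewrite -(subrr t); apply: cvgB; [exact: st|exact: cvg_cst].
have e : (fun i => flow g (s i - t) (flow g t (V i))) = (fun i => flow g (s i) (V i)).
  by apply/funext => i; rewrite -(flowD gc) subrK.
by rewrite -e; exact: (joint_flow_cvg0 (flow_cvg gc t Vv) H).
Qed.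

Definition vopp v : TM M := (v.1, - v.2).

Lemma vopp_SM v : SM g v -> SM g (vopp v).
Proof. by move=> /SM_ip v1; apply/SM_ip; rewrite /= ipNl ipNr opprK. Qed.

Lemma vopp_cvg (V : I -> TM M) v : vcvg F V v -> vcvg F (fun i => vopp (V i)) (vopp v).
Proof.
move=> [Pp Xx]; split=> //= q qv.
have e p (x : 'rV[R]_n) : dom M q p -> tc q p (- x) = - tc q p x.
  by move=> qp; rewrite -scaleN1r trZ ?scaleN1r//; exact: dom_center.
rewrite e//; apply: near_cvg (cvgN (Xx q qv)).
by apply: filterS (near_dom_cvg Pp qv) => i qi; rewrite e.
Qed.

Lemma flow_vopp t v : (flow g t (vopp v)).1 = (flow g (- t) v).1.
Proof.
have [vg v0] := geodesic_ofP gc v.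
have og := geodesic_opp vg.
have e : velocity_lift (fun s => geodesic_of g v (- s)) 0 = vopp v.
  rewrite /vopp -[in RHS]v0 /velocity_lift /= (velocity_opp _ vg) oppr0.
  by [].
by have := geodesic_flow gc t og; rewrite e => /(congr1 fst) /= <-.
Qed.

Lemma TM_open_cvg (W : set (TM M)) (V : I -> TM M) v : TM_open W -> W v -> vcvg F V v ->
  \forall i \near F, W (V i).
Proof.
move=> Wo Wv Vv; have qv : dom M v.1 v.1 := dom_center _.
have [Pp Xx] := Vv.
pose y i := (chart v.1 (V i).1, tc v.1 (V i).1 (V i).2).
have yc : y @ F --> (chart v.1 v.1, tc v.1 v.1 v.2).
  exact: (cvg_pair (chart_cvg Pp qv) (Xx _ qv)).
have E w : dom M v.1 w.1 -> (ichart v.1 (chart v.1 w.1), tvec v.1 (chart v.1 w.1) (tc v.1 w.1 w.2)) = w.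
  move=> qw; rewrite tvecE; last exact: cdom_chart.
  by rewrite chartK// vec_tc//; case: (w).
have H : \forall i \near F, (cdom v.1 (y i).1) /\ W (ichart v.1 (y i).1, tvec v.1 (y i).1 (y i).2).
  have N : nbhs (chart v.1 v.1, tc v.1 v.1 v.2) [set z : 'rV[R]_n * 'rV[R]_n | cdom v.1 z.1 /\ W (ichart v.1 z.1, tvec v.1 z.1 z.2)].
    apply: open_nbhs_nbhs; split; first exact: (Wo v.1).
    by split; [exact: cdom_chart|rewrite E].
  exact: yc N.
move: (near_dom_cvg Pp qv) H; apply: filterS2 => i qi [_]; rewrite E//.
Qed.

End JointFlow.

Section GoodOpen.
Context {R : realType} {n : nat} {M : manifold R n} (g : riemannian_metric M) (gc : complete_metric g).
Context (k C : R) (k_gt0 : 0 < k) (C_gt0 : 0 < C) (Es Eu : TM M -> {vspace TTM R n})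
  (HA : anosov_splitting g k C Es Eu).
Context (M_connected : connected [set: M]).
Context (escape : forall v : TM M, SM g v ->
       exists U : set (TM M), [/\ SM_open g U, U v &
         forall A : R, exists T : R, forall c : R -> M,
           unit_geodesic g c -> U (velocity_lift c 0) ->
           forall t, T <= t -> A <= dist g (c 0) (c t)]).
Context (K : set M) (K_compact : compact K)
  (far : forall v, SM g v -> ~ K v.1 -> ~ bad g Es v).
Context {I : Type} {U : set_system I} {UF : UltraFilter U}.
Context (V : I -> TM M) (v : TM M) (Vv : vcvg U V v) (V1 : \forall i \near U, SM g (V i)).

Let PF : ProperFilter U := @ultra_proper _ _ UF.

Lemma escape_near (W : I -> TM M) w (A : R) : vcvg U W w -> (\forall i \near U, SM g (W i)) ->
  exists T : R, \forall i \near U, forall t, T <= t -> A <= dist g (W i).1 (flow g t (W i)).1.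
Proof.
move=> Ww W1; have w1 : SM g w by exact: SM_cvg Ww W1.
have [N [[N' No ->] [Nw _] H]] := escape w1.
have [T HT] := H A; exists T.
have NW : \forall i \near U, N' (W i) by exact: (TM_open_cvg No Nw Ww).
move: NW W1; apply: filterS2 => i Oi Si t Tt.
have [cg c0] := geodesic_ofP gc (W i).
have := HT _ (unit_geodesic_of gc Si) _ t Tt; rewrite c0.
move=> /(_ (conj Oi Si)); have -> : geodesic_of g (W i) 0 = (W i).1 by rewrite -[in RHS]c0.
by [].
Qed.

Lemma not_good_cvg : (\forall i \near U, ~ good g Es (V i)) -> ~ good g Es v.
Proof.
move=> H.
have [s Hs] : exists s : I -> R, \forall i \near U, bad g Es (flow g (s i) (V i)).
  have /choice[s sP] : forall i, exists t : R, ~ good g Es (V i) -> bad g Es (flow g t (V i)).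
    move=> i; have [h|/existsNP[t /contrapT ht]] := pselect (good g Es (V i)); first by exists 0.
    by exists t.
  by exists s; apply: filterS H => i /sP.
have S1 : \forall i \near U, SM g (flow g (s i) (V i)) by apply: filterS V1 => i; exact: flow_SM.
have KV : \forall i \near U, K (flow g (s i) (V i)).1.
  move: S1 Hs; apply: filterS2 => i h1 h2; apply: contrapT => nK; exact: far h1 nK h2.
have [p Kp fp] := ultra_compact_cvg (f := fun i => (flow g (s i) (V i)).1) K_compact KV.
have [D1 HD1] := reach_bounded g M_connected v.1 p.
have [D0 _ HD0] := reach_near g v.1.
(* [D0] leads from the foot of [V i] to the foot of [v], and [D1] from there to the foot of the bad
   vector, which is close to [p]. *)
pose D := D0 + D1.
have dD : \forall i \near U, dist g (V i).1 (flow g (s i) (V i)).1 <= D.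
  have [Pp _] := Vv.
  have h1 : \forall i \near U, \forall y \near v.1, reach g (V i).1 y D0 by exact: Pp HD0.
  have h2 : \forall i \near U, reach g v.1 (flow g (s i) (V i)).1 D1 by exact: fp HD1.
  move: h1 h2; apply: filterS2 => i h1 h2; apply: reach_dist.
  exact: reach_trans (nbhs_singleton h1) h2.
(* [D + 1] instead of [D]: escape is a weak inequality and has to contradict the bound [D]. The
   second instance, for reversed vectors, bounds [s i] from below. *)
have [T HT] := escape_near (D + 1) Vv V1.
have [T' HT'] := escape_near (D + 1) (vopp_cvg Vv) (filterS (fun i => @vopp_SM _ _ _ g (V i)) V1).
have sT : \forall i \near U, [set x : R | - T' <= x <= T] (s i).
  move: dD HT HT'; apply: filterS3 => i dDi h1 h2 /=; apply/andP; split; rewrite leNgt; apply/negP => h.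
    have := h2 (- s i); rewrite flow_vopp// opprK lerNr => /(_ (ltW h)) /le_trans /(_ dDi).
    by rewrite gerDl ler10.
  by have := h1 (s i) (ltW h) => /le_trans /(_ dDi); rewrite gerDl ler10.
have Ic : compact [set x : R | - T' <= x <= T].
  have -> : [set x : R | - T' <= x <= T] = `[- T', T]%classic.
    by apply/seteqP; split=> x /=; rewrite in_itv.
  exact: segment_compact.
have [t _ st] := ultra_compact_cvg Ic sT.
move=> vg; apply: (vg t).
apply: (bad_cvg gc k_gt0 C_gt0 HA (joint_flow_cvg gc Vv st)).
by move: S1 Hs; apply: filterS2 => i; split.
Qed.

Lemma good_cvg : (\forall i \near U, good g Es (V i)) -> good g Es v.
Proof.
move=> H t; apply: (not_bad_cvg gc k_gt0 C_gt0 HA (flow_cvg gc t Vv)).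
move: V1 H; apply: filterS2 => i v1 vg; split; first exact: flow_SM.
by move=> u; rewrite -(flowD gc); exact: vg.
Qed.

End GoodOpen.

(** * Connectedness of the unit tangent bundle *)

Section Clopen.
Context {R : realType} {n : nat} {M : manifold R n} (g : riemannian_metric M).
Local Notation E := 'rV[R]_n.
Implicit Types (p q : M) (v : TM M).

(** Turns closedness under ultrafilter limits into a statement about neighbourhoods: a set that
    meets every neighbourhood of [t] belongs to some ultrafilter converging to [t]. *)
Lemma near_ultra (T : topologicalType) (D : set T) (t : T) :
  (forall U : set_system T, UltraFilter U -> U --> t -> U D -> False) -> \forall s \near t, ~ D s.
Proof.
move=> H; apply: contrapT => nD.
have PF : ProperFilter (within D (nbhs t)).
  apply: Build_ProperFilter_ex => A nA; apply: contrapT => /forallNP eA; apply: nD.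
  have nA' : \forall s \near t, D s -> A s by exact: nA.
  by apply: filterS nA' => s sA Ds; exact: eA (sA Ds).
have [U [UF sU]] := ultraFilterLemma PF.
apply: (H U UF); last by apply: sU; exact: withinT.
move=> A nA; apply: sU; have nA' : \forall s \near t, A s by exact: nA.
by have : \forall s \near t, D s -> A s by apply: filterS nA'.
Qed.

Context (P : TM M -> Prop).
Context (P_closed : forall (U : set_system R) (UF : UltraFilter U) (V : R -> TM M) v,
  vcvg U V v -> (\forall i \near U, SM g (V i)) -> (\forall i \near U, P (V i)) -> P v).
Context (nP_closed : forall (U : set_system R) (UF : UltraFilter U) (V : R -> TM M) v,
  vcvg U V v -> (\forall i \near U, SM g (V i)) -> (\forall i \near U, ~ P (V i)) -> ~ P v).

Lemma vcvg_sub (I : Type) (F F' : set_system I) (V : I -> TM M) v : F `<=` F' -> vcvg F V v -> vcvg F' V v.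
Proof.
move=> FF [Pp Xx]; split; first by apply: cvg_trans Pp => A; exact: FF.
by move=> q qv; apply: cvg_trans (Xx q qv) => A; exact: FF.
Qed.

Lemma path_clopen (V : R -> TM M) (a b : R) : (forall t, SM g (V t)) -> (forall t, vcvg (nbhs t) V (V t)) ->
  P (V a) -> P (V b).
Proof.
move=> V1 Vc; move: a b; apply: trans_local_total => [a b c ab bc /ab|t]; first exact.
suff H : exists2 Q : Prop, True & \forall s \near t, P (V s) <-> Q.
  have [Q _ HQ] := H; have [e e0 He] := nbhs_dist HQ.
  exists e => // a b ta tb Pa.
  by apply/(He b tb); apply/(He a ta).
have [Pt|nPt] := pselect (P (V t)); [exists True|exists False] => //.
  have : \forall s \near t, ~ ~ P (V s).
    apply: near_ultra => U UF Ut nU; apply: (nP_closed UF (vcvg_sub Ut (Vc t))) nU Pt.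
    by have PF : ProperFilter U := @ultra_proper _ _ UF; exact: filterE.
  by apply: filterS => s /contrapT.
have : \forall s \near t, ~ P (V s).
  apply: near_ultra => U UF Ut nU; apply: nPt; apply: (P_closed UF (vcvg_sub Ut (Vc t))) nU.
  by have PF : ProperFilter U := @ultra_proper _ _ UF; exact: filterE.
by apply: filterS => s.
Qed.

Definition unit_at q (X w : E) : TM M :=
  let p := ichart q X in (p, (Num.sqrt (ip g p (vec q p w) (vec q p w)))^-1 *: vec q p w).

Lemma ip_vec_gt0 q X (w : E) : cdom q X -> w != 0 -> 0 < ip g (ichart q X) (vec q (ichart q X) w) (vec q (ichart q X) w).
Proof.
move=> qX w0; rewrite lt_neqAle ip_ge0 andbT eq_sym; apply: contra w0 => /eqP/ip_eq0 e.
by rewrite -(tc_vec w (ichart_dom qX)) e tr0.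
Qed.

Lemma unit_at_SM q X (w : E) : cdom q X -> w != 0 -> SM g (unit_at q X w).
Proof.
move=> qX w0; apply/SM_ip; rewrite /unit_at /= ipZl ipZr.
have := ip_vec_gt0 qX w0; move: (ip g _ _ _) => a a0.
by rewrite mulrA -invfM -expr2 sqr_sqrtr ?ltW// mulVf// gt_eqF.
Qed.

Lemma unit_at_chart q v : dom M q v.1 -> SM g v -> unit_at q (chart q v.1) (tc q v.1 v.2) = v.
Proof.
move=> qv /SM_ip v1; rewrite /unit_at /= chartK// vec_tc// v1 sqrtr1 invr1 scale1r.
by case: (v).
Qed.

Lemma tc_neq0 q v : dom M q v.1 -> SM g v -> tc q v.1 v.2 != 0.
Proof.
move=> qv v1; apply: contra (vel_neq0 v1) => /eqP e.
by rewrite -(vec_tc v.2 qv) e tr0.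
Qed.

Lemma unit_at_cvg q (X W : R -> E) (t : R) : {for t, continuous X} -> {for t, continuous W} ->
  cdom q (X t) -> W t != 0 -> vcvg (nbhs t) (fun s => unit_at q (X s) (W s)) (unit_at q (X t) (W t)).
Proof.
move=> Xc Wc qX W0; pose p s := ichart q (X s).
have pc : p @ t --> p t.
  by apply: (@continuous_comp _ _ _ X (ichart q)); [exact: Xc|exact: ichart_continuous qX].
have qp : dom M q (p t) := ichart_dom qX.
have np : \forall s \near t, dom M q (p s) := near_dom_cvg pc qp.
have yc : xcvg (nbhs t) p (fun s => vec q (p s) (W s)) (p t) (vec q (p t) (W t)).
  apply: (xcvgP pc qp); rewrite tc_vec//.
  by apply: near_cvg Wc; apply: filterS np => s qs; rewrite tc_vec.
split; first exact: pc.
apply: (xcvgP pc qp).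
have ic : (fun s => (Num.sqrt (ip g (p s) (vec q (p s) (W s)) (vec q (p s) (W s))))^-1) @ t -->
    (Num.sqrt (ip g (p t) (vec q (p t) (W t)) (vec q (p t) (W t))))^-1.
  apply: cvgV; first by rewrite gt_eqF// sqrtr_gt0; exact: ip_vec_gt0.
  apply: (@cvg_comp _ _ _ (fun s => ip g (p s) (vec q (p s) (W s)) (vec q (p s) (W s))) Num.sqrt).
    exact: (ip_cvg pc yc yc).
  exact: sqrt_continuous.
rewrite /= trZ//; last exact: dom_center.
apply: near_cvg (cvgZ ic (yc q qp)); apply: filterS np => s qs.
by rewrite /= trZ//; exact: dom_center.
Qed.

(** The conditions on coordinate [i] make [w] and [w'] linearly independent, so the segment between
    them avoids 0 and can be normalized to a path of unit vectors over the segment from [X] to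
    [Y]. *)
Lemma segment_clopen q r (X Y w w' : E) (i : 'I_n) : ball (chart q q) r `<=` cdom q ->
  ball (chart q q) r X -> ball (chart q q) r Y -> w 0 i != 0 -> w' 0 i = 0 -> w' != 0 ->
  P (unit_at q X w) <-> P (unit_at q Y w').
Proof.
move=> Bq BX BY wi w'i w'0.
pose z (A B : E) (t : R) := A + step t *: (B - A).
have zc A B t : {for t, continuous (z A B)}.
  apply: cvgD; first exact: cvg_cst.
  apply: cvgZ; last exact: cvg_cst.
  by apply: derivable1_continuous; have [] := is_derive_step t.
have z0 A B : z A B 0 = A by rewrite /z step0 scale0r addr0.
have z1 A B : z A B 1 = B by rewrite /z step1 scale1r addrC subrK.
have qz t : cdom q (z X Y t) by apply: Bq; exact: ball_convex BX BY (step_itv t).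
have wz t : z w w' t != 0.
  apply/eqP => e; have := congr1 (fun u : E => u 0 i) e; rewrite /z !mxE w'i sub0r mulrN => e1.
  have : (1 - step t) * w 0 i = 0 by rewrite mulrBl mul1r.
  move=> /eqP; rewrite mulf_eq0 (negbTE wi) orbF subr_eq0 => /eqP s1.
  by move: e; rewrite /z -s1 scale1r addrC subrK => /eqP; rewrite (negbTE w'0).
pose V t := unit_at q (z X Y t) (z w w' t).
have V1 t : SM g (V t) by exact: unit_at_SM.
have Vc t : vcvg (nbhs t) V (V t) by exact: unit_at_cvg.
have -> : unit_at q X w = V 0 by rewrite /V !z0.
have -> : unit_at q Y w' = V 1 by rewrite /V !z1.
by split; exact: path_clopen.
Qed.

Context (n2 : (1 < n)%N).

(** If [w] and [w'] both have a nonzero coordinate [i], they may be opposite; the path then makes a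
    detour through a basis vector of another index, which exists as [n > 1]. *)
Lemma chart_clopen q r (X Y w w' : E) : ball (chart q q) r `<=` cdom q ->
  ball (chart q q) r X -> ball (chart q q) r Y -> w != 0 -> w' != 0 ->
  P (unit_at q X w) -> P (unit_at q Y w').
Proof.
move=> Bq BX BY /rV0Pn[i wi] w'0 PX.
have [w'i|w'i] := eqVneq (w' 0 i) 0; first exact/(segment_clopen Bq BX BY wi w'i w'0).
have [j ji] : exists j : 'I_n, j != i.
  have [i0|i0] := eqVneq (val i) 0%N; last by exists (Ordinal (ltnW n2)); rewrite -val_eqE eq_sym.
  by exists (Ordinal n2); rewrite -val_eqE /= i0.
pose d : E := delta_mx 0 j.
have di : d 0 i = 0 by rewrite mxE eqxx /= eq_sym (negbTE ji).
have d0 : d != 0 by apply/rV0Pn; exists j; rewrite mxE !eqxx oner_neq0.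
apply/(segment_clopen Bq BY BX w'i di d0).
exact/(segment_clopen Bq BX BX wi di d0).
Qed.

(** Connectedness is applied to [M], with the set of points over which all unit vectors satisfy [P].
    Having some unit vector over every point makes this set open and closed. *)
Lemma clopen_all (M_connected : connected [set: M]) v0 : SM g v0 -> P v0 -> forall v, SM g v -> P v.
Proof.
move=> v01 Pv0.
pose A : set M := [set y : M | forall v, SM g v -> v.1 = y -> P v].
suff AT : A = setT.
  move=> v v1; have Av : A v.1 by rewrite AT.
  exact: Av v v1 erefl.
have loc q : exists N : set M, nbhs q N /\ forall v v', N v.1 -> N v'.1 -> SM g v -> SM g v' -> P v -> P v'.
  have [D D0 [r r0 [Bq _]]] := reach_local g q.
  exists [set x | dom M q x /\ ball (chart q q) r (chart q x)]; split.
    apply: filterI; first by apply: open_nbhs_nbhs; split; [exact: dom_open|exact: dom_center].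
    have cc := @chart_continuous _ _ M q q (dom_center q).
    by apply: cc; apply: open_nbhs_nbhs; split; [exact: ball_open|exact: ballxx].
  move=> v v' [qv Bv] [qv' Bv'] v1 v1' Pv.
  rewrite -(unit_at_chart qv' v1'); apply: (chart_clopen Bq Bv Bv' (tc_neq0 qv v1) (tc_neq0 qv' v1')).
  by rewrite unit_at_chart.
have unit_ex y : exists2 v, SM g v & v.1 = y.
  have yy : cdom y (chart y y) := cdom_chart (dom_center y).
  have d0 : (delta_mx 0 (Ordinal n2) : E) != 0 by apply/rV0Pn; exists (Ordinal n2); rewrite mxE !eqxx oner_neq0.
  by exists (unit_at y (chart y y) (delta_mx 0 (Ordinal n2))); [exact: unit_at_SM|exact: (chartK (dom_center y))].
apply: M_connected.
- exists v0.1 => v v1 vv; have [N [nN H]] := loc v0.1.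
  by apply: H Pv0 => //; rewrite ?vv; exact: nbhs_singleton nN.
- exists A; last by rewrite setTI.
  rewrite openE => y Ay; rewrite /interior; have [N [nN H]] := loc y.
  have [v v1 vy] := unit_ex y; apply: filterS (nN) => x Nx v' v1' vx.
  apply: (H v v') => //; [by rewrite vy; exact: nbhs_singleton nN|by rewrite vx|exact: Ay].
- exists A; last by rewrite setTI.
  move=> y cy; have [N [nN H]] := loc y.
  have [x [Ax Nx]] := cy _ nN; have [v v1 vx] := unit_ex x => v' v1' v'y.
  apply: (H v v') => //; [by rewrite vx|by rewrite v'y; exact: nbhs_singleton nN|exact: Ax].
Qed.

End Clopen.

(** * Dimension at most one, and the absence of conjugate points *)

Section LowDimension.
Context {R : realType} {n : nat} {M : manifold R n} (g : riemannian_metric M) (gc : complete_metric g).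
Context (k C : R) (k_gt0 : 0 < k) (C_gt0 : 0 < C) (Es Eu : TM M -> {vspace TTM R n})
  (HA : anosov_splitting g k C Es Eu).

Lemma good_dim1 (v : TM M) : (n <= 1)%N -> SM g v -> good g Es v.
Proof.
move=> n1 v1 t [xi [xiE _]]; have := Es_dim gc k_gt0 C_gt0 HA (flow_SM gc t v1).
move=> e; have d0 : \dim (Es (flow g t v)) == 0%N by move: n1; rewrite -[X in (X <= 1)%N]e ltnS leqn0.
by move: xiE; rewrite (eqP (_ : Es (flow g t v) == 0%VS)) -?dimv_eq0// memv0 => /eqP ->; rewrite eqxx.
Qed.

End LowDimension.

Theorem theorem4 (R : realType) (beta k C sigma : R)
    (k_gt0 : 0 < k) (C_gt0 : 0 < C) (sigma_gt0 : 0 < sigma)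
    (sigmaP : conjugacy_constant beta k C sigma)
    (n : nat) (M : manifold R n) (g : riemannian_metric M)
    (g_complete : complete_metric g)
    (M_connected : connected [set: M])
    (M_noncompact : ~ compact [set: M])
    (g_curvature : sectional_bounded_below g (- beta ^+ 2))
    (g_anosov : anosov g k C)
    (escape : forall v : TM M, SM g v ->
       exists U : set (TM M), [/\ SM_open g U, U v &
         forall A : R, exists T : R, forall c : R -> M,
           unit_geodesic g c -> U (velocity_lift c 0) ->
           forall t, T <= t -> A <= dist g (c 0) (c t)])
    (no_conj_far : exists2 K : set M, compact K &
       forall p : M, ~ K p -> forall c : R -> M,
         unit_geodesic g c -> c 0 = p ->
         ~ conjugate_points_on g c `[-1, sigma])
    (no_conj_one : exists2 c : R -> M,
       unit_geodesic g c & ~ conjugate_points_on g c setT) :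
  forall c : R -> M, unit_geodesic g c -> ~ conjugate_points_on g c setT.

Proof.
have gc := g_complete; have [Es [Eu HA]] := g_anosov.
have sig := sigmaP n M g Es Eu gc g_curvature HA.
have [K K_compact far_conj] := no_conj_far.
have bad_conj v : SM g v -> bad g Es v -> conjugate_points_on g (geodesic_of g v) `[-1, sigma].
  by move=> v1 vb; exact: sig v v1 vb.
have far v : SM g v -> ~ K v.1 -> ~ bad g Es v.
  move=> v1 nK /(bad_conj v v1); apply: (far_conj v.1 nK); first exact: unit_geodesic_of.
  by have := flow0 gc v => /(congr1 fst).
have lift_SM c : unit_geodesic g c -> SM g (velocity_lift c 0) by move=> [_ /(_ 0)].
have [c1 c1u c1n] := no_conj_one.
(* A bad vector at time [t] would give conjugate points on [[-1, sigma]] of the geodesic shifted by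
   [t], hence of [c1]. *)
have good1 : good g Es (velocity_lift c1 0).
  move=> t bt; apply: c1n; have [c1g _] := c1u.
  have := bad_conj _ (flow_SM gc t (lift_SM _ c1u)) bt.
  rewrite -(geodesic_flow gc t c1g).
  have := velocity_lift_shift c1 t 0; rewrite addr0 => <-.
  rewrite (geodesic_of_lift gc (geodesic_shift t c1g)).
  exact: conjugate_shift.
have good_all v : SM g v -> good g Es v.
  (* For [n = 1] the unit tangent bundle need not be connected, but [Es] has dimension [n - 1 = 0]
     and contains no bad direction. *)
  have [n1|n2] := leqP n 1; first exact: (good_dim1 gc k_gt0 C_gt0 HA n1).
  apply: (@clopen_all _ _ _ g (good g Es) _ _ n2 M_connected _ (lift_SM _ c1u) good1) => U UF V w Vw V1.
    exact: (good_cvg gc k_gt0 C_gt0 HA Vw V1).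
  exact: (not_good_cvg gc k_gt0 C_gt0 HA M_connected escape K_compact far Vw V1).
move=> c cu; have [cg _] := cu; rewrite -(geodesic_of_lift gc cg).
exact: (good_no_conj gc k_gt0 C_gt0 HA (lift_SM _ cu) (good_all _ (lift_SM _ cu))).
Qed.
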